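(* Assume $\Sigma$ is reduced. The (not necessarily pointwise) stabilizer $\operatorname{Stab}'_{G_{\mathbb{F}}}(\mathbb{A})=\{g\in G_{\mathbb{F}}:g.\mathbb{A}=\mathbb{A}\}$ of $\mathbb{A}$ is $$\operatorname{Stab}'_{G_{\mathbb{F}}}(\mathbb{A})=\operatorname{Nor}_{G_{\mathbb{F}}}(A_{\mathbb{F}})=A_{\mathbb{F}}N_{\mathbb{F}}.$$
   Context: Let $\mathbb{K},\mathbb{F}$ be real closed fields with $\mathbb{K}\subseteq\mathbb{R}\cap\mathbb{F}$. Let $O\subsetneq\mathbb{F}$ be an order convex subring ($a,b\in O$ and $a\le c\le b$ imply $c\in O$); it is a valuation ring. Let $\Lambda=\mathbb{F}^\times/O^\times$, written additively, and let $v:\mathbb{F}\to\Lambda\cup\{\infty\}$ be the associated valuation, with $\Lambda$ ordered so that $(-v)(a)\ge(-v)(b)$ whenever $a\ge b>0$; thus $O=\{a:(-v)(a)\le 0\}$. For a semialgebraic set $V$ defined over $\mathbb{K}$, $V_{\mathbb{F}}$ denotes its $\mathbb{F}$-extension. $G<\operatorname{SL}_n$ is a connected semisimple algebraic group over $\mathbb{K}$, self-adjoint ($g\in G$ implies $g^{\mathsf T}\in G$). $S<G$ is a maximal $\mathbb{K}$-split torus with $s=s^{\mathsf T}$ for all $s\in S$; $A_{\mathbb{F}}$ is the $\mathbb{F}$-extension of the semialgebraic connected component of $S_{\mathbb{K}}$ containing $\operatorname{Id}$; $K_{\mathbb{F}}=G_{\mathbb{F}}\cap\operatorname{SO}_n(\mathbb{F})$;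 the group $N_{\mathbb{F}}=\operatorname{Nor}_{K_{\mathbb{F}}}(A_{\mathbb{F}})$. Let $\mathfrak{a}=\operatorname{Lie}(A_{\mathbb{R}})$; $\Sigma\subseteq\mathfrak{a}^\star$ is the root system of $\operatorname{Lie}(G_{\mathbb{R}})$ with respect to $\mathfrak{a}$; reduced means $\alpha\in\Sigma\Rightarrow2\alpha\notin\Sigma$. For $\alpha\in\Sigma$, $\chi_\alpha:A_{\mathbb{F}}\to\mathbb{F}_{>0}$ is the restriction of the algebraic character of $S$ over $\mathbb{K}$ which over $\mathbb{R}$ satisfies $\chi_\alpha(\exp H)=e^{\alpha(H)}$, $H\in\mathfrak{a}$. Fix a basis $\Delta$ of $\Sigma$; let $A^+_{\mathbb{F}}=\{a\in A_{\mathbb{F}}:\chi_\alpha(a)\ge1\ \forall\alpha\in\Delta\}$. $G_{\mathbb{F}}$ acts on symmetric positive definite matrices of determinant $1$ over $\mathbb{F}$ by $g.x=gxg^{\mathsf T}$, and $\mathcal{X}_{\mathbb{F}}=G_{\mathbb{F}}.\operatorname{Id}$. For $x=g.\operatorname{Id}$, $y=h.\operatorname{Id}$, $\delta_{\mathbb{F}}(x,y)$ is the unique $a\in A^+_{\mathbb{F}}$ with $g^{-1}h\in K_{\mathbb{F}}aK_{\mathbb{F}}$. Put $\|a\|=\prod_{\alpha\in\Sigma}\max\{\chi_\alpha(a),\chi_\alpha(a)^{-1}\}$ for $a\in A_{\mathbb{F}}$, and $d(x,y)=(-v)(\|\delta_{\mathbb{F}}(x,y)\|)\in\Lambda$, a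 $G_{\mathbb{F}}$-invariant pseudo-distance. $\mathcal{B}=\mathcal{X}_{\mathbb{F}}/\!\sim$ with $x\sim y$ iff $d(x,y)=0$, with the induced $G_{\mathbb{F}}$-action; $o\in\mathcal{B}$ is the class of $\operatorname{Id}$; $\mathbb{A}=A_{\mathbb{F}}.o\subseteq\mathcal{B}$. *)

(* Defs.v *)
(* [mpoly] is not imported: its notations clash with those of [all_analysis]. *)
From HB Require Import structures.
From mathcomp Require Import all_boot all_order all_algebra.
From mathcomp Require Import all_classical all_reals all_analysis.
From mathcomp Require Import complex.
From mathcomp Require mpoly.

Set Implicit Arguments.
Unset Strict Implicit.
Unset Printing Implicit Defensive.

Import Order.TTheory GRing.Theory Num.Theory.
Import numFieldNormedType.Exports.

Local Open Scope classical_set_scope.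
Local Open Scope ring_scope.

Definition peval (m : nat) (K L : comNzRingType) (i : K -> L) (x : 'I_m -> L)
    (p : mpoly.mpoly m K) : L :=
  mpoly.mmap i x p.

(* Polynomials in the n * n matrix entries, enumerated by [mxvec]. *)
Definition mxpolynomial (n : nat) (K : comNzRingType) := mpoly.mpoly (n * n) K.

Definition mxeval (n : nat) (K L : comNzRingType) (i : K -> L)
    (p : mxpolynomial n K) (A : 'M[L]_n) : L :=
  peval i (fun j => mxvec A 0 j) p.

Definition zeros (n : nat) (K L : comNzRingType) (i : K -> L)
    (P : set (mxpolynomial n K)) : set 'M[L]_n :=
  [set A | forall p, P p -> mxeval i p A = 0].

Definition mxgroup (n : nat) (L : fieldType) (H : set 'M[L]_n) : Prop :=
  [/\ H 1%:M,
      (forall A B, H A -> H B -> H (A *m B)) &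
      (forall A, H A -> A \in unitmx /\ H (invmx A))].

Definition mxconj (n : nat) (L : fieldType) (g A : 'M[L]_n) : 'M[L]_n :=
  g *m A *m invmx g.

Definition mxnormalizer (n : nat) (L : fieldType) (H B : set 'M[L]_n) :
    set 'M[L]_n :=
  [set g | H g /\ [set mxconj g b | b in B] = B].

Definition derived (n : nat) (L : fieldType) (H : set 'M[L]_n) :
    set 'M[L]_n :=
  \bigcap_(N in [set N | mxgroup N /\
      forall A B, H A -> H B -> N (A *m B *m invmx A *m invmx B)]) N.

Definition mxsolvable (n : nat) (L : fieldType) (H : set 'M[L]_n) : Prop :=
  exists k, iter k (@derived n L) H `<=` [set 1%:M].

Definition zclosed (n : nat) (L : fieldType) (Z : set 'M[L]_n) : Prop :=
  exists P : set (mxpolynomial n L), Z = zeros idfun P.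

Definition zconnected (n : nat) (L : fieldType) (Z : set 'M[L]_n) : Prop :=
  forall Z1 Z2 : set 'M[L]_n, zclosed Z1 -> zclosed Z2 ->
    Z1 `|` Z2 = Z -> Z1 `&` Z2 = set0 -> Z1 = set0 \/ Z2 = set0.

(* An algebraic set over [K] is given by polynomials with coefficients in [K];
   connectedness, semisimplicity, etc. refer to its points over the algebraic
   closure [K[i]], for the Zariski topology. *)
Definition geom (n : nat) (K : rcfType) (P : set (mxpolynomial n K)) :
    set 'M[K[i]]_n :=
  zeros (real_complex K) P.

Definition alg_subgroup_SL (n : nat) (K : rcfType) (G : set (mxpolynomial n K)) :
    Prop :=
  mxgroup (geom G) /\ (forall g, geom G g -> \det g = 1).

(* The radical is trivial. *)
Definition semisimple (n : nat) (L : fieldType) (G : set 'M[L]_n) : Prop :=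
  forall H : set 'M[L]_n,
    mxgroup H -> H `<=` G -> zclosed H -> zconnected H ->
    (forall g h, G g -> H h -> H (mxconj g h)) -> mxsolvable H ->
    H = [set 1%:M].

(* The point (t, t^-1) at which Laurent polynomials in [d] variables, written
   as polynomials in [d + d] variables, are evaluated. *)
Definition laurent_pt (d : nat) (L : fieldType) (t : 'I_d -> L) :
    'I_(d + d) -> L :=
  fun j => match fintype.split j with inl i => t i | inr i => (t i)^-1 end.

Definition mor_of_Gm (n d : nat) (K : rcfType)
    (phi : 'I_n -> 'I_n -> mpoly.mpoly (d + d) K) (t : 'I_d -> K[i]) :
    'M[K[i]]_n :=
  \matrix_(i, j) peval (real_complex K) (laurent_pt t) (phi i j).

(* [S], assumed to be a closed subgroup of SL_n, is isomorphic over [K] to the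
   [d]-th power of the multiplicative group: [phi] and [psi] are mutually
   inverse morphisms.  As det = 1 on [S], regular functions on [S] are
   restrictions of polynomials in the matrix entries. *)
Definition split_torus (n : nat) (K : rcfType) (S : set (mxpolynomial n K)) : Prop :=
  alg_subgroup_SL S /\
  exists (d : nat) (phi : 'I_n -> 'I_n -> mpoly.mpoly (d + d) K)
         (psi : 'I_d -> mxpolynomial n K),
    [/\ (forall t, (forall i, t i != 0) -> geom S (mor_of_Gm phi t)),
        (forall t u, (forall i, t i != 0) -> (forall i, u i != 0) ->
           mor_of_Gm phi (fun i => t i * u i)
             = mor_of_Gm phi t *m mor_of_Gm phi u),
        (forall s i, geom S s -> mxeval (real_complex K) (psi i) s != 0),
        (forall s, geom S s ->
           mor_of_Gm phi (fun i => mxeval (real_complex K) (psi i) s) = s) &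
        (forall t i, (forall i, t i != 0) ->
           mxeval (real_complex K) (psi i) (mor_of_Gm phi t) = t i)].

Definition maximal_split_torus (n : nat) (K : rcfType)
    (G S : set (mxpolynomial n K)) : Prop :=
  [/\ split_torus S, geom S `<=` geom G &
      forall T : set (mxpolynomial n K), split_torus T -> geom T `<=` geom G ->
        geom S `<=` geom T -> geom T = geom S].

Definition alg_character (n : nat) (K : rcfType) (S : set (mxpolynomial n K))
    (c : mxpolynomial n K) : Prop :=
  (forall s, geom S s -> mxeval (real_complex K) c s != 0) /\
  (forall s t, geom S s -> geom S t ->
     mxeval (real_complex K) c (s *m t)
       = mxeval (real_complex K) c s * mxeval (real_complex K) c t).

(* A list of pairs (p, q) describes the finite union of the sets
   { p_1 = ... = p_k = 0, q_1 > 0, ..., q_l > 0 }; every semialgebraic set has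
   this form. *)

Definition sadesc (n : nat) (K : rcfType) :=
  seq (seq (mxpolynomial n K) * seq (mxpolynomial n K)).

(* For [i : K -> L], the [L]-extension of the set described by [V]. *)
Definition saext (n : nat) (K L : rcfType) (i : K -> L) (V : sadesc n K) :
    set 'M[L]_n :=
  [set A | has (fun c => all (fun p => mxeval i p A == 0) c.1
                      && all (fun q => 0 < mxeval i q A) c.2) V].

Definition semialgebraic (n : nat) (K : rcfType) (V : set 'M[K]_n) : Prop :=
  exists D : sadesc n K, V = saext idfun D.

Definition closed_in (T : topologicalType) (V B : set T) : Prop :=
  exists C : set T, closed C /\ B = V `&` C.

Definition sa_connected (n : nat) (K : rcfType) (V : set 'M[K]_n) : Prop :=
  forall B1 B2 : set 'M[K]_n, semialgebraic B1 -> semialgebraic B2 ->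
    closed_in V B1 -> closed_in V B2 ->
    B1 `|` B2 = V -> B1 `&` B2 = set0 -> B1 = V \/ B2 = V.

Definition sa_component (n : nat) (K : rcfType) (V : set 'M[K]_n)
    (x : 'M[K]_n) (C : set 'M[K]_n) : Prop :=
  [/\ semialgebraic C, C `<=` V, C x, sa_connected C &
      forall C' : set 'M[K]_n, semialgebraic C' -> C' `<=` V -> C' x ->
        sa_connected C' -> C' `<=` C].

Definition expmx (n : nat) (R : realType) (X : 'M[R]_n) : 'M[R]_n :=
  \matrix_(i, j) limn (fun N : nat => \sum_(k < N) (X ^+ k) i j / (k`!)%:R).

(* The Lie algebra of a closed subgroup of GL_n(R), as the set of generators of
   its one-parameter subgroups. *)
Definition lie (n : nat) (R : realType) (H : set 'M[R]_n) : set 'M[R]_n :=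
  [set X | forall t : R, H (expmx (t *: X))].

Definition dual (n : nat) (R : realType) (a : {vspace 'M[R]_n}) :=
  'Hom(subvs_of a, R^o).

Definition root_system (n : nat) (R : realType) (g : set 'M[R]_n)
    (a : {vspace 'M[R]_n}) : set (dual a) :=
  [set alpha : dual a | alpha <> 0 /\
     exists X : 'M[R]_n, [/\ g X, X <> 0 &
       forall H : subvs_of a,
         vsval H *m X - X *m vsval H = (alpha H : R) *: X]].

Arguments root_system {n R} g a _.

Definition reduced (n : nat) (R : realType) (a : {vspace 'M[R]_n})
    (Sigma : set (dual a)) : Prop :=
  forall alpha, Sigma alpha -> ~ Sigma (alpha *+ 2).

Definition root_basis (n : nat) (R : realType) (a : {vspace 'M[R]_n})
    (Sigma : set (dual a)) (Delta : seq (dual a)) : Prop :=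
  [/\ (forall alpha, alpha \in Delta -> Sigma alpha),
      basis_of fullv Delta &
      forall beta, Sigma beta -> exists c : dual a -> nat,
        beta = \sum_(alpha <- Delta) alpha *+ c alpha \/
        beta = - \sum_(alpha <- Delta) alpha *+ c alpha].

(* [chi alpha] is a polynomial over [K] inducing the character chi_alpha. *)
Definition root_characters (n : nat) (K : rcfType) (R : realType)
    (iR : K -> R) (S : set (mxpolynomial n K)) (a : {vspace 'M[R]_n})
    (Sigma : set (dual a)) (chi : dual a -> mxpolynomial n K) : Prop :=
  forall alpha, Sigma alpha ->
    alg_character S (chi alpha) /\
    forall H : subvs_of a,
      mxeval iR (chi alpha) (expmx (vsval H)) = expR (alpha H : R).

Definition order_convex_subring (F : rcfType) (O : set F) : Prop :=
  [/\ O 1,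
      (forall a b, O a -> O b -> O (a - b)),
      (forall a b, O a -> O b -> O (a * b)) &
      (forall a b c, O a -> O b -> a <= c -> c <= b -> O c)].

Definition ounit (F : rcfType) (O : set F) : set F :=
  [set u | [/\ u != 0, O u & O u^-1]].

(* The valuation of a nonzero [a].  Elements of Lambda = F^x / O^x are
   represented as cosets in F, so the additively written zero is [vl O 1]. *)
Definition vl (F : rcfType) (O : set F) (a : F) : set F :=
  [set a * u | u in ounit O].

Definition negv (F : rcfType) (O : set F) (a : F) : set F := vl O a^-1.

Definition SO (n : nat) (F : fieldType) : set 'M[F]_n :=
  [set k | k *m k^T = 1%:M /\ \det k = 1].

Arguments SO n F _ : clear implicits.

Definition act (n : nat) (F : fieldType) (g x : 'M[F]_n) : 'M[F]_n :=
  g *m x *m g^T.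

Definition XX (n : nat) (F : fieldType) (G : set 'M[F]_n) : set 'M[F]_n :=
  [set act g 1%:M | g in G].

Section Building.
Context (n : nat) (K F : rcfType) (R : realType) (iF : K -> F).
Context (a : {vspace 'M[R]_n}).
(* [G] and [A] stand for G_F and A_F. *)
Context (O : set F) (G A : set 'M[F]_n).
Context (Sigma : set (dual a)) (Delta : seq (dual a)).
Context (chi : dual a -> mxpolynomial n K).

Definition chamber : set 'M[F]_n :=
  [set x | A x /\ forall alpha, alpha \in Delta -> 1 <= mxeval iF (chi alpha) x].

Definition KF : set 'M[F]_n := G `&` SO n F.

(* The default value 1 is irrelevant: on [XX G] there is exactly one such
   element by the Cartan decomposition. *)
Definition delta (x y : 'M[F]_n) : 'M[F]_n :=
  xget 1%:M [set c | chamber c /\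
    exists g h, [/\ G g, G h, x = act g 1%:M, y = act h 1%:M &
      exists k1 k2, [/\ KF k1, KF k2 & invmx g *m h = k1 *m c *m k2]]].

Definition mnorm (x : 'M[F]_n) : F :=
  \big[*%R/1]_(alpha \in Sigma)
    Num.max (mxeval iF (chi alpha) x) (mxeval iF (chi alpha) x)^-1.

Definition dist (x y : 'M[F]_n) : set F := negv O (mnorm (delta x y)).

(* Points of the building are equivalence classes, as subsets of [XX G]. *)
Definition bclass (x : 'M[F]_n) : set 'M[F]_n :=
  [set y | XX G y /\ dist x y = vl O 1].

Definition building : set (set 'M[F]_n) := [set bclass x | x in XX G].

Definition bact (g : 'M[F]_n) (p : set 'M[F]_n) : set 'M[F]_n :=
  [set act g x | x in p].

Definition base_pt : set 'M[F]_n := bclass 1%:M.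

Definition apartment : set (set 'M[F]_n) := [set bact g base_pt | g in A].

Definition stab_apartment : set 'M[F]_n :=
  [set g | G g /\ [set bact g p | p in apartment] = apartment].

End Building.

(* Main.v *)
(** In split coordinates the component [A] of [1] is the set of points of [S] with positive
    coordinates, over every real closed field, and Tarski's principle moves first-order statements
    between [K], [R] and [F].  Two such statements carry the proof.

    First, a positive diagonalizable element of [G] commuting with [A] lies in [A]: together with
    [A] it would otherwise generate a group whose Zariski closure contains a split torus larger
    than [S].

    Second, the Cartan decomposition [G = K A^+ K].  Over the reals, let [X] be the logarithm of
    [g^T g] and let [k] maximize [tr (k X k^T H0)], where the simple roots take the value [1] at
    [H0].  The first derivative shows that [k X k^T] commutes with [H0], hence lies in the Lie
    algebra of [A]; the second derivative, in the directions [X_alpha - X_alpha^T], shows that it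
    lies in the closed chamber.

    Over [F] the class [o] then consists of the points of [XX] with entries in [O], its stabilizer
    is the set of [h] in [G] with entries in [O], and the pointwise stabilizer of the apartment is
    the set of [h] such that all [b^-1 h b], [b] in [A], have entries in [O].  As the ratio of two
    distinct coordinate characters of [A] takes all positive values, such an [h] centralizes [A].
    If [g] stabilizes the apartment, the pointwise stabilizer, which contains the [K]-points of
    [A], is invariant under conjugation by [g]; thus [g^-1 A g] commutes with these points, hence
    with [A], so it lies in [A] by the first statement.  Finally, in a polar decomposition
    [g = k p] of an element normalizing [A], [p^2] commutes with [A] because [p a p^-1] is
    symmetric, so [p] is in [A]. *)
Require Import Defs.
From HB Require Import structures.
From mathcomp Require Import all_boot all_order all_algebra.
From mathcomp Require Import all_classical all_reals all_analysis.
From mathcomp Require Import complex.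
From mathcomp Require mpoly.
From mathcomp Require qe_rcf_th qe_rcf mxtens.

Set Implicit Arguments.
Unset Strict Implicit.
Unset Printing Implicit Defensive.

Import Order.TTheory GRing.Theory Num.Theory.
Import numFieldNormedType.Exports.

Local Open Scope classical_set_scope.
Local Open Scope ring_scope.

(** * Tarski transfer between real closed fields *)

Module Q := mathcomp.real_closed.qe_rcf.

(** The fields [R] and [F] both contain [K] but are not comparable, so every transfer passes through
    [K]. Connectedness, compactness, exponentials and logarithms are used over [R] alone; what
    leaves [R] is rephrased in first-order form: inverses become variables, closedness is written
    with epsilons, logarithmic estimates become power estimates with an integer exponent. Maximality
    of the torus is not first-order either; it is exploited for points over [K], and its consequence
    is transferred. Zariski closures are handled by Dedekind's independence of characters: an
    equation restricted to a diagonal group is a linear relation between characters, so it persists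
    wherever equal characters take equal values. The Lie algebra is defined by one-parameter
    subgroups, so its linearity needs an argument; coefficients of representations supply it.
    Finally, [K] lies in the archimedean field [R], which forces its image in [F] into [O]: this is
    why the change to torus coordinates is integral and why the [K]-points of the torus fix the
    apartment pointwise. *)

Lemma ler_rcf_rmorph (K L : rcfType) (i : {rmorphism K -> L}) x y :
  (i x <= i y) = (x <= y).
Proof.
have pos (z : K) : 0 <= z -> 0 <= i z.
  by move=> /sqr_sqrtr <-; rewrite rmorphXn /= sqr_ge0.
have [xy|yx] := leP x y; first by rewrite -subr_ge0 -rmorphB pos // subr_ge0.
apply/negbTE; rewrite -ltNge lt_neqAle fmorph_eq (lt_eqF yx) /=.
by rewrite -subr_ge0 -rmorphB pos // subr_ge0 ltW.
Qed.

Lemma ltr_rcf_rmorph (K L : rcfType) (i : {rmorphism K -> L}) x y :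
  (i x < i y) = (x < y).
Proof. by rewrite !ltNge ler_rcf_rmorph. Qed.

(* The quantifier elimination of [qe_rcf] manipulates formulas only syntactically, so that it
   commutes with the renaming of constants along [i]. *)
Section MapSyntax.
Variables (K L : rcfType) (i : {rmorphism K -> L}).

Fixpoint mapt (t : Q.term K) : Q.term L :=
  match t with
  | Q.Var n => Q.Var _ n
  | Q.Const c => Q.Const (i c)
  | Q.NatConst n => Q.NatConst _ n
  | Q.Add t u => Q.Add (mapt t) (mapt u)
  | Q.Opp t => Q.Opp (mapt t)
  | Q.NatMul t n => Q.NatMul (mapt t) n
  | Q.Mul t u => Q.Mul (mapt t) (mapt u)
  | Q.Exp t n => Q.Exp (mapt t) n
  end.

Fixpoint mapf (f : Q.formula K) : Q.formula L :=
  match f with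
  | Q.Bool b => Q.Bool b
  | Q.Equal t u => Q.Equal (mapt t) (mapt u)
  | Q.Lt t u => Q.Lt (mapt t) (mapt u)
  | Q.Le t u => Q.Le (mapt t) (mapt u)
  | Q.And f g => Q.And (mapf f) (mapf g)
  | Q.Or f g => Q.Or (mapf f) (mapf g)
  | Q.Implies f g => Q.Implies (mapf f) (mapf g)
  | Q.Not f => Q.Not (mapf f)
  end.

Notation mp := (map mapt).

(** The elimination procedure is written in continuation-passing style, so commutation with [mapf]
    is proved for each routine under the assumption that the continuations [k] and [k']
    correspond. *)
Lemma map_Size p k k' : (forall n, mapf (k n) = k' n) ->
  mapf (Q.Size p k) = Q.Size (mp p) k'.
Proof.
elim: p k k' => [|c p IH] k k' kk' /=; first exact: kk'.
by apply: IH => -[|m] /=; rewrite ?kk'.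
Qed.

Lemma map_Isnull p k k' : (forall n, mapf (k n) = k' n) ->
  mapf (Q.Isnull p k) = Q.Isnull (mp p) k'.
Proof. by move=> kk'; apply: map_Size => n; apply: kk'. Qed.

Lemma map_LtSize p q k k' : (forall n, mapf (k n) = k' n) ->
  mapf (Q.LtSize p q k) = Q.LtSize (mp p) (mp q) k'.
Proof. by move=> kk'; apply: map_Size => n; apply: map_Size => m; apply: kk'. Qed.

Lemma map_LeadCoef p k k' : (forall t, mapf (k t) = k' (mapt t)) ->
  mapf (Q.LeadCoef p k) = Q.LeadCoef (mp p) k'.
Proof.
elim: p k k' => [|c p IH] k k' kk' /=; first by rewrite kk' /= rmorph0.
by apply: IH => t /=; rewrite !kk'.
Qed.

Lemma map_AmulXn a n : mp (Q.AmulXn a n) = Q.AmulXn (mapt a) n.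
Proof. by elim: n => //= n ->; rewrite rmorph0. Qed.

Lemma map_AddPoly p q : mp (Q.AddPoly p q) = Q.AddPoly (mp p) (mp q).
Proof. by elim: p q => [|a p IH] [|b q] //=; rewrite IH. Qed.

Lemma map_ScalPoly c p : mp (Q.ScalPoly c p) = Q.ScalPoly (mapt c) (mp p).
Proof. by rewrite /Q.ScalPoly -!map_comp; apply: eq_map. Qed.

Lemma map_MulPoly p q : mp (Q.MulPoly p q) = Q.MulPoly (mp p) (mp q).
Proof.
by elim: p => //= a p IH; rewrite map_AddPoly map_ScalPoly /= IH.
Qed.

Lemma map_ExpPoly p n : mp (Q.ExpPoly p n) = Q.ExpPoly (mp p) n.
Proof.
case: n => // n; rewrite /Q.ExpPoly !iteropS.
by elim: n => // n IH; rewrite !iterS map_MulPoly IH.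
Qed.

Lemma map_OppPoly p : mp (Q.OppPoly p) = Q.OppPoly (mp p).
Proof. by rewrite /Q.OppPoly map_ScalPoly /= rmorphN1. Qed.

Lemma map_NatMulPoly n p : mp (Q.NatMulPoly n p) = Q.NatMulPoly n (mp p).
Proof. exact: map_ScalPoly. Qed.

Lemma map_Deriv p : mp (Q.Deriv p) = Q.Deriv (mp p).
Proof. by elim: p => //= a p IH; rewrite map_AddPoly /= IH. Qed.

Lemma map_Rediv_rec_loop q sq cq c qq r n k k' :
  (forall c qq r, mapf (k (c, qq, r)) = k' (c, mp qq, mp r)) ->
  mapf (Q.Rediv_rec_loop q sq cq c qq r n k)
  = Q.Rediv_rec_loop (mp q) sq (mapt cq) c (mp qq) (mp r) n k'.
Proof.
elim: n c qq r k k' => [|n IH] c qq r k k' kk' /=;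
  apply: map_Size => m; case: ifP => _; rewrite ?kk' //;
  apply: map_LeadCoef => l.
  by rewrite kk' !map_AddPoly !map_OppPoly !map_MulPoly !map_AmulXn.
rewrite (IH _ _ _ _ k') //.
by rewrite !map_AddPoly !map_OppPoly !map_MulPoly !map_AmulXn.
Qed.

Lemma map_Rediv p q k k' :
  (forall c qq r, mapf (k (c, qq, r)) = k' (c, mp qq, mp r)) ->
  mapf (Q.Rediv p q k) = Q.Rediv (mp p) (mp q) k'.
Proof.
move=> kk'; apply: map_Isnull => -[].
  by rewrite kk' /= rmorph0.
apply: map_Size => n; apply: map_Size => m; apply: map_LeadCoef => l.
by rewrite (map_Rediv_rec_loop _ _ _ _ _ _ _ (k' := k')) //= rmorph0.
Qed.

Lemma map_Rmod p q k k' : (forall p, mapf (k p) = k' (mp p)) ->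
  mapf (Q.Rmod p q k) = Q.Rmod (mp p) (mp q) k'.
Proof. by move=> kk'; apply: map_Rediv => c qq r; rewrite kk'. Qed.

Lemma map_Rscal p q k k' : (forall n, mapf (k n) = k' n) ->
  mapf (Q.Rscal p q k) = Q.Rscal (mp p) (mp q) k'.
Proof. by move=> kk'; apply: map_Rediv => c qq r; rewrite kk'. Qed.

Lemma map_Rgcd_loop n p q k k' : (forall p, mapf (k p) = k' (mp p)) ->
  mapf (Q.Rgcd_loop n p q k) = Q.Rgcd_loop n (mp p) (mp q) k'.
Proof.
elim: n p q k k' => [|n IH] p q k k' kk' /=; apply: map_Rmod => r;
  apply: map_Isnull => -[]; rewrite ?kk' //; exact: IH.
Qed.

Lemma map_Rgcd p q k k' : (forall p, mapf (k p) = k' (mp p)) ->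
  mapf (Q.Rgcd p q k) = Q.Rgcd (mp p) (mp q) k'.
Proof.
move=> kk'; apply: map_LtSize => -[]; apply: map_Isnull => -[]; rewrite ?kk' //;
  apply: map_Size => n; exact: map_Rgcd_loop.
Qed.

Lemma map_BigRgcd ps k k' : (forall p, mapf (k p) = k' (mp p)) ->
  mapf (Q.BigRgcd ps k) = Q.BigRgcd (map mp ps) k'.
Proof.
elim: ps k k' => [|p ps IH] k k' kk' /=; first by rewrite kk' /= rmorph0.
by apply: IH => r; apply: map_Rgcd.
Qed.

Lemma map_Changes s k k' : (forall n, mapf (k n) = k' n) ->
  mapf (Q.Changes s k) = Q.Changes (mp s) k'.
Proof.
elim: s k k' => [|a s IH] k k' kk' /=; first exact: kk'.
apply: IH => n /=; rewrite !kk'.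
suff -> : mapt (head (Q.NatConst K 0) s) = head (Q.NatConst L 0) (mp s) by [].
by case: (s).
Qed.

Lemma map_SeqPInfty ps k k' : (forall p, mapf (k p) = k' (mp p)) ->
  mapf (Q.SeqPInfty ps k) = Q.SeqPInfty (map mp ps) k'.
Proof.
elim: ps k k' => [|p ps IH] k k' kk' /=; first exact: kk'.
by apply: map_LeadCoef => t; apply: IH => r; apply: kk'.
Qed.

Lemma map_SeqMInfty ps k k' : (forall p, mapf (k p) = k' (mp p)) ->
  mapf (Q.SeqMInfty ps k) = Q.SeqMInfty (map mp ps) k'.
Proof.
elim: ps k k' => [|p ps IH] k k' kk' /=; first exact: kk'.
apply: map_LeadCoef => t; apply: map_Size => n; apply: IH => r.
by rewrite kk' /= rmorphN1.
Qed.

Lemma map_ChangesPoly ps k k' : (forall n, mapf (k n) = k' n) ->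
  mapf (Q.ChangesPoly ps k) = Q.ChangesPoly (map mp ps) k'.
Proof.
move=> kk'; apply: map_SeqMInfty => p; apply: map_SeqPInfty => q.
by apply: map_Changes => n; apply: map_Changes => m; apply: kk'.
Qed.

Lemma map_NextMod p q k k' : (forall p, mapf (k p) = k' (mp p)) ->
  mapf (Q.NextMod p q k) = Q.NextMod (mp p) (mp q) k'.
Proof.
move=> kk'; apply: map_LeadCoef => l; apply: map_Rscal => n.
by apply: map_Rmod => r; rewrite kk' map_ScalPoly.
Qed.

Lemma map_ModsAux p q n k k' : (forall p, mapf (k p) = k' (map mp p)) ->
  mapf (Q.ModsAux p q n k) = Q.ModsAux (mp p) (mp q) n k'.
Proof.
elim: n p q k k' => [|n IH] p q k k' kk' /=; first exact: kk'.
apply: map_Isnull => -[]; rewrite ?kk' //.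
by apply: map_NextMod => r; apply: IH => s; apply: kk'.
Qed.

Lemma map_Mods p q k k' : (forall p, mapf (k p) = k' (map mp p)) ->
  mapf (Q.Mods p q k) = Q.Mods (mp p) (mp q) k'.
Proof.
by move=> kk'; apply: map_Size => n; apply: map_Size => m; apply: map_ModsAux.
Qed.

Lemma map_bigMulPoly (T : Type) (r : seq T) (F : T -> seq (Q.term K)) F' :
  (forall x, mp (F x) = F' x) ->
  mp (reducebig [:: Q.NatConst K 1] r (fun x => BigBody x (@Q.MulPoly K) true (F x)))
  = reducebig [:: Q.NatConst L 1] r (fun x => BigBody x (@Q.MulPoly L) true (F' x)).
Proof. by move=> FF'; elim: r => //= x r IH; rewrite map_MulPoly FF' IH. Qed.

Lemma nth_mp sq n : mp (nth [::] sq n) = nth [::] (map mp sq) n.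
Proof. by elim: sq n => [|p sq IH] [|n] //=. Qed.

Lemma map_PolyComb sq sc :
  mp (Q.PolyComb sq sc) = Q.PolyComb (map mp sq) sc.
Proof.
rewrite /Q.PolyComb size_map; apply: map_bigMulPoly => j.
by rewrite map_ExpPoly nth_mp.
Qed.

Lemma map_Pcq sq n : mp (Q.Pcq sq n) = Q.Pcq (map mp sq) n.
Proof.
rewrite /Q.Pcq nth_mp -map_comp size_map; congr nth.
by apply: eq_map => sc /=; rewrite map_PolyComb.
Qed.

Lemma map_TaqsR p sq n k k' : (forall t, mapf (k t) = k' (mapt t)) ->
  mapf (Q.TaqsR p sq n k) = Q.TaqsR (mp p) (map mp sq) n k'.
Proof.
move=> kk'; rewrite /Q.TaqsR /Q.TaqR -map_Pcq -map_Deriv -map_MulPoly.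
apply: map_Mods => s; apply: map_ChangesPoly => m.
by rewrite kk' /= rmorph_int.
Qed.

Lemma map_BoundingPoly sq :
  mp (Q.BoundingPoly sq) = Q.BoundingPoly (map mp sq).
Proof.
rewrite map_Deriv; congr Q.Deriv.
by elim: sq => //= p sq IH; rewrite map_MulPoly IH.
Qed.

(** The coefficients are entries of the inverse of an integer matrix, hence rational, so every ring
    morphism preserves them. *)
Lemma rmorph_coefs n m : i (qe_rcf_th.coefs K n m) = qe_rcf_th.coefs L n m.
Proof.
rewrite /qe_rcf_th.coefs.
have E j : (castmx (erefl, qe_rcf_th.exp3n n)
      (invmx (map_mx intr (qe_rcf_th.ctmat n) : 'M[L]_ _))) j ord0
    = i ((castmx (erefl, qe_rcf_th.exp3n n)
      (invmx (map_mx intr (qe_rcf_th.ctmat n) : 'M[K]_ _))) j ord0).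
  rewrite !castmxE /=.
  have <- : map_mx i (map_mx intr (qe_rcf_th.ctmat n))
      = map_mx intr (qe_rcf_th.ctmat n).
    by rewrite -map_mx_comp; apply: eq_map_mx => z; apply: rmorph_int.
  by rewrite -map_invmx mxE.
rewrite (eq_map E) (map_comp i).
move: (map _ _) => s; have [lt|ge] := ltnP m (size s); first by rewrite (nth_map 0).
by rewrite !nth_default ?size_map ?rmorph0 //.
Qed.

Lemma map_Coefs n m : mapt (Q.Coefs K n m) = Q.Coefs L n m.
Proof.
rewrite /Q.Coefs; congr Q.Const; case: n => [|[|n]].
- by rewrite rmorph_nat.
- by case: m => [|[|[|m]]] /=; rewrite ?nth_nil ?rmorph0 ?fmorphV ?rmorph_nat.
- exact: rmorph_coefs.
Qed.

Lemma map_CcountWeak p sq k k' : (forall t, mapf (k t) = k' (mapt t)) ->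
  mapf (Q.CcountWeak p sq k) = Q.CcountWeak (mp p) (map mp sq) k'.
Proof.
move=> kk'; rewrite /Q.CcountWeak size_map.
rewrite -[Q.NatConst L 0]/(mapt (Q.NatConst K 0)); move: (Q.NatConst K 0) => s.
elim: (3 ^ size sq)%N s k k' kk' => [|n IH] s k k' kk' //=.
by apply: map_TaqsR => t; rewrite -map_Coefs (IH _ _ k').
Qed.

Lemma map_CcountGt0 sp sq :
  mapf (Q.CcountGt0 sp sq) = Q.CcountGt0 (map mp sp) (map mp sq).
Proof.
apply: map_BigRgcd => p; apply: map_Isnull => -[] /=.
  rewrite -map_BoundingPoly; apply: map_CcountWeak => t /=.
  congr (Q.Or _ (Q.Or _ _)).
    elim: (sq) => //= q s ->; congr Q.And; exact: map_LeadCoef.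
  elim: (sq) => //= q s ->; congr Q.And.
  by apply: map_Size => n; apply: map_LeadCoef.
exact: map_CcountWeak.
Qed.

Lemma map_abstrX n t : mp (Q.abstrX n t) = Q.abstrX n (mapt t).
Proof.
elim: t => //= [m|t IHt u IHu|t IH|t IH m|t IHt u IHu|t IH m].
- by case: eqP.
- by rewrite map_AddPoly IHt IHu.
- by rewrite map_OppPoly IH.
- by rewrite map_NatMulPoly IH.
- by rewrite map_MulPoly IHt IHu.
- by rewrite map_ExpPoly IH.
Qed.

Lemma eval_mapt e t : Q.eval (map i e) (mapt t) = i (Q.eval e t).
Proof.
elim: t => //= [n|n|t -> u ->|t ->|t -> n|t -> u ->|t -> n].
- have [lt|ge] := ltnP n (size e); first by rewrite (nth_map 0).
  by rewrite !nth_default ?size_map ?rmorph0.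
- by rewrite rmorph_nat.
- by rewrite rmorphD.
- by rewrite rmorphN.
- by rewrite rmorphMn.
- by rewrite rmorphM.
- by rewrite rmorphXn.
Qed.

Lemma qf_eval_mapf e f : Q.qf_eval (map i e) (mapf f) = Q.qf_eval e f.
Proof.
elim: f => //= [t u|t u|t u|f -> g -> //|f -> g -> //|f -> g -> //|f -> //].
- by rewrite !eval_mapt fmorph_eq.
- by rewrite !eval_mapt ltr_rcf_rmorph.
- by rewrite !eval_mapt ler_rcf_rmorph.
Qed.

End MapSyntax.

(** * Quantifier elimination, uniform in the field *)

Section Elimination.
Variable K : rcfType.
Implicit Types (L : rcfType) (f g : Q.formula K) (t : Q.term K).

Let clause := (seq (Q.term K) * seq (Q.term K))%type.

Definition clause_holds L (i : {rmorphism K -> L}) (e : seq L) (c : clause) :=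
  all (fun t => Q.eval e (mapt i t) == 0) c.1
  && all (fun t => 0 < Q.eval e (mapt i t)) c.2.

Lemma clause_holds_cat L (i : {rmorphism K -> L}) e c c' :
  clause_holds i e (c.1 ++ c'.1, c.2 ++ c'.2)
  = clause_holds i e c && clause_holds i e c'.
Proof. by rewrite /clause_holds /= !all_cat andbACA. Qed.

(** The list of clauses is required to work in every extension [L] of [K] simultaneously; this
    uniformity is what later makes the eliminated formula independent of the field. *)
Definition is_dnf f (d : seq clause) := forall L (i : {rmorphism K -> L}) e,
  Q.qf_eval e (mapf i f) = has (clause_holds i e) d.

Lemma dnf_and f g d d' : is_dnf f d -> is_dnf g d' ->
  is_dnf (Q.And f g) [seq (c.1 ++ c'.1, c.2 ++ c'.2) | c <- d, c' <- d'].
Proof.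
move=> fd gd' L i e /=; rewrite fd gd'; elim: d {fd} => //= c d IH.
rewrite has_cat -IH andb_orl; congr (_ || _); rewrite has_map.
transitivity (has (fun c' => clause_holds i e c && clause_holds i e c') d').
  by elim: d' {gd' IH} => [|c' d' IH'] /=; rewrite ?andbF // andb_orr IH'.
by apply: eq_has => c'; rewrite /= clause_holds_cat.
Qed.

Lemma dnf_or f g d d' : is_dnf f d -> is_dnf g d' ->
  is_dnf (Q.Or f g) (d ++ d').
Proof. by move=> fd gd' L i e /=; rewrite fd gd' has_cat. Qed.

(** A formula and its negation are normalized together, so that the induction passes through [Not]
    and [Implies]. Negated atoms are expressed by strict inequalities: a difference is nonzero iff
    it or its opposite is positive. *)
Lemma dnf_pair f : (exists d, is_dnf f d) /\ (exists d, is_dnf (Q.Not f) d).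
Proof.
have pdnf t : is_dnf (Q.Lt (Q.NatConst K 0) t) [:: ([::], [:: t])].
  by move=> L i e; rewrite /clause_holds /= orbF andbT.
have zdnf t : is_dnf (Q.Equal t (Q.NatConst K 0)) [:: ([:: t], [::])].
  by move=> L i e; rewrite /clause_holds /= orbF !andbT.
pose sub t u := Q.Add t (Q.Opp u).
elim: f => [b|t u|t u|t u|f [[d fd] [d' fd']] g [[c gc] [c' gc']]
  |f [[d fd] [d' fd']] g [[c gc] [c' gc']]|f [[d fd] [d' fd']] g [[c gc] [c' gc']]
  |f [[d fd] [d' fd']]].
- split; [exists (if b then [:: ([::], [::])] else [::])
         |exists (if b then [::] else [:: ([::], [::])])] => L i e;
  by case: b.
- split.
    exists [:: ([:: sub t u], [::])] => L i e.
    by rewrite -zdnf /= subr_eq0.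
  exists ([:: ([::], [:: sub t u])] ++ [:: ([::], [:: sub u t])]) => L i e.
  by rewrite -(dnf_or (@pdnf _) (@pdnf _)) /= !subr_gt0 -neq_lt eq_sym.
- split.
    by exists [:: ([::], [:: sub u t])] => L i e; rewrite -pdnf /= subr_gt0.
  exists ([:: ([:: sub t u], [::])] ++ [:: ([::], [:: sub t u])]) => L i e.
  by rewrite -(dnf_or (@zdnf _) (@pdnf _)) /= subr_eq0 subr_gt0 -leNgt le_eqVlt eq_sym.
- split.
    exists ([:: ([:: sub t u], [::])] ++ [:: ([::], [:: sub u t])]) => L i e.
    by rewrite -(dnf_or (@zdnf _) (@pdnf _)) /= subr_eq0 subr_gt0 le_eqVlt.
  by exists [:: ([::], [:: sub t u])] => L i e; rewrite -pdnf /= subr_gt0 -ltNge.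
- split; first by eexists; exact: dnf_and fd gc.
  by exists (d' ++ c') => L i e; rewrite -(dnf_or fd' gc') /= negb_and.
- split; first by eexists; exact: dnf_or fd gc.
  have [D hD] : exists D, is_dnf (Q.And (Q.Not f) (Q.Not g)) D.
    by eexists; exact: dnf_and fd' gc'.
  by exists D => L i e; rewrite -hD /= negb_or.
- split; first by exists (d' ++ c) => L i e; rewrite -(dnf_or fd' gc) /= implybE.
  have [D hD] : exists D, is_dnf (Q.And f (Q.Not g)) D.
    by eexists; exact: dnf_and fd gc'.
  by exists D => L i e; rewrite -hD /= negb_imply.
- by split; [exists d' | exists d => L i e; rewrite -fd /= negbK].
Qed.

(** An existential quantifier distributes over the clauses, and [CcountGt0] decides whether a single
    clause has a solution in the variable [n]. *)
Definition elim_ex (n : nat) (d : seq clause) : Q.formula K :=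
  foldr (fun c => Q.Or (Q.CcountGt0 (map (Q.abstrX n) c.1) (map (Q.abstrX n) c.2)))
    (Q.Bool false) d.

Lemma elim_exP L (i : {rmorphism K -> L}) e n d :
  Q.qf_eval e (mapf i (elim_ex n d))
  <-> exists x, has (clause_holds i (set_nth 0 e n x)) d.
Proof.
have one c : Q.qf_eval e (mapf i
    (Q.CcountGt0 (map (Q.abstrX n) c.1) (map (Q.abstrX n) c.2)))
    <-> exists x, clause_holds i (set_nth 0 e n x) c.
  rewrite map_CcountGt0 Q.eval_CcountGt0; split.
    move=> /qe_rcf_th.ccount_gt0P[x]; rewrite !big_map !big_all => h; exists x.
    rewrite /clause_holds; congr (_ && _): h; apply: eq_all => t;
    by rewrite map_abstrX Q.abstrXP.
  move=> [x h]; apply/qe_rcf_th.ccount_gt0P; exists x; rewrite !big_map !big_all.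
  rewrite /clause_holds in h; congr (_ && _): h; apply: eq_all => t;
  by rewrite map_abstrX Q.abstrXP.
elim: d => [|c d IH] /=; first by split=> // -[].
split=> [/orP[/one[x hx]|/IH[x hx]]|[x /orP[hx|hx]]].
- by exists x; rewrite hx.
- by exists x; rewrite hx orbT.
- by apply/orP; left; apply/one; exists x.
- by apply/orP; right; apply/IH; exists x.
Qed.

Lemma exists_elim f n : exists g, forall L (i : {rmorphism K -> L}) e,
  Q.qf_eval e (mapf i g) <-> exists x, Q.qf_eval (set_nth 0 e n x) (mapf i f).
Proof.
have [[d fd] _] := dnf_pair f; exists (elim_ex n d) => L i e.
rewrite elim_exP; split=> -[x hx]; exists x; by rewrite fd in hx *.
Qed.

Definition set_block (L : rcfType) (N m : nat) (e : seq L) (y : nat -> L) :=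
  foldr (fun k e => set_nth 0 e (N + k)%N (y k)) e (iota 0 m).

Lemma nth_set_block L N m (e : seq L) y k :
  (set_block N m e y)`_k = if (N <= k < N + m)%N then y (k - N)%N else e`_k.
Proof.
rewrite /set_block; have -> : (N <= k < N + m)%N = (N <= k)%N && ((k - N)%N \in iota 0 m).
  by rewrite mem_iota; have [|] := leqP N k => //= h; rewrite ltn_subLR.
elim: (iota 0 m) => [|a s IH] /=; first by rewrite andbF.
rewrite nth_set_nth /= inE; case: eqP => [->|ne]; first by rewrite leq_addr addKn eqxx.
rewrite IH; case: (leqP N k) => //= h; case: eqP => // E.
by rewrite -E subnKC in ne.
Qed.

Lemma exists_block_elim f N m : exists g, forall L (i : {rmorphism K -> L}) e,
  Q.qf_eval e (mapf i g) <-> exists y, Q.qf_eval (set_block N m e y) (mapf i f).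
Proof.
rewrite /set_block; have := iota_uniq 0 m; elim: (iota 0 m) f => [|a s IH] f /=.
  by exists f => L i e; split=> [h|[]//]; exists (fun=> 0).
move=> /andP[nas us]; have [g hg] := exists_elim f (N + a).
have [g' hg'] := IH g us; exists g' => L i e; rewrite hg'; split=> -[y].
  rewrite hg => -[x hx]; exists (fun k => if k == a then x else y k); rewrite eqxx.
  move: hx; set r := foldr _ _ _; set r' := foldr _ _ _; suff -> : r = r' by [].
  rewrite /r /r'; elim: (s) nas => //= b s' IHs.
  by rewrite inE negb_or eq_sym => /andP[/negbTE -> /IHs ->].
by move=> hy; exists y; rewrite hg; exists (y a).
Qed.

End Elimination.

(** * Definable relations and transfer of sentences *)

Section Definable.
Variable K : rcfType.

(** A shallow embedding of terms: one function for each extension of [K], all given by a single term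
    with constants in [K]. Quantifying over the placement [r] of the variables in the environment
    allows [I] to be any index type, in particular a sum type to which bound variables have been
    added. *)
Definition polyfam (I : Type)
    (T : forall L : rcfType, {rmorphism K -> L} -> (I -> L) -> L) :=
  forall r : I -> nat, exists t, forall (L : rcfType) (i : {rmorphism K -> L}) (s : seq L),
    T L i (fun k => s`_(r k)) = Q.eval s (mapt i t).

Definition definable (I : Type)
    (D : forall L : rcfType, {rmorphism K -> L} -> (I -> L) -> Prop) :=
  forall r : I -> nat, exists f, forall (L : rcfType) (i : {rmorphism K -> L}) (s : seq L),
    D L i (fun k => s`_(r k)) <-> Q.qf_eval s (mapf i f).

(** After elimination, truth at a point of [K] is a combination of sign conditions on elements of
    [K], and [i] preserves and reflects signs. *)
Lemma definable_transfer (I : finType) D : @definable I D ->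
  forall (L : rcfType) (i : {rmorphism K -> L}) (x : I -> K),
    D K idfun x <-> D L i (i \o x).
Proof.
move=> /(_ enum_rank)[f hf] L i x.
pose s := [seq x k | k <- enum I].
have sE (k : I) : s`_(enum_rank k) = x k.
  by rewrite (nth_map k) ?nth_enum_rank // -cardE.
have isE (k : I) : (map i s)`_(enum_rank k) = i (x k).
  by rewrite -map_comp (nth_map k) /= ?nth_enum_rank // -cardE.
have -> : x = (fun k : I => s`_(enum_rank k)) by apply/funext => k; rewrite sE.
have -> : i \o (fun k : I => s`_(enum_rank k)) = (fun k : I => (map i s)`_(enum_rank k)).
  by apply/funext => k; rewrite /= isE sE.
rewrite !hf qf_eval_mapf -[in X in X <-> _](map_id s).
by rewrite -[X in Q.qf_eval X _]/(map (idfun : {rmorphism K -> K}) s) qf_eval_mapf.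
Qed.

(** The transfer principle in the form used everywhere below: without free variables both sides are
    equivalent to the statement over [K], so no morphism between [L] and [L'] is needed. *)
Lemma definable_sentence D : @definable void D ->
  forall (L L' : rcfType) (i : {rmorphism K -> L}) (i' : {rmorphism K -> L'}) x x',
    D L i x <-> D L' i' x'.
Proof.
move=> hD L L' i i' x x'; pose y : void -> K := fun v => match v with end.
have vE (M : rcfType) (z z' : void -> M) : z = z' by apply/funext => -[].
rewrite (vE _ x (i \o y)) (vE _ x' (i' \o y)).
by rewrite -!(definable_transfer hD).
Qed.

Variable I : Type.
Implicit Types D E : forall L : rcfType, {rmorphism K -> L} -> (I -> L) -> Prop.
Implicit Types T U : forall L : rcfType, {rmorphism K -> L} -> (I -> L) -> L.

Lemma definable_and D E : definable D -> definable E ->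
  definable (fun L i x => D L i x /\ E L i x).
Proof.
move=> hD hE r; have [f hf] := hD r; have [g hg] := hE r.
by exists (Q.And f g) => L i s /=; rewrite hf hg; split=> /andP.
Qed.

Lemma definable_or D E : definable D -> definable E ->
  definable (fun L i x => D L i x \/ E L i x).
Proof.
move=> hD hE r; have [f hf] := hD r; have [g hg] := hE r.
by exists (Q.Or f g) => L i s /=; rewrite hf hg; split=> /orP.
Qed.

Lemma definable_imply D E : definable D -> definable E ->
  definable (fun L i x => D L i x -> E L i x).
Proof.
move=> hD hE r; have [f hf] := hD r; have [g hg] := hE r.
by exists (Q.Implies f g) => L i s /=; rewrite hf hg; split=> /implyP.
Qed.

Lemma definable_not D : definable D -> definable (fun L i x => ~ D L i x).
Proof.
move=> hD r; have [f hf] := hD r.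
by exists (Q.Not f) => L i s /=; rewrite hf; split=> /negP.
Qed.

Lemma definable_iff D E : definable D -> definable E ->
  definable (fun L i x => D L i x <-> E L i x).
Proof. by move=> hD hE; apply: definable_and; apply: definable_imply. Qed.

Lemma definable_cst (P : Prop) : definable (fun (L : rcfType) (i : {rmorphism K -> L}) (x : I ->
  L) => P).
Proof.
move=> r; exists (Q.Bool `[< P >]) => L i s /=.
by split=> /asboolP.
Qed.

Lemma definable_all (J : eqType) (l : seq J)
    (D : J -> forall L : rcfType, {rmorphism K -> L} -> (I -> L) -> Prop) :
  (forall j, j \in l -> definable (D j)) ->
  definable (fun L i x => forall j, j \in l -> D j L i x).
Proof.
elim: l => [|j l IH] hD.
  by move=> r; exists (Q.Bool true) => L i s /=.
have h1 := hD j (mem_head _ _).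
have /IH h2 : forall k, k \in l -> definable (D k).
  by move=> k kl; apply: hD; rewrite inE kl orbT.
move=> r; have [f hf] := definable_and h1 h2 r; exists f => L i s.
rewrite -hf; split=> [h|[h h'] k]; last first.
  by rewrite inE => /orP[/eqP ->|/h'].
by split=> [|k kl]; apply: h; rewrite inE ?eqxx ?kl ?orbT.
Qed.

Lemma definable_forall_fin (J : finType)
    (D : J -> forall L : rcfType, {rmorphism K -> L} -> (I -> L) -> Prop) :
  (forall j, definable (D j)) -> definable (fun L i x => forall j, D j L i x).
Proof.
move=> hD r; have [//|f hf] := @definable_all J (enum J) D _ r.
exists f => L i s; rewrite -hf; split=> h j; first by move=> _; apply: h.
by apply: h; rewrite mem_enum.
Qed.

Lemma definable_eq T U : polyfam T -> polyfam U ->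
  definable (fun L i x => T L i x = U L i x).
Proof.
move=> hT hU r; have [t ht] := hT r; have [u hu] := hU r.
by exists (Q.Equal t u) => L i s /=; rewrite ht hu; split=> /eqP.
Qed.

Lemma definable_le T U : polyfam T -> polyfam U ->
  definable (fun L i x => T L i x <= U L i x).
Proof.
move=> hT hU r; have [t ht] := hT r; have [u hu] := hU r.
by exists (Q.Le t u) => L i s /=; rewrite ht hu.
Qed.

Lemma definable_lt T U : polyfam T -> polyfam U ->
  definable (fun L i x => T L i x < U L i x).
Proof.
move=> hT hU r; have [t ht] := hT r; have [u hu] := hU r.
by exists (Q.Lt t u) => L i s /=; rewrite ht hu.
Qed.

Lemma polyfam_var k : polyfam (fun (L : rcfType) (i : {rmorphism K -> L}) (x : I -> L) => x k).
Proof. by move=> r; exists (Q.Var _ (r k)). Qed.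

Lemma polyfam_cst c : polyfam (fun (L : rcfType) (i : {rmorphism K -> L}) (x : I -> L) => i c).
Proof. by move=> r; exists (Q.Const c). Qed.


Lemma polyfam0 : polyfam (fun (L : rcfType) (i : {rmorphism K -> L}) (x : I -> L) => 0).
Proof. by move=> r; exists (Q.NatConst _ 0). Qed.

Lemma polyfam1 : polyfam (fun (L : rcfType) (i : {rmorphism K -> L}) (x : I -> L) => 1).
Proof. by move=> r; exists (Q.NatConst _ 1). Qed.

Lemma polyfam_add T U : polyfam T -> polyfam U ->
  polyfam (fun L i x => T L i x + U L i x).
Proof.
move=> hT hU r; have [t ht] := hT r; have [u hu] := hU r.
by exists (Q.Add t u) => L i s /=; rewrite ht hu.
Qed.

Lemma polyfam_mul T U : polyfam T -> polyfam U ->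
  polyfam (fun L i x => T L i x * U L i x).
Proof.
move=> hT hU r; have [t ht] := hT r; have [u hu] := hU r.
by exists (Q.Mul t u) => L i s /=; rewrite ht hu.
Qed.

Lemma polyfam_opp T : polyfam T -> polyfam (fun L i x => - T L i x).
Proof. by move=> hT r; have [t ht] := hT r; exists (Q.Opp t) => L i s /=; rewrite ht. Qed.

Lemma polyfam_exp T n : polyfam T -> polyfam (fun L i x => T L i x ^+ n).
Proof. by move=> hT r; have [t ht] := hT r; exists (Q.Exp t n) => L i s /=; rewrite ht. Qed.

Lemma polyfam_sum (J : Type) (l : seq J) (P : pred J)
    (T : J -> forall L : rcfType, {rmorphism K -> L} -> (I -> L) -> L) :
  (forall j, polyfam (T j)) ->
  polyfam (fun L i x => \sum_(j <- l | P j) T j L i x).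
Proof.
move=> hT r; elim: l => [|j l [t ht]].
  by exists (Q.NatConst _ 0) => L i s; rewrite big_nil.
have [u hu] := hT j r; exists (if P j then Q.Add u t else t) => L i s.
by rewrite big_cons ht hu; case: (P j).
Qed.

Lemma polyfam_prod (J : Type) (l : seq J) (P : pred J)
    (T : J -> forall L : rcfType, {rmorphism K -> L} -> (I -> L) -> L) :
  (forall j, polyfam (T j)) ->
  polyfam (fun L i x => \prod_(j <- l | P j) T j L i x).
Proof.
move=> hT r; elim: l => [|j l [t ht]].
  by exists (Q.NatConst _ 1) => L i s; rewrite big_nil.
have [u hu] := hT j r; exists (if P j then Q.Mul u t else t) => L i s.
by rewrite big_cons ht hu; case: (P j).
Qed.

End Definable.

Section Quantifiers.
Variables (K : rcfType) (I : finType).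

Lemma definable_exists (J : finType)
    (D : forall L : rcfType, {rmorphism K -> L} -> (I -> L) -> (J -> L) -> Prop) :
  definable (fun (L : rcfType) (i : {rmorphism K -> L}) (z : I + J -> L) =>
    D L i (z \o inl) (z \o inr)) ->
  definable (fun L i x => exists y, D L i x y).
Proof.
(* Every position used by [r] lies below [N], so the block starting at [N] is free to hold the
   quantified variables. *)
move=> hD r; pose N := (\max_k r k).+1.
have rN k : (r k < N)%N by rewrite ltnS leq_bigmax.
have [f hf] := hD (fun k => match k with inl k => r k | inr j => N + enum_rank j end)%N.
have [g hg] := exists_block_elim f N #|J|; exists g => L i s; rewrite hg.
have E1 y : (fun k => (set_block N #|J| s y)`_(r k)) = (fun k => s`_(r k)).
  by apply/funext => k; rewrite nth_set_block leqNgt rN.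
have E2 y : (fun j : J => (set_block N #|J| s y)`_(N + enum_rank j))
    = (fun j => y (enum_rank j)).
  apply/funext => k; rewrite nth_set_block leq_addr ltn_add2l ltn_ord /=.
  by rewrite addKn.
split=> -[y]; last first.
  by rewrite -hf /comp /= E1 E2 => h; exists (fun j => y (enum_rank j)).
(* Turning [y] into a function on the natural numbers takes a default element of [J]; the case where
   [J] is empty is separate. *)
move=> h; case: (pickP J) => [j0 _|J0].
  exists (fun n => y (enum_val (insubd (enum_rank j0) n))).
  rewrite -hf /comp /= E1 E2.
  suff -> : (fun j => y (enum_val (insubd (enum_rank j0) (enum_rank j)))) = y by [].
  by apply/funext => j; congr y; rewrite valKd enum_rankK.
exists (fun=> 0); rewrite -hf /comp /= E1 E2.
suff -> : (fun _ : J => 0) = y by [].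
by apply/funext => j; have := J0 j.
Qed.

Lemma definable_forall (J : finType)
    (D : forall L : rcfType, {rmorphism K -> L} -> (I -> L) -> (J -> L) -> Prop) :
  definable (fun (L : rcfType) (i : {rmorphism K -> L}) (z : I + J -> L) =>
    D L i (z \o inl) (z \o inr)) ->
  definable (fun L i x => forall y, D L i x y).
Proof.
move=> hD r; have [f hf] := definable_not (@definable_exists J (fun L i x y =>
  ~ D L i x y) (definable_not hD)) r.
exists f => L i s; rewrite -hf; split=> [h [y]|h y]; first exact.
by apply: contrapT => nD; apply: h; exists y.
Qed.

Lemma definable_exists_mx m n
    (D : forall L : rcfType, {rmorphism K -> L} -> (I -> L) -> 'M[L]_(m, n) -> Prop) :
  definable (fun (L : rcfType) (i : {rmorphism K -> L}) (z : I + 'I_m * 'I_n -> L) =>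
    D L i (z \o inl) (\matrix_(a, b) z (inr (a, b)))) ->
  definable (fun L i x => exists y, D L i x y).
Proof.
move=> hD r; have [f hf] := @definable_exists ('I_m * 'I_n)%type
  (fun L i x y => D L i x (\matrix_(a, b) y (a, b))) hD r.
exists f => L i s; rewrite -hf; split=> -[y hy]; last by eexists; exact: hy.
exists (fun ab => y ab.1 ab.2); suff -> : \matrix_(a, b) y a b = y by [].
by apply/matrixP => a b; rewrite mxE.
Qed.

Lemma definable_forall_mx m n
    (D : forall L : rcfType, {rmorphism K -> L} -> (I -> L) -> 'M[L]_(m, n) -> Prop) :
  definable (fun (L : rcfType) (i : {rmorphism K -> L}) (z : I + 'I_m * 'I_n -> L) =>
    D L i (z \o inl) (\matrix_(a, b) z (inr (a, b)))) ->
  definable (fun L i x => forall y, D L i x y).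
Proof.
move=> hD r; have [f hf] := definable_not (@definable_exists_mx m n (fun L i x y =>
  ~ D L i x y) (definable_not hD)) r.
exists f => L i s; rewrite -hf; split=> [h [y]|h y]; first exact.
by apply: contrapT => nD; apply: h; exists y.
Qed.

Lemma definable_exists_elt
    (D : forall L : rcfType, {rmorphism K -> L} -> (I -> L) -> L -> Prop) :
  definable (fun (L : rcfType) (i : {rmorphism K -> L}) (z : I + 'I_1 -> L) =>
    D L i (z \o inl) (z (inr ord0))) ->
  definable (fun L i x => exists y, D L i x y).
Proof.
move=> hD r; have [f hf] := @definable_exists 'I_1
  (fun L i x y => D L i x (y ord0)) hD r.
exists f => L i s; rewrite -hf; split=> -[y hy]; last by eexists; exact: hy.
by exists (fun=> y).
Qed.

Lemma definable_forall_elt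
    (D : forall L : rcfType, {rmorphism K -> L} -> (I -> L) -> L -> Prop) :
  definable (fun (L : rcfType) (i : {rmorphism K -> L}) (z : I + 'I_1 -> L) =>
    D L i (z \o inl) (z (inr ord0))) ->
  definable (fun L i x => forall y, D L i x y).
Proof.
move=> hD r; have [f hf] := definable_not (@definable_exists_elt  (fun L i x y =>
  ~ D L i x y) (definable_not hD)) r.
exists f => L i s; rewrite -hf; split=> [h [y]|h y]; first exact.
by apply: contrapT => nD; apply: h; exists y.
Qed.

End Quantifiers.

(** * Finiteness of systems of equations *)

(** Each term is chosen where [g] is minimal on the tail that begins just after the previous term;
    later terms lie in the same tail, so their values cannot be smaller. *)
Lemma increasing_min_subseq (g : nat -> nat) : exists s : nat -> nat,
  (forall k, (s k < s k.+1)%N) /\ (forall k, (g (s k) <= g (s k.+1))%N).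
Proof.
have /choice[c hc] N : exists m, (N <= m)%N /\ forall m', (N <= m')%N -> (g m <= g m')%N.
  pose P v := `[< exists2 m, (N <= m)%N & g m = v >].
  have exP : exists v, P v by exists (g N); apply/asboolP; exists N.
  case: (ex_minnP exP) => v /asboolP[m Nm <-] hm; exists m; split=> // m' Nm'.
  by apply: hm; apply/asboolP; exists m'.
pose s k := iter k (fun m => c m.+1) (c 0%N); exists s; split=> k /=.
  by have [] := hc (s k).+1.
have hk : exists N, s k = c N by case: k => [|k]; [exists 0%N | exists (s k).+1].
have [N ->] := hk; have [h1 h2] := hc N; apply: h2.
by apply: leq_trans h1 _; apply: leq_trans (leqnSn _) _; have [] := hc (c N).+1.
Qed.


(** Passing to a subsequence once for each coordinate makes all coordinates nondecreasing; two
    consecutive terms then give the result. *)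
Lemma dickson (n : nat) (f : nat -> 'I_n -> nat) :
  exists i j, (i < j)%N /\ forall k, (f i k <= f j k)%N.
Proof.
suff [s [h1 h2]] : exists s : nat -> nat, (forall k, (s k < s k.+1)%N) /\
    forall a, a \in enum 'I_n -> forall k, (f (s k) a <= f (s k.+1) a)%N.
  by exists (s 0%N), (s 1%N); split=> // k; apply: h2; rewrite mem_enum.
elim: (enum _) => [|a l [s [h1 h2]]]; first by exists id.
have [t [h3 h4]] := increasing_min_subseq (fun k => f (s k) a).
have mono (u : nat -> nat) : (forall k, (u k <= u k.+1)%N) ->
    forall i j, (i <= j)%N -> (u i <= u j)%N.
  move=> hu i j; elim: j => [|j IH]; first by rewrite leqn0 => /eqP ->.
  by rewrite leq_eqVlt => /orP[/eqP ->//|/IH h]; apply: leq_trans h (hu j).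
have smono : forall i j, (i < j)%N -> (s i < s j)%N.
  move=> i; elim=> // j IH; rewrite ltnS leq_eqVlt => /orP[/eqP ->|/IH h].
    exact: h1.
  exact: ltn_trans h (h1 j).
exists (s \o t); split=> [k|b] /=; first exact: smono.
rewrite inE => /orP[/eqP -> k|bl k]; first exact: h4.
by apply: (mono (fun k => f (s k) b) (h2 b bl)); apply: ltnW.
Qed.

Section HilbertBasis.
Import -(notations) mpoly.
Variables (m : nat) (K : fieldType).

(** Otherwise one could keep choosing nonzero elements of [J] whose leading monomial is divisible by
    none of the earlier ones, which Dickson's lemma forbids. *)
Lemma dickson_leading (J : mpoly m K -> Prop) : exists l : seq (mpoly m K),
  (forall g, g \in l -> J g /\ g != 0) /\
  forall f, J f -> f != 0 -> exists2 g, g \in l & lem (mlead g) (mlead f).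
Proof.
apply: contrapT => nex.
pose good (l : seq (mpoly m K)) := forall g, g \in l -> J g /\ g != 0.
have /choice[F hF] (l : seq (mpoly m K)) : exists f, good l ->
    [/\ J f, f != 0 & forall g, g \in l -> ~ lem (mlead g) (mlead f)].
  have [gl|] := pselect (good l); last by exists 0.
  apply: contrapT => nf; apply: nex; exists l; split=> // f Jf f0.
  apply: contrapT => ng; apply: nf; exists f => _; split=> // g gl' h.
  by apply: ng; exists g.
pose l k := iter k (fun l => F l :: l) [::].
have gl k : good (l k).
  elim: k => [|k IH] // g; rewrite inE => /orP[/eqP ->|]; last exact: IH.
  by have [] := hF _ IH.
have mem_l j i : (i < j)%N -> F (l i) \in l j.
  elim: j => // j IH; rewrite ltnS leq_eqVlt => /orP[/eqP ->|/IH h];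
  by rewrite inE ?eqxx // h orbT.
have [i [j [ij h]]] := dickson (fun i k => mlead (F (l i)) k).
have [_ _ /(_ (F (l i)) (mem_l _ _ ij))] := hF _ (gl j); apply.
by apply/mnm_lepP.
Qed.

(** Algebraic sets are given by arbitrary sets of polynomials, and only finite systems are
    first-order; this reduction makes [zeros] definable. The role of the ideal generated by [P] is
    played by [J], the polynomials that vanish, over every field, at the common zeros of some finite
    part of [P]. *)
Lemma hilbert_basis_zeros (P : set (mpoly m K)) : exists l : seq (mpoly m K),
  (forall p, p \in l -> P p) /\
  forall (L : fieldType) (i : {rmorphism K -> L}) (x : 'I_m -> L),
    (forall p, p \in l -> mmap i x p = 0) -> forall p, P p -> mmap i x p = 0.
Proof.
pose van (L : fieldType) (i : {rmorphism K -> L}) x (l : seq (mpoly m K)) :=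
  forall p : mpoly m K, p \in l -> mmap i x p = 0.
pose J (f : mpoly m K) := exists2 l : seq (mpoly m K), (forall p, p \in l -> P p) &
  forall (L : fieldType) (i : {rmorphism K -> L}) (x : 'I_m -> L),
    van L i x l -> mmap i x f = 0.
have [l [lJ lead_l]] := dickson_leading J.
have van_l : forall f, J f -> forall (L : fieldType) (i : {rmorphism K -> L})
    (x : 'I_m -> L), van L i x l -> mmap i x f = 0.
  elim/mleadrect => f IH Jf L i x vl; have [->|f0] := eqVneq f 0; first exact: mmap0.
  have [g gl hg] := lead_l f Jf f0; have [Jg g0] := lJ g gl.
  pose c := mcoeff (mlead f) f / mcoeff (mlead g) g.
  (* One division step: [h] is the multiple of [g] with the same leading term as [f], so [f - h]
     stays in [J] and has a smaller leading monomial, or is zero. *)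
  pose h := c *: (mpolyX K (mnm_sub (mlead f) (mlead g)) * g).
  have lg0 : mcoeff (mlead g) g != 0 by rewrite mleadc_eq0.
  have lf0 : mcoeff (mlead f) f != 0 by rewrite mleadc_eq0.
  have X0 : mpolyX K (mnm_sub (mlead f) (mlead g)) != 0.
    apply/eqP => /(congr1 (mcoeff (mnm_sub (mlead f) (mlead g)))).
    by rewrite mcoeffX eqxx mcoeff0 => /eqP; rewrite oner_eq0.
  have c0 : c != 0 by rewrite mulf_neq0 ?invr_eq0.
  have hh : mlead h = mlead f.
    by rewrite mleadZ // mleadM // mleadXm submK.
  have hc : mcoeff (mlead f) h = mcoeff (mlead f) f.
    have E := mleadcM (mpolyX K (mnm_sub (mlead f) (mlead g))) g.
    rewrite mleadXm submK // mcoeffX eqxx mul1r in E.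
    by rewrite mcoeffZ E divfK.
  have van_h (L' : fieldType) (i' : {rmorphism K -> L'}) (x' : 'I_m -> L') :
      mmap i' x' g = 0 -> mmap i' x' h = 0.
    by move=> vg; rewrite mmapZ (mmap_is_multiplicative _ _).1 vg !mulr0.
  have Jfh : J (f - h).
    have [l1 l1P h1] := Jf; have [l2 l2P h2] := Jg; exists (l1 ++ l2).
      by move=> p; rewrite mem_cat => /orP[/l1P|/l2P].
    move=> L' i' x' v; rewrite mmapB h1 ?van_h ?subr0 // ?h2 // => p pl;
    by apply: v; rewrite mem_cat pl ?orbT.
  have vg := vl g gl.
  rewrite -[f](subrK h) mmapD van_h // addr0.
  have [->|fh0] := eqVneq (f - h) 0; first exact: mmap0.
  apply: IH => //; rewrite lt_neqAle.
  have le : (mlead (f - h) <= mlead f)%O.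
    by have := mleadB_le f h; rewrite hh joinxx.
  rewrite le andbT; apply: contra_neq fh0 => E.
  by apply/eqP; rewrite -mleadc_eq0 E mcoeffB hc subrr.
have PJ p : P p -> J p.
  by exists [:: p] => [q|L i x v]; [rewrite inE => /eqP -> | apply: v; rewrite inE].
have /choice[w hw] (g : mpoly m K) : exists l' : seq (mpoly m K), g \in l ->
    (forall p, p \in l' -> P p) /\
    forall (L : fieldType) (i : {rmorphism K -> L}) (x : 'I_m -> L),
    van L i x l' -> mmap i x g = 0.
  have [gl|] := boolP (g \in l); last by exists [::].
  by have [[l' h1 h2] _] := lJ g gl; exists l'.
exists (flatten (map w l)); split=> [p /flattenP[l' /mapP[g gl ->]]|L i x v p Pp].
  by have [h _] := hw g gl; exact: h.
apply: van_l (PJ p Pp) _ _ _ _ => g gl; have [_ h] := hw g gl; apply: h => q ql.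
by apply: v; apply/flattenP; exists (w g) => //; apply: map_f.
Qed.

End HilbertBasis.

(** * Polynomial matrix families and algebraic groups *)

Section MatrixFamilies.
Import -(notations) mpoly.
Variable K : rcfType.

Definition polymx (I : Type) (m n : nat)
    (M : forall L : rcfType, {rmorphism K -> L} -> (I -> L) -> 'M[L]_(m, n)) :=
  forall a b, polyfam (fun (L : rcfType) (i : {rmorphism K -> L}) x => M L i x a b).

Variable I : Type.

Lemma eq_polyfam (T U : forall L : rcfType, {rmorphism K -> L} -> (I -> L) -> L) :
  (forall L i x, T L i x = U L i x) -> polyfam T -> polyfam U.
Proof. by move=> TU hT r; have [t ht] := hT r; exists t => L i s; rewrite -TU. Qed.

Lemma eq_definable (D E : forall L : rcfType, {rmorphism K -> L} -> (I -> L) -> Prop) :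
  (forall L i x, D L i x <-> E L i x) -> definable D -> definable E.
Proof. by move=> DE hD r; have [f hf] := hD r; exists f => L i s; rewrite -DE. Qed.

Lemma polymx_var m n (k : 'I_m -> 'I_n -> I) :
  polymx (fun (L : rcfType) (i : {rmorphism K -> L}) (x : I -> L) =>
    \matrix_(a, b) x (k a b)).
Proof.
move=> a b; apply: eq_polyfam (polyfam_var K (k a b)) => L i x.
by rewrite mxE.
Qed.

Lemma polymx_cst m n (C : 'M[K]_(m, n)) :
  polymx (fun (L : rcfType) (i : {rmorphism K -> L}) (x : I -> L) => map_mx i C).
Proof.
move=> a b; apply: eq_polyfam (polyfam_cst (C a b)) => L i x.
by rewrite mxE.
Qed.

Lemma polymx_scalar n T : polyfam T ->
  polymx (fun (L : rcfType) (i : {rmorphism K -> L}) (x : I -> L) =>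
    (T L i x)%:M : 'M[L]_n).
Proof.
move=> hT a b; apply: (@eq_polyfam (fun (L : rcfType) (i : {rmorphism K -> L}) (x : I -> L) =>
  (if a == b then T L i x else 0))).
  by move=> L i x; rewrite mxE; case: eqP; rewrite ?mulr1n.
by case: eqP => _ //; apply: polyfam0.
Qed.

Lemma polymx_diag n T : polymx T ->
  polymx (fun (L : rcfType) (i : {rmorphism K -> L}) (x : I -> L) =>
    diag_mx (T L i x) : 'M[L]_n).
Proof.
move=> hT a b; apply: (@eq_polyfam (fun (L : rcfType) (i : {rmorphism K -> L}) (x : I -> L) =>
  (if a == b then T L i x 0 a else 0))).
  by move=> L i x; rewrite mxE; case: eqP; rewrite ?mulr1n.
by case: eqP => _ //; apply: polyfam0.
Qed.

Lemma polymx_mul m n p M N : polymx M -> polymx N ->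
  polymx (fun (L : rcfType) (i : {rmorphism K -> L}) (x : I -> L) =>
    (M L i x : 'M[L]_(m, n)) *m (N L i x : 'M[L]_(n, p))).
Proof.
move=> hM hN a b; have := @polyfam_sum K I 'I_n (index_enum 'I_n) xpredT
  (fun j L i x => M L i x a j * N L i x j b) (fun j => polyfam_mul (hM a j) (hN j b)).
by apply: eq_polyfam => L i x; rewrite mxE.
Qed.


Lemma polymx_tr m n M : polymx M ->
  polymx (fun (L : rcfType) (i : {rmorphism K -> L}) (x : I -> L) =>
    (M L i x : 'M[L]_(m, n))^T).
Proof. by move=> hM a b; apply: eq_polyfam (hM b a) => L i x; rewrite mxE. Qed.

Lemma polyfam_det n M : polymx M ->
  polyfam (fun (L : rcfType) (i : {rmorphism K -> L}) (x : I -> L) =>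
    \det (M L i x : 'M[L]_n)).
Proof.
move=> hM; rewrite /determinant; apply: polyfam_sum => s; apply: polyfam_mul.
  apply: polyfam_exp; apply: polyfam_opp; exact: (polyfam1 _).
by apply: polyfam_prod => a; apply: hM.
Qed.

Lemma definable_mxeq m n M N : polymx M -> polymx N ->
  definable (fun (L : rcfType) (i : {rmorphism K -> L}) (x : I -> L) =>
    (M L i x : 'M[L]_(m, n)) = N L i x).
Proof.
move=> hM hN; apply: (@eq_definable (fun (L : rcfType) (i : {rmorphism K -> L}) (x : I -> L) =>
  forall a b, M L i x a b = N L i x a b)).
  by move=> L i x; split=> [h|-> //]; apply/matrixP.
apply: definable_forall_fin => a; apply: definable_forall_fin => b.
exact: definable_eq.
Qed.

Lemma polyfam_mxeval n (p : mxpolynomial n K) M : polymx M ->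
  polyfam (fun (L : rcfType) (i : {rmorphism K -> L}) (x : I -> L) =>
    mxeval i p (M L i x)).
Proof.
move=> hM; rewrite /mxeval /peval /mpoly.mmap; apply: polyfam_sum => m.
apply: polyfam_mul; first exact: polyfam_cst.
apply: polyfam_prod => j; apply: polyfam_exp; case/mxvec_indexP: j => a b.
by apply: eq_polyfam (hM a b) => L i x; rewrite mxvecE.
Qed.

Lemma zeros_finite n (P : set (mxpolynomial n K)) :
  exists l : seq (mxpolynomial n K),
  forall (L : fieldType) (i : {rmorphism K -> L}),
    zeros i P = [set A | forall p : mxpolynomial n K, p \in l -> mxeval i p A = 0].
Proof.
have [l [lP h]] := hilbert_basis_zeros P; exists l => L i.
apply/seteqP; split=> A /= hA p Pp; first by apply: hA; apply: lP.
exact: h Pp.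
Qed.

Lemma definable_zeros n (P : set (mxpolynomial n K)) M : polymx M ->
  definable (fun (L : rcfType) (i : {rmorphism K -> L}) (x : I -> L) =>
    zeros i P (M L i x)).
Proof.
move=> hM; have [l hl] := zeros_finite P.
apply: (@eq_definable (fun (L : rcfType) (i : {rmorphism K -> L}) (x : I -> L) => forall p :
  mxpolynomial n K, p \in l -> mxeval i p (M L i x) = 0)).
  by move=> L i x; rewrite hl.
apply: definable_all => p _.
by apply: definable_eq; [exact: polyfam_mxeval | exact: polyfam0].
Qed.

Lemma definable_saext n (V : sadesc n K) M : polymx M ->
  definable (fun (L : rcfType) (i : {rmorphism K -> L}) (x : I -> L) =>
    saext i V (M L i x)).
Proof.
move=> hM; rewrite /saext /=; elim: V => [|c V IH] /=.
  exact: definable_cst.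
apply: (@eq_definable (fun (L : rcfType) (i : {rmorphism K -> L}) (x : I -> L) =>
    ((forall p : mxpolynomial n K, p \in c.1 -> mxeval i p (M L i x) = 0) /\
     (forall p : mxpolynomial n K, p \in c.2 -> 0 < mxeval i p (M L i x))) \/
    has (fun c => all (fun p => mxeval i p (M L i x) == 0) c.1
               && all (fun q => 0 < mxeval i q (M L i x)) c.2) V)).
  move=> L i x; split.
    move=> [[h1 h2]|->]; last by rewrite orbT.
    apply/orP; left; apply/andP; split; apply/allP => p pc; last exact: h2.
    by apply/eqP; apply: h1.
  move=> /orP[/andP[/allP h1 /allP h2]|->]; [left|by right].
  by split=> p pc; [apply/eqP; apply: h1 | apply: h2].
apply: definable_or IH; apply: definable_and; apply: definable_all => p _.
  by apply: definable_eq; [exact: polyfam_mxeval | exact: polyfam0].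
by apply: definable_lt; [exact: polyfam0 | exact: polyfam_mxeval].
Qed.

End MatrixFamilies.

Lemma mxeval_map n (K K' L : comNzRingType) (i : {rmorphism K -> K'})
    (j : {rmorphism K' -> L}) (k : K -> L) (p : mxpolynomial n K) (A : 'M[K']_n) :
  k =1 j \o i -> mxeval k p (map_mx j A) = j (mxeval i p A).
Proof.
move=> kE; rewrite /mxeval /peval /mpoly.mmap rmorph_sum; apply: eq_bigr => m _.
rewrite rmorphM kE; congr (_ * _); rewrite /mpoly.mmap1 rmorph_prod.
by apply: eq_bigr => a _; rewrite rmorphXn /= -map_mxvec mxE.
Qed.

(** * The group laws over every real closed field *)

Section AlgebraicGroup.
Variables (n : nat) (K : rcfType) (G : set (mxpolynomial n K)).

(** The hypotheses on algebraic groups concern points over [K[i]], which is not ordered. They are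
    first restricted to points over [K] by this equivalence and then transferred to all real closed
    extensions. *)
Lemma geom_real (A : 'M[K]_n) :
  geom G (map_mx (real_complex K) A) <-> zeros idfun G A.
Proof.
have E p : mxeval (real_complex K) p (map_mx (real_complex K) A)
    = real_complex K (mxeval idfun p A).
  by apply: (@mxeval_map _ _ _ _ idfun (real_complex K)).
split=> h p Gp; have := h p Gp; rewrite E; last by move=> ->; rewrite rmorph0.
by move/eqP; rewrite fmorph_eq0 => /eqP.
Qed.

Hypothesis hG : alg_subgroup_SL G.

Lemma det_zeros (L : rcfType) (i : {rmorphism K -> L}) A : zeros i G A -> \det A = 1.
Proof.
pose D (L : rcfType) (i : {rmorphism K -> L}) (x : void -> L) :=
  forall A : 'M[L]_n, zeros i G A -> \det A = 1.
have hD : definable D.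
  apply: definable_forall_mx; apply: definable_imply.
    by apply: definable_zeros; apply: polymx_var.
  apply: definable_eq; first by apply: polyfam_det; apply: polymx_var.
  exact: (polyfam1 _).
have v (M : Type) : void -> M by case.
apply: (definable_sentence hD idfun i (v _) (v _)).1 => B /geom_real/hG.2.
by rewrite det_map_mx => /eqP; rewrite fmorph_eq1 => /eqP.
Qed.

Lemma zeros1 (L : rcfType) (i : {rmorphism K -> L}) : zeros i G 1%:M.
Proof.
have v (M : Type) : void -> M by case.
have hD : definable (fun (L : rcfType) (i : {rmorphism K -> L}) (x : void -> L) =>
    zeros i G 1%:M).
  by apply: definable_zeros; apply: polymx_scalar; apply: (polyfam1 _).
apply: (definable_sentence hD idfun i (v _) (v _)).1.
by apply/geom_real; rewrite map_mx1; case: hG.1.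
Qed.

Lemma zerosM (L : rcfType) (i : {rmorphism K -> L}) A B :
  zeros i G A -> zeros i G B -> zeros i G (A *m B).
Proof.
move: A B; have v (M : Type) : void -> M by case.
pose D (L : rcfType) (i : {rmorphism K -> L}) (x : void -> L) :=
  forall A B : 'M[L]_n, zeros i G A -> zeros i G B -> zeros i G (A *m B).
have hD : definable D.
  do 2!apply: definable_forall_mx; do 2![apply: definable_imply;
    first by apply: definable_zeros; apply: polymx_var].
  by apply: definable_zeros; apply: polymx_mul; apply: polymx_var.
apply: (definable_sentence hD idfun i (v _) (v _)).1 => A B /geom_real GA /geom_real GB.
by apply/geom_real; rewrite map_mxM; case: hG.1 => _ + _; apply.
Qed.

Lemma zerosV (L : rcfType) (i : {rmorphism K -> L}) A :
  zeros i G A -> zeros i G (invmx A).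
Proof.
move: A; have v (M : Type) : void -> M by case.
(* The inverse is not a polynomial in the entries; it enters the sentence as a matrix [B] with
   [A *m B = 1%:M]. *)
pose D (L : rcfType) (i : {rmorphism K -> L}) (x : void -> L) :=
  forall A B : 'M[L]_n, zeros i G A -> A *m B = 1%:M -> zeros i G B.
have hD : definable D.
  do 2!apply: definable_forall_mx; apply: definable_imply.
    by apply: definable_zeros; apply: polymx_var.
  apply: definable_imply; last by apply: definable_zeros; apply: polymx_var.
  apply: definable_mxeq; first by apply: polymx_mul; apply: polymx_var.
  by apply: polymx_scalar; apply: (polyfam1 _).
move=> A GA; have uA : A \in unitmx by rewrite unitmxE (det_zeros GA) unitr1.
apply: ((definable_sentence hD idfun i (v _) (v _)).1 _ A) => //; last exact: mulmxV.
move=> B C GB BC; apply/geom_real; move/geom_real: GB => GB.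
have [uB EC] := mulmx1_unit BC; have -> : C = invmx B by rewrite -(mulKmx uB C) BC mulmx1.
by rewrite map_invmx; case: hG.1 => _ _ /(_ _ GB)[].
Qed.

Lemma zeros_unitmx (L : rcfType) (i : {rmorphism K -> L}) A :
  zeros i G A -> A \in unitmx.
Proof. by move=> GA; rewrite unitmxE (det_zeros GA) unitr1. Qed.

Hypothesis hGadj : forall g, geom G g -> geom G g^T.

Lemma zeros_tr (L : rcfType) (i : {rmorphism K -> L}) A :
  zeros i G A -> zeros i G A^T.
Proof.
move: A; have v (M : Type) : void -> M by case.
pose D (L : rcfType) (i : {rmorphism K -> L}) (x : void -> L) :=
  forall A : 'M[L]_n, zeros i G A -> zeros i G A^T.
have hD : definable D.
  apply: definable_forall_mx; apply: definable_imply.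
    by apply: definable_zeros; apply: polymx_var.
  by apply: definable_zeros; apply: polymx_tr; apply: polymx_var.
apply: (definable_sentence hD idfun i (v _) (v _)).1 => A /geom_real GA.
by apply/geom_real; rewrite -map_trmx; apply: hGadj.
Qed.

End AlgebraicGroup.

(** * Diagonalizable matrices *)

Section DiagonalConjugates.
Variables (L : fieldType) (n : nat).
Implicit Types (P M X : 'M[L]_n) (d e : 'rV[L]_n).

Definition dconj P d : 'M[L]_n := invmx P *m diag_mx d *m P.

Lemma dconjP P d M : P \in unitmx ->
  (M = dconj P d) <-> (P *m M *m invmx P = diag_mx d).
Proof.
move=> uP; rewrite /dconj; split=> [->|<-].
  by rewrite !mulmxA mulmxV // mul1mx mulmxK.
by rewrite !mulmxA mulVmx // mul1mx mulmxKV.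
Qed.

Lemma dconjM P d e : P \in unitmx ->
  dconj P d *m dconj P e = dconj P (\row_j (d 0 j * e 0 j)).
Proof.
move=> uP; rewrite /dconj !mulmxA mulmxK // -[_ *m diag_mx e]mulmxA mulmx_diag.
by congr (_ *m diag_mx _ *m _); apply/rowP => j; rewrite !mxE.
Qed.

Lemma dconj1 P : P \in unitmx -> dconj P (const_mx 1) = 1%:M.
Proof. by move=> uP; rewrite /dconj diag_const_mx mulmx1 mulVmx. Qed.

Lemma dconj_inj P : P \in unitmx -> injective (dconj P).
Proof.
move=> uP d e /(dconjP _ _ uP); rewrite /dconj !mulmxA mulmxV // mul1mx mulmxK //.
by move=> /matrixP E; apply/rowP => j; have := E j j; rewrite !mxE eqxx !mulr1n.
Qed.

Lemma dconj_unit P d : P \in unitmx -> (forall j, d 0 j != 0) -> dconj P d \in unitmx.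
Proof.
move=> uP hd; rewrite !unitmx_mul unitmx_inv uP !andbT unitmxE det_diag unitfE.
by apply/prodf_neq0.
Qed.

Lemma dconjV P d : P \in unitmx -> (forall j, d 0 j != 0) ->
  invmx (dconj P d) = dconj P (\row_j (d 0 j)^-1).
Proof.
move=> uP hd; have uM := dconj_unit uP hd; rewrite -[RHS](mulKmx uM) dconjM //.
rewrite (_ : \row_j _ = const_mx 1); first by rewrite dconj1 // mulmx1.
by apply/rowP => j; rewrite !mxE mulfV.
Qed.

Lemma dconj_exp P d k : P \in unitmx ->
  iter k (mulmx (dconj P d)) 1%:M = dconj P (\row_j (d 0 j ^+ k)).
Proof.
move=> uP; elim: k => [|k /= ->]; last first.
  by rewrite dconjM //; congr dconj; apply/rowP => j; rewrite !mxE exprS.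
by rewrite /= -(dconj1 uP); congr dconj; apply/rowP => j; rewrite !mxE expr0.
Qed.

(** Entry by entry: where [X a b] is nonzero the hypothesis says that the two diagonal values agree,
    so their images under [f] agree, for any function [f] whatsoever. *)
Lemma diag_intertwine (X : 'M[L]_n) d e (f : L -> L) :
  X *m diag_mx d = diag_mx e *m X ->
  X *m diag_mx (map_mx f d) = diag_mx (map_mx f e) *m X.
Proof.
move=> /matrixP E; apply/matrixP => a b; have := E a b.
rewrite !mul_mx_diag !mul_diag_mx !mxE => E'.
have [->|x0] := eqVneq (X a b) 0; first by rewrite mulr0 mul0r.
by rewrite mulrC; congr (f _ * _); apply: (mulIf x0); rewrite mulrC.
Qed.

(** Square roots, logarithms and exponentials of a diagonalizable matrix are obtained by applying a
    function to its eigenvalues, so they commute with everything the matrix commutes with. *)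
Lemma dconj_commute P d (f : L -> L) X : P \in unitmx ->
  X *m dconj P d = dconj P d *m X ->
  X *m dconj P (map_mx f d) = dconj P (map_mx f d) *m X.
Proof.
move=> uP E; pose Y := P *m X *m invmx P.
have cj e : (X *m dconj P e = dconj P e *m X) <-> (Y *m diag_mx e = diag_mx e *m Y).
  have E1 : Y *m diag_mx e = P *m (X *m dconj P e) *m invmx P.
    by rewrite /Y /dconj !mulmxA mulmxK.
  have E2 : diag_mx e *m Y = P *m (dconj P e *m X) *m invmx P.
    by rewrite /Y /dconj !mulmxA mulmxV // mul1mx.
  have uP' : invmx P \in unitmx by rewrite unitmx_inv.
  rewrite E1 E2; split=> [-> //|].
  by move=> /(can_inj (mulmxK uP'))/(can_inj (mulKmx uP)).
by apply/cj; apply: diag_intertwine; apply/cj.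
Qed.

End DiagonalConjugates.

(** Symmetry of [dconj P d] means that [P *m P^T] commutes with [diag_mx d], and such a relation
    survives the application of [f]. *)
Lemma dconj_sym (L : fieldType) n (P : 'M[L]_n) d (f : L -> L) : P \in unitmx ->
  (dconj P d)^T = dconj P d -> (dconj P (map_mx f d))^T = dconj P (map_mx f d).
Proof.
move=> uP E; pose X := P *m P^T.
have cj e : (dconj P e)^T = dconj P e <-> X *m diag_mx e = diag_mx e *m X.
  have uT : P^T \in unitmx by rewrite unitmx_tr.
  have E1 : X *m diag_mx e = P *m (dconj P e)^T *m P^T.
    by rewrite /X /dconj !trmx_mul tr_diag_mx !mulmxA trmx_inv mulmxKV.
  have E2 : diag_mx e *m X = P *m dconj P e *m P^T.
    by rewrite /X /dconj !mulmxA mulmxV // mul1mx.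
  rewrite E1 E2; split=> [-> //|].
  by move=> /(can_inj (mulmxK uT))/(can_inj (mulKmx uP)).
by apply/cj; apply: diag_intertwine; apply/cj.
Qed.

(** Over [L[i]] the matrix is hermitian, so the spectral theorem applies and its eigenvalues are
    real. Hence the minimal polynomial divides a product of distinct linear factors already defined
    over [L], which is diagonalizability over [L]. *)
Lemma symmetric_diagonalizable (L : rcfType) n (M : 'M[L]_n) : M^T = M ->
  exists P d, P \in unitmx /\ M = dconj P d.
Proof.
case: n M => [|n] M sM.
  by exists 1%:M, 0; split; [exact: unitmx1 | apply/matrixP => -[]].
suff [P uP] : diagonalizable M.
  move=> /(diagonalizable_forLR uP)[d ->]; exists P, d; split=> //.
  by rewrite mxpoly.conjVmx // /dconj mulmxA.
apply/diagonalizableP.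
pose f : {rmorphism L -> L[i]} := real_complex L.
have hM : map_mx f M \is hermsymmx.
  apply: realsym_hermsym.
    apply/is_hermitianmxP; rewrite expr0 scale1r.
    by apply/matrixP => a b; rewrite -[in LHS]sM !mxE.
  by apply/mxOverP => i j; rewrite mxE; apply/complex_realP; exists (M i j).
have /orthomx_spectralP E := hermitian_normalmx hM.
have rD := hermitian_spectral_diag_real hM.
set U := spectralmx _ in E; set D := spectral_diag _ in E rD.
have uU : U \in unitmx := spectral_unit _.
exists (undup [seq complex.Re (D 0 j) | j <- enum 'I_n.+1]); first exact: undup_uniq.
suff : map_poly f (mxminpoly M) %| map_poly f
    (\prod_(x <- undup [seq complex.Re (D 0 j) | j <- enum 'I_n.+1]) ('X - x%:P)).
  by rewrite dvdp_map.
rewrite -mxminpoly_map [X in mxminpoly X]E -mxpoly.conjVmx // mxpoly.mxminpoly_uconj ?unitmx_inv //.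
rewrite mxminpoly_diag rmorph_prod /=.
rewrite (eq_bigr (fun x : L => 'X - (f x)%:P)); last first.
  by move=> x _; rewrite rmorphB /= map_polyX map_polyC.
rewrite -(big_map f xpredT (fun z => 'X - z%:P)) -undup_map_inj; last exact: fmorph_inj.
have -> : map f [seq complex.Re (D 0 j) | j <- enum 'I_n.+1]
    = [seq D 0 j | j <- enum 'I_n.+1].
  rewrite -map_comp; apply: eq_map => j /=.
  by apply: RRe_real; have /mxOverP := rD; apply.
by [].
Qed.

Lemma mul_trmx_ge0 (L : realDomainType) n (v : 'rV[L]_n) :
  (0 <= (v *m v^T) 0 0) /\ ((v *m v^T) 0 0 = 0 -> v = 0).
Proof.
rewrite !mxE (eq_bigr (fun j => v 0 j ^+ 2)); last by move=> j _; rewrite mxE.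
have nn j : true -> 0 <= v 0 j ^+ 2 by rewrite sqr_ge0.
split=> [|/(psumr_eq0P nn) h]; first exact: sumr_ge0.
by apply/rowP => j; apply/eqP; rewrite !mxE -sqrf_eq0 h.
Qed.

(** For a left eigenvector [v] the eigenvalue times the squared length of [v] is the squared length
    of [v *m g^T], which is positive as [g] is invertible. *)
Lemma gram_diagonalizable (L : rcfType) n (g : 'M[L]_n) : g \in unitmx ->
  exists (P : 'M[L]_n) (d : 'rV[L]_n),
    [/\ P \in unitmx, forall j, 0 < d 0 j & g^T *m g = dconj P d].
Proof.
move=> ug; have [|P [d [uP E]]] := @symmetric_diagonalizable _ _ (g^T *m g).
  by rewrite trmx_mul trmxK.
exists P, d; split=> // j; pose v := row j P.
have vn0 : v != 0.
  apply/eqP => /(congr1 (mulmx^~ (invmx P))); rewrite -row_mul mulmxV // mul0mx.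
  by move=> /rowP/(_ j) /eqP; rewrite !mxE eqxx oner_eq0.
have v0 : v *m g^T != 0.
  apply: contra_neq vn0 => E'; have ugT : g^T \in unitmx by rewrite unitmx_tr.
  by rewrite -(mulmxK ugT v) E' mul0mx.
have Ev : v *m (g^T *m g) = d 0 j *: v.
  rewrite E /v /dconj -row_mul !mulmxA mulmxV // mul1mx row_mul.
  by rewrite row_diag_mx -scalemxAl -rowE.
have := congr1 (fun u => (u *m v^T) 0 0) Ev.
rewrite /= mulmxA -mulmxA -[g *m v^T]trmxK trmx_mul trmxK -scalemxAl [X in _ = X]mxE => H.
have [p1 n1] := mul_trmx_ge0 (v *m g^T); have [p2 n2] := mul_trmx_ge0 v.
have p1' : 0 < ((v *m g^T) *m (v *m g^T)^T) 0 0.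
  by rewrite lt_neqAle p1 andbT eq_sym; apply: contra_neq v0.
rewrite ltNge; apply/negP => dj; move: p1'; rewrite H ltNge => /negP; apply.
exact: mulr_le0_ge0.
Qed.

(** A finite list of elements of [E] whose span has maximal dimension already spans every element of
    [E], so simultaneous diagonalization of that list is enough. *)
Lemma codiagonalizable_set (L : fieldType) n (E : set 'M[L]_n) :
  (forall A B, E A -> E B -> A *m B = B *m A) ->
  (forall A, E A -> exists P d, P \in unitmx /\ A = dconj P d) ->
  exists2 P, P \in unitmx & forall A, E A -> exists d, A = dconj P d.
Proof.
move=> Ecomm Ediag.
pose Q k := `[< exists2 l : seq 'M[L]_n, (forall A, A \in l -> E A) & \dim (span l) = k >].
have exQ : exists k, Q k by exists (\dim (span ([::] : seq 'M[L]_n))); apply/asboolP; exists [::].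
have bQ k : Q k -> (k <= \dim {: 'M[L]_n})%N.
  by move=> /asboolP[l _ <-]; apply: dimvS; apply: subvf.
case: (ex_maxnP exQ bQ) => k /asboolP[l lE dl] kmax.
have El A : E A -> A \in (span l).
  move=> EA; have sl : (span l <= span (A :: l))%VS by apply: sub_span => B Bl; rewrite inE Bl orbT.
  have : \dim (span (A :: l)) = \dim (span l).
    apply/eqP; rewrite eqn_leq (dimvS sl) andbT dl kmax //; apply/asboolP.
    by exists (A :: l) => // B; rewrite inE => /orP[/eqP ->|/lE].
  move=> h; have : (span (A :: l) <= span l)%VS.
    by rewrite -(geq_leqif (dimv_leqif_sup sl)) h.
  by move=> /subvP; apply; rewrite memv_span // mem_head.
have /codiagonalizableP[P uP /allP dP] : {in l &, forall A B, comm_mx A B}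
    /\ {in l, forall A, diagonalizable A}.
  split=> [A B /lE EA /lE EB|A /lE EA]; first exact: Ecomm.
  have [P [d [uP ->]]] := Ediag A EA; exists P => //.
  apply/diagonalizable_forLR => //; exists d.
  by rewrite mxpoly.conjVmx.
exists P => // A /El Al.
have Pl B : B \in l -> exists d, P *m B *m invmx P = diag_mx d.
  move=> Bl; have /diagonalizable_forLR := dP B Bl; move=> /(_ uP)[d ->].
  by exists d; rewrite mxpoly.conjVmx // !mulmxA mulmxV // mul1mx mulmxK.
suff [d hd] : exists d, P *m A *m invmx P = diag_mx d by exists d; apply/dconjP.
rewrite (coord_span (X := in_tuple l) Al); elim/big_ind: _ => [|B C [d hd] [e he]|j _].
- exists 0; rewrite mulmx0 mul0mx; apply/matrixP => a b.
  by rewrite !mxE mul0rn.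
- by exists (d + e); rewrite mulmxDr mulmxDl hd he raddfD.
- have [d hd] := Pl _ (mem_nth 0 (ltn_ord j)); exists (coord (in_tuple l) j A *: d).
  by rewrite -scalemxAr -scalemxAl hd linearZ.
Qed.

(** * Linear independence of characters *)

Section Dedekind.
Variables (L : fieldType) (T J : Type) (D : set T) (mul : T -> T -> T) (one : T).
Variable chi : J -> T -> L.
Hypothesis D1 : D one.
Hypothesis DM : forall s t, D s -> D t -> D (mul s t).
Hypothesis chi1 : forall j, chi j one = 1.
Hypothesis chiM : forall j s t, D s -> D t -> chi j (mul s t) = chi j s * chi j t.

Let same j j' := `[< forall t, D t -> chi j t = chi j' t >].

Let sum_classes0 (l : seq (L * J)) (f : J -> L) :
  (forall j, \sum_(c <- l | same c.2 j) c.1 = 0) ->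
  (forall j j', (forall t, D t -> chi j t = chi j' t) -> f j = f j') ->
  \sum_(c <- l) c.1 * f c.2 = 0.
Proof.
move=> + fE; have [k] := ubnP (size l); elim: k l => // k IH [|c l].
  by rewrite big_nil.
rewrite ltnS => lk h; rewrite (bigID (fun b => same b.2 c.2)) /=.
rewrite (eq_bigr (fun b => b.1 * f c.2)); last first.
  by move=> b /asboolP/fE ->.
rewrite -mulr_suml h mul0r add0r -big_filter; apply: IH => [|j].
  have cc : same c.2 c.2 by apply/asboolP.
  by rewrite /= cc /=; apply: leq_ltn_trans lk; rewrite size_filter count_size.
rewrite big_filter_cond; have [/asboolP jc|/asboolP jc] := boolP (same j c.2).
  rewrite big_pred0 // => b; apply/negP => /andP[/negP nb /asboolP bj]; apply: nb.
  by apply/asboolP => t Dt; rewrite bj // jc.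
rewrite -[RHS](h j); apply: eq_bigl => b; case: (boolP (same b.2 j)); rewrite ?andbF //.
move=> /asboolP bj; rewrite andbT; apply/negP => /asboolP bc; apply: jc => t Dt.
by rewrite -bj // bc.
Qed.

(** In a linear relation between characters the coefficients of equal characters sum to zero, so the
    relation survives when the characters are replaced by any values that depend only on the
    character. It serves as the passage from a monoid to its Zariski closure. *)
Lemma dedekind_independence (l : seq (L * J)) (f : J -> L) :
  (forall t, D t -> \sum_(c <- l) c.1 * chi c.2 t = 0) ->
  (forall j j', (forall t, D t -> chi j t = chi j' t) -> f j = f j') ->
  \sum_(c <- l) c.1 * f c.2 = 0.
Proof.
move=> h; apply: sum_classes0 => j; have [k] := ubnP (size l); elim: k l h j => // k IH.
move=> [|c0 l] h j; first by rewrite big_nil.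
rewrite ltnS /= => lk.
have ndiff j' : ~~ same c0.2 j' -> \sum_(c <- c0 :: l | same c.2 j') c.1 = 0.
  move=> nj; rewrite big_cons (negbTE nj).
  have [s [Ds /eqP/negbTE ns]] : exists s, D s /\ chi c0.2 s <> chi j' s.
    apply: contrapT => hs; move/asboolP: nj; apply => s Ds.
    by apply: contrapT => e; apply: hs; exists s.
  (* Artin's trick: the relation at [mul s t] minus [chi c0.2 s] times the relation at [t] no longer
     involves [c0], and it multiplies the class of [j'] by a nonzero factor. *)
  pose l1 := [seq (c.1 * (chi c.2 s - chi c0.2 s), c.2) | c <- l].
  have : \sum_(c <- l1 | same c.2 j') c.1 = 0.
    apply: IH => [t Dt|]; last by rewrite size_map.
    rewrite big_map /=; have := h _ (DM Ds Dt); have := h _ Dt.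
    rewrite !big_cons => h1 h2.
    transitivity ((c0.1 * chi c0.2 (mul s t) + \sum_(c <- l) c.1 * chi c.2 (mul s t))
      - chi c0.2 s * (c0.1 * chi c0.2 t + \sum_(c <- l) c.1 * chi c.2 t)).
      rewrite mulrDr mulr_sumr chiM // opprD addrACA -[LHS]add0r; congr (_ + _).
        by rewrite mulrCA subrr.
      rewrite -sumrB; apply: eq_bigr => c _; rewrite chiM // mulrBr mulrBl; congr (_ - _).
        by rewrite mulrA.
      by rewrite mulrA [chi c0.2 s * _]mulrC.
    by rewrite h1 h2 mulr0 subrr.
  rewrite big_map /=.
  rewrite (eq_bigr (fun c => c.1 * (chi j' s - chi c0.2 s))); last first.
    by move=> c /asboolP e; rewrite e.
  rewrite -mulr_suml => /eqP; rewrite mulf_eq0 subr_eq0 [_ == chi c0.2 s]eq_sym ns orbF.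
  by move=> /eqP.
have [/asboolP e|] := boolP (same c0.2 j); last exact: ndiff.
(* The class of [c0] itself is lost in that difference; it is recovered from the relation at [one],
   where all characters are 1, since every other class sums to zero. *)
have E0 : \sum_(c <- c0 :: l) c.1 = 0.
  rewrite -[RHS](h one D1); apply: eq_bigr => c _.
  by rewrite chi1 mulr1.
rewrite (bigID (fun c => same c.2 j)) /= in E0.
rewrite [X in _ + X](_ : _ = 0) ?addr0 // in E0.
rewrite -big_filter (eq_bigr (fun c => c.1 * 1)); last by move=> c _; rewrite mulr1.
apply: (sum_classes0 (f := fun=> 1)) => // j'; rewrite big_filter_cond.
have [/asboolP ej|/asboolP ej] := boolP (same j' j).
  rewrite big_pred0 // => c; apply/negP => /andP[/negP nc /asboolP cj']; apply: nc.
  by apply/asboolP => t Dt; rewrite cj' // ej.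
transitivity (\sum_(c <- c0 :: l | same c.2 j') c.1).
  apply: eq_bigl => c; case: (boolP (same c.2 j')); rewrite ?andbF // => /asboolP cj'.
  rewrite andbT; apply/negP => /asboolP cj; apply: ej => t Dt.
  by rewrite -cj' // cj.
apply: ndiff; apply/negP => /asboolP c0j'; apply: ej => t Dt.
by rewrite -c0j' // e.
Qed.

End Dedekind.

(** * Polynomial equations as sums of monomials *)

Section MonomialSums.
Variables (L : comNzRingType) (n : nat).

Definition monomial (m : 'I_n -> nat) (x : 'I_n -> L) := \prod_j x j ^+ m j.

Definition monomial_sum (F : ('I_n -> L) -> L) :=
  exists l : seq (L * ('I_n -> nat)), forall x, F x = \sum_(c <- l) c.1 * monomial c.2 x.

Lemma monomial_sum_cst c : monomial_sum (fun=> c).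
Proof.
exists [:: (c, fun=> 0%N)] => x; rewrite big_seq1 /monomial big1 ?mulr1 //.
Qed.

Lemma monomial_sum_var j : monomial_sum (fun x => x j).
Proof.
exists [:: (1, fun k => (k == j : nat))] => x; rewrite big_seq1 mul1r /monomial.
rewrite (bigD1 j) //= eqxx expr1 big1 ?mulr1 // => k /negbTE ->.
by rewrite expr0.
Qed.

Lemma monomial_sumD F F' : monomial_sum F -> monomial_sum F' ->
  monomial_sum (fun x => F x + F' x).
Proof.
by move=> [l hl] [l' hl']; exists (l ++ l') => x; rewrite big_cat hl hl'.
Qed.

Lemma monomial_sumM F F' : monomial_sum F -> monomial_sum F' ->
  monomial_sum (fun x => F x * F' x).
Proof.
move=> [l hl] [l' hl'].
exists [seq (c.1 * c'.1, fun j => (c.2 j + c'.2 j)%N) | c <- l, c' <- l'] => x.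
rewrite hl hl' big_allpairs_dep mulr_suml; apply: eq_bigr => c _.
rewrite mulr_sumr; apply: eq_bigr => c' _ /=; rewrite mulrACA; congr (_ * _).
by rewrite /monomial -big_split; apply: eq_bigr => j _; rewrite exprD.
Qed.

Lemma monomial_sum_sum (I : Type) (l : seq I) F : (forall k, monomial_sum (F k)) ->
  monomial_sum (fun x => \sum_(k <- l) F k x).
Proof.
move=> hF; elim: l => [|k l IH].
  have [l hl] := monomial_sum_cst 0; exists l => x; rewrite big_nil; exact: hl.
have [l' hl'] := monomial_sumD (hF k) IH; exists l' => x; rewrite big_cons; exact: hl'.
Qed.

Lemma monomial_sum_prod (I : Type) (l : seq I) F : (forall k, monomial_sum (F k)) ->
  monomial_sum (fun x => \prod_(k <- l) F k x).
Proof.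
move=> hF; elim: l => [|k l IH].
  have [l hl] := monomial_sum_cst 1; exists l => x; rewrite big_nil; exact: hl.
have [l' hl'] := monomial_sumM (hF k) IH; exists l' => x; rewrite big_cons; exact: hl'.
Qed.

Lemma monomial_sumX F k : monomial_sum F -> monomial_sum (fun x => F x ^+ k).
Proof.
move=> hF; elim: k => [|k IH]; first exact: monomial_sum_cst.
by have [l hl] := monomial_sumM hF IH; exists l => x; rewrite exprS; exact: hl.
Qed.

Lemma monomial_sum_peval (K : comNzRingType) (i : K -> L) m (p : mpoly.mpoly m K) F :
  (forall k, monomial_sum (F k)) -> monomial_sum (fun x => peval i (fun k => F k x) p).
Proof.
move=> hF; apply: monomial_sum_sum => mm; apply: monomial_sumM.
  exact: monomial_sum_cst.
by apply: monomial_sum_prod => k; apply: monomial_sumX.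
Qed.

Lemma monomial_sum_mxeval (K : comNzRingType) (i : K -> L) m (p : mxpolynomial m K) M :
  (forall a b, monomial_sum (fun x => (M x : 'M[L]_m) a b)) ->
  monomial_sum (fun x => mxeval i p (M x)).
Proof.
move=> hM; apply: (@monomial_sum_peval _ _ _ _ (fun k x => mxvec (M x) 0 k)) => k.
case/mxvec_indexP: k => a b; have [l hl] := hM a b; exists l => x.
by rewrite mxvecE.
Qed.

End MonomialSums.

Lemma monomial_sum_dconj (L : fieldType) (K : comNzRingType) (i : K -> L) n
    (p : mxpolynomial n K) (P : 'M[L]_n) :
  monomial_sum (fun x => mxeval i p (dconj P (\row_j x j))).
Proof.
apply: monomial_sum_mxeval => a b.
have [l hl] := @monomial_sum_sum L n _ (index_enum 'I_n)
  (fun k x => invmx P a k * x k * P k b)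
  (fun k => monomial_sumM (monomial_sumM (monomial_sum_cst _ _) (monomial_sum_var _ k))
    (monomial_sum_cst _ _)).
exists l => x; rewrite -hl mxE; apply: eq_bigr => k _.
by rewrite mul_mx_diag !mxE.
Qed.

Lemma monomialM (L : comNzRingType) n (m : 'I_n -> nat) (x y : 'I_n -> L) :
  monomial m (fun j => x j * y j) = monomial m x * monomial m y.
Proof. by rewrite /monomial -big_split; apply: eq_bigr => j _; rewrite exprMn. Qed.

Lemma monomial1 (L : comNzRingType) n (m : 'I_n -> nat) :
  monomial m (fun=> 1 : L) = 1.
Proof. by rewrite /monomial big1 // => j _; rewrite expr1n. Qed.

(* If all powers of a diagonalizable matrix with positive eigenvalues satisfy a
   polynomial equation, then so does every generalized power of it: evaluated on the powers,
   the equation is a linear relation between characters of the monoid of exponents. *)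
Lemma zeros_generalized_power (K L : rcfType) (i : {rmorphism K -> L}) n
    (G : set (mxpolynomial n K)) (P : 'M[L]_n) (d : 'rV[L]_n) (g : L -> L) :
  (forall j, 0 < d 0 j) -> (forall k, zeros i G (dconj P (\row_j (d 0 j ^+ k)))) ->
  (forall x y, 0 < x -> 0 < y -> g (x * y) = g x * g y) -> g 1 = 1 ->
  zeros i G (dconj P (map_mx g d)).
Proof.
move=> d0 hk gM g1 p Gp; have [l hl] := monomial_sum_dconj i p P.
have -> : map_mx g d = \row_j (fun j => g (d 0 j)) j by apply/rowP => j; rewrite !mxE.
have mon_gt0 (m : 'I_n -> nat) : 0 < monomial m (d 0).
  by apply: prodr_gt0 => j _; rewrite exprn_gt0.
have gX x k : 0 < x -> g (x ^+ k) = g x ^+ k.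
  by move=> x0; elim: k => [|k IH]; rewrite ?expr0 // !exprS gM ?IH // exprn_gt0.
have gmon (m : 'I_n -> nat) : monomial m (fun j => g (d 0 j)) = g (monomial m (d 0)).
  rewrite /monomial.
  have : forall r : seq 'I_n, g (\prod_(j <- r) d 0 j ^+ m j) = \prod_(j <- r) g (d 0 j) ^+ m j.
    elim=> [|j r IH]; first by rewrite !big_nil.
    rewrite !big_cons gM ?IH ?gX ?exprn_gt0 //.
    by apply: prodr_gt0 => k _; rewrite exprn_gt0.
  by move=> ->.
rewrite hl; apply: (@dedekind_independence _ _ _ setT addn 0%N
  (fun m k => monomial m (fun j => d 0 j ^+ k)) I _ _ _ l
  (fun m => monomial m (fun j => g (d 0 j)))) => //.
- by move=> m; rewrite -[RHS](monomial1 _ m).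
- by move=> m s t _ _; rewrite -monomialM; congr monomial; apply/funext => j; rewrite exprD.
- by move=> k _; rewrite -hl; have := hk k p Gp.
- by move=> m m' /(_ 1%N I); rewrite !gmon => ->.
Qed.

(** * Split tori and their positive parts *)

Lemma polyfam_peval (K : rcfType) (I : Type) m (p : mpoly.mpoly m K)
    (T : 'I_m -> forall L : rcfType, {rmorphism K -> L} -> (I -> L) -> L) :
  (forall k, polyfam (T k)) ->
  polyfam (fun (L : rcfType) (i : {rmorphism K -> L}) (x : I -> L) =>
    peval i (fun k => T k L i x) p).
Proof.
move=> hT; rewrite /peval /mpoly.mmap; apply: polyfam_sum => mm.
apply: polyfam_mul; first exact: polyfam_cst.
by apply: polyfam_prod => j; apply: polyfam_exp.
Qed.

Lemma peval_map m (K K' L : comNzRingType) (i : {rmorphism K -> K'})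
    (j : {rmorphism K' -> L}) (k : K -> L) (p : mpoly.mpoly m K) (x : 'I_m -> K') :
  k =1 j \o i -> peval k (j \o x) p = j (peval i x p).
Proof.
move=> kE; rewrite /peval /mpoly.mmap rmorph_sum; apply: eq_bigr => mm _.
rewrite rmorphM kE; congr (_ * _); rewrite /mpoly.mmap1 rmorph_prod.
by apply: eq_bigr => a _; rewrite rmorphXn.
Qed.

Definition join_pt (d : nat) (L : Type) (t y : 'I_d -> L) : 'I_(d + d) -> L :=
  fun k => match fintype.split k with inl a => t a | inr b => y b end.

Section Torus.
Variables (n d : nat) (K : rcfType) (S : set (mxpolynomial n K)).
Variables (phi : 'I_n -> 'I_n -> mpoly.mpoly (d + d) K) (psi : 'I_d -> mxpolynomial n K).

(** The inverses of the parameters are passed as separate arguments [y], which keeps the map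
    polynomial; the statements about it assume [t j * y j = 1]. *)
Definition tor (L : rcfType) (i : {rmorphism K -> L}) (t y : 'I_d -> L) : 'M[L]_n :=
  \matrix_(a, b) peval i (join_pt t y) (phi a b).

Hypothesis hS : alg_subgroup_SL S.
Definition split_by := [/\
  (forall t, (forall i, t i != 0) -> geom S (mor_of_Gm phi t)),
  (forall t u, (forall i, t i != 0) -> (forall i, u i != 0) ->
     mor_of_Gm phi (fun i => t i * u i) = mor_of_Gm phi t *m mor_of_Gm phi u),
  (forall s i, geom S s -> mxeval (real_complex K) (psi i) s != 0),
  (forall s, geom S s ->
     mor_of_Gm phi (fun i => mxeval (real_complex K) (psi i) s) = s) &
  (forall t i, (forall i, t i != 0) ->
     mxeval (real_complex K) (psi i) (mor_of_Gm phi t) = t i)].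

Hypothesis hT : split_by.

Let h1 t : (forall i, t i != 0) -> geom S (mor_of_Gm phi t).
Proof. by case: hT => h _ _ _ _; apply: h. Qed.

Let h2 t u : (forall i, t i != 0) -> (forall i, u i != 0) ->
  mor_of_Gm phi (fun i => t i * u i) = mor_of_Gm phi t *m mor_of_Gm phi u.
Proof. by case: hT => _ h _ _ _; apply: h. Qed.

Let h3 s i : geom S s -> mxeval (real_complex K) (psi i) s != 0.
Proof. by case: hT => _ _ h _ _; apply: h. Qed.

Let h4 s : geom S s -> mor_of_Gm phi (fun i => mxeval (real_complex K) (psi i) s) = s.
Proof. by case: hT => _ _ _ h _; apply: h. Qed.

Let h5 t i : (forall i, t i != 0) ->
  mxeval (real_complex K) (psi i) (mor_of_Gm phi t) = t i.
Proof. by case: hT => _ _ _ _ h; apply: h. Qed.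

Lemma tor_real (t y : 'I_d -> K) : (forall i, t i * y i = 1) ->
  map_mx (real_complex K) (tor idfun t y) = mor_of_Gm phi (real_complex K \o t).
Proof.
move=> ty; apply/matrixP => a b; rewrite !mxE.
rewrite -(@peval_map _ _ _ _ idfun (real_complex K) (real_complex K)) //.
congr (peval _ _ _); apply/funext => k; rewrite /laurent_pt /join_pt /=.
case: fintype.split => // j; rewrite -fmorphV; congr (real_complex _ _).
have t0 : t j != 0 by apply/eqP => tj; have := ty j; rewrite tj mul0r => /esym/eqP;
  rewrite oner_eq0.
by apply: (mulfI t0); rewrite mulfV.
Qed.

Let real_neq0 (t y : 'I_d -> K) : (forall i, t i * y i = 1) ->
  forall j, (real_complex K \o t) j != 0.
Proof.
move=> ty j /=; rewrite fmorph_eq0; apply/eqP => tj; have := ty j.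
by rewrite tj mul0r => /esym/eqP; rewrite oner_eq0.
Qed.

Lemma polymx_tor (I : Type) (t y : 'I_d -> forall L : rcfType, {rmorphism K -> L} -> (I -> L) ->
  L) :
  (forall j, polyfam (t j)) -> (forall j, polyfam (y j)) ->
  polymx (fun (L : rcfType) (i : {rmorphism K -> L}) (x : I -> L) =>
    tor i (fun j => t j L i x) (fun j => y j L i x)).
Proof.
move=> ht hy a b; rewrite /tor.
apply: (@eq_polyfam K I (fun L i x =>
  peval i (join_pt (fun j => t j L i x) (fun j => y j L i x)) (phi a b))).
  by move=> L i x; rewrite mxE.
apply: (@polyfam_peval K I (d + d) (phi a b)
  (fun k L i x => join_pt (fun j => t j L i x) (fun j => y j L i x) k)) => k.
by rewrite /join_pt; case: fintype.split.
Qed.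

Lemma definable_inverse (I : Type) (t y : 'I_d -> forall L : rcfType, {rmorphism K -> L} -> (I ->
  L) -> L) :
  (forall j, polyfam (t j)) -> (forall j, polyfam (y j)) ->
  definable (fun (L : rcfType) (i : {rmorphism K -> L}) (x : I -> L) =>
    forall j, t j L i x * y j L i x = 1).
Proof.
move=> ht hy; apply: definable_forall_fin => j; apply: definable_eq; last exact: polyfam1.
exact: polyfam_mul.
Qed.

Let v (M : Type) : void -> M. Proof. by case. Qed.

Lemma tor_zeros (L : rcfType) (i : {rmorphism K -> L}) (t y : 'I_d -> L) :
  (forall j, t j * y j = 1) -> zeros i S (tor i t y).
Proof.
move: t y; pose D (L : rcfType) (i : {rmorphism K -> L}) (x : void -> L) :=
  forall t y : 'I_d -> L, (forall j, t j * y j = 1) -> zeros i S (tor i t y).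
have hD : definable D.
  do 2!apply: definable_forall; apply: definable_imply.
    by apply: definable_inverse => j; apply: polyfam_var.
  by apply: definable_zeros; apply: polymx_tor => j; apply: polyfam_var.
apply: (definable_sentence hD idfun i (v _) (v _)).1 => t y ty.
by apply/geom_real; rewrite tor_real //; apply: h1; apply: real_neq0 ty.
Qed.

Lemma psi_tor (L : rcfType) (i : {rmorphism K -> L}) (t y : 'I_d -> L) :
  (forall j, t j * y j = 1) -> forall j, mxeval i (psi j) (tor i t y) = t j.
Proof.
move: t y; pose D (L : rcfType) (i : {rmorphism K -> L}) (x : void -> L) :=
  forall t y : 'I_d -> L, (forall j, t j * y j = 1) ->
    forall j, mxeval i (psi j) (tor i t y) = t j.
have hD : definable D.
  do 2!apply: definable_forall; apply: definable_imply.
    by apply: definable_inverse => j; apply: polyfam_var.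
  apply: definable_forall_fin => j; apply: definable_eq; last exact: polyfam_var.
  by apply: polyfam_mxeval; apply: polymx_tor => k; apply: polyfam_var.
apply: (definable_sentence hD idfun i (v _) (v _)).1 => t y ty j.
apply: (fmorph_inj (real_complex K)); rewrite -(@mxeval_map _ _ _ _ idfun _ (real_complex K)) //.
by rewrite tor_real // h5 //; apply: real_neq0 ty.
Qed.

Lemma torM (L : rcfType) (i : {rmorphism K -> L}) (t y t' y' : 'I_d -> L) :
  (forall j, t j * y j = 1) -> (forall j, t' j * y' j = 1) ->
  tor i (fun j => t j * t' j) (fun j => y j * y' j) = tor i t y *m tor i t' y'.
Proof.
move: t y t' y'; pose D (L : rcfType) (i : {rmorphism K -> L}) (x : void -> L) :=
  forall t y t' y' : 'I_d -> L, (forall j, t j * y j = 1) -> (forall j, t' j * y' j = 1) ->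
  tor i (fun j => t j * t' j) (fun j => y j * y' j) = tor i t y *m tor i t' y'.
have hD : definable D.
  do 4!apply: definable_forall; do 2![apply: definable_imply;
    first by apply: definable_inverse => j; apply: polyfam_var].
  apply: definable_mxeq; first by apply: polymx_tor => j; apply: polyfam_mul; apply: polyfam_var.
  by apply: polymx_mul; apply: polymx_tor => j; apply: polyfam_var.
apply: (definable_sentence hD idfun i (v _) (v _)).1 => t y t' y' ty ty'.
have tty j : t j * t' j * (y j * y' j) = 1 by rewrite mulrACA ty ty' mulr1.
apply: (@map_mx_inj _ _ (real_complex K)).
rewrite map_mxM !tor_real // -h2; try exact: real_neq0.
by congr mor_of_Gm; apply/funext => j; rewrite /= rmorphM.
Qed.

Lemma psi_neq0 (L : rcfType) (i : {rmorphism K -> L}) s :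
  zeros i S s -> forall j, mxeval i (psi j) s != 0.
Proof.
move: s; pose D (L : rcfType) (i : {rmorphism K -> L}) (x : void -> L) :=
  forall s : 'M[L]_n, zeros i S s -> forall j, ~ (mxeval i (psi j) s = 0).
suff h : D L i (v _) by move=> s Ss j; apply/eqP; apply: h.
have hD : definable D.
  apply: definable_forall_mx; apply: definable_imply.
    by apply: definable_zeros; apply: polymx_var.
  apply: definable_forall_fin => j; apply: definable_not; apply: definable_eq; last exact: polyfam0.
  by apply: polyfam_mxeval; apply: polymx_var.
apply: (definable_sentence hD idfun i (v _) (v _)).1 => s /geom_real Ss j.
move=> /(congr1 (real_complex K)); rewrite -(@mxeval_map _ _ _ _ idfun _ (real_complex K)) //.
by rewrite rmorph0 => /eqP; apply/negP; apply: h3.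
Qed.

Lemma tor_psi (L : rcfType) (i : {rmorphism K -> L}) s : zeros i S s ->
  tor i (fun j => mxeval i (psi j) s) (fun j => (mxeval i (psi j) s)^-1) = s.
Proof.
move: s; pose D (L : rcfType) (i : {rmorphism K -> L}) (x : void -> L) :=
  forall s : 'M[L]_n, forall y : 'I_d -> L, zeros i S s ->
  (forall j, mxeval i (psi j) s * y j = 1) ->
  tor i (fun j => mxeval i (psi j) s) y = s.
suff h : D L i (v _) by move=> s Ss; apply: h => // j; rewrite mulfV // psi_neq0.
have hD : definable D.
  apply: definable_forall_mx; apply: definable_forall; apply: definable_imply.
    by apply: definable_zeros; apply: polymx_var.
  apply: definable_imply.
    apply: definable_inverse => j; last exact: polyfam_var.
    by apply: polyfam_mxeval; apply: polymx_var.
  apply: definable_mxeq; last exact: polymx_var.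
  apply: polymx_tor => j; last exact: polyfam_var.
  by apply: polyfam_mxeval; apply: polymx_var.
apply: (definable_sentence hD idfun i (v _) (v _)).1 => s y Ss sy.
apply: (@map_mx_inj _ _ (real_complex K)).
rewrite tor_real // -[RHS]h4; last exact/geom_real.
congr mor_of_Gm; apply/funext => j /=.
by rewrite -(@mxeval_map _ _ _ _ idfun _ (real_complex K)).
Qed.

Definition pos_tor (L : rcfType) (i : {rmorphism K -> L}) : set 'M[L]_n :=
  [set s | zeros i S s /\ forall j, 0 < mxeval i (psi j) s].

Lemma definable_pos_tor (I : Type) M : polymx M ->
  definable (fun (L : rcfType) (i : {rmorphism K -> L}) (x : I -> L) => pos_tor i (M L i x)).
Proof.
move=> hM; apply: definable_and; first exact: definable_zeros.
apply: definable_forall_fin => j; apply: definable_lt; first exact: polyfam0.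
exact: polyfam_mxeval.
Qed.

Lemma tor1 (L : rcfType) (i : {rmorphism K -> L}) : tor i (fun=> 1) (fun=> 1) = 1%:M.
Proof.
have o : forall j : 'I_d, (1 : L) * 1 = 1 by move=> _; rewrite mulr1.
have u : tor i (fun=> 1) (fun=> 1) \in unitmx by apply: (zeros_unitmx hS); apply: tor_zeros.
have E := torM i o o; rewrite -[LHS](mulKmx u) -E.
have -> : (fun _ : 'I_d => (1 : L) * 1) = (fun=> 1) by apply/funext => j; rewrite mulr1.
by rewrite mulVmx.
Qed.

Lemma psi1 (L : rcfType) (i : {rmorphism K -> L}) j : mxeval i (psi j) 1%:M = 1.
Proof. by rewrite -(tor1 i) psi_tor // => k; rewrite mulr1. Qed.

Lemma psiM (L : rcfType) (i : {rmorphism K -> L}) s s' j : zeros i S s -> zeros i S s' ->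
  mxeval i (psi j) (s *m s') = mxeval i (psi j) s * mxeval i (psi j) s'.
Proof.
move=> Ss Ss'; rewrite -{1}(tor_psi Ss) -{1}(tor_psi Ss').
have e k := mulfV (psi_neq0 Ss k); have e' k := mulfV (psi_neq0 Ss' k).
rewrite -torM // psi_tor // => k.
by rewrite mulrACA e e' mulr1.
Qed.

Lemma pos_tor_sqrt (L : rcfType) (i : {rmorphism K -> L}) s : pos_tor i s ->
  exists2 r, pos_tor i r & s = r *m r.
Proof.
move=> [Ss ps]; pose t j := Num.sqrt (mxeval i (psi j) s).
have t0 j : t j * (t j)^-1 = 1 by rewrite mulfV // gt_eqF // sqrtr_gt0.
exists (tor i t (fun j => (t j)^-1)).
  by split=> [|j]; [exact: tor_zeros | rewrite psi_tor // sqrtr_gt0].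
rewrite -torM // -[LHS](tor_psi Ss); congr tor; apply/funext => j;
by rewrite -?invfM -expr2 sqr_sqrtr // ltW.
Qed.

End Torus.

Lemma continuous_peval (K L : rcfType) (i : K -> L) (T : topologicalType) (x : T) m
    (p : mpoly.mpoly m K) (F : 'I_m -> T -> L) :
  (forall k, {for x, continuous (F k)}) ->
  {for x, continuous (fun y => peval i (fun k => F k y) p)}.
Proof.
move=> cF.
have csum (I : Type) (l : seq I) (G : I -> T -> L) : (forall k, {for x, continuous (G k)}) ->
    {for x, continuous (fun y => \sum_(k <- l) G k y)}.
  move=> hG; elim: l => [|k l IH].
    by rewrite (funext (fun y => big_nil _ _ _ _)); exact: cst_continuous.
  by rewrite (funext (fun y => big_cons _ _ _ _ _ _)); apply: continuousD; [exact: hG | exact: IH].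
have cprod (I : Type) (l : seq I) (G : I -> T -> L) : (forall k, {for x, continuous (G k)}) ->
    {for x, continuous (fun y => \prod_(k <- l) G k y)}.
  move=> hG; elim: l => [|k l IH].
    by rewrite (funext (fun y => big_nil _ _ _ _)); exact: cst_continuous.
  by rewrite (funext (fun y => big_cons _ _ _ _ _ _)); apply: continuousM; [exact: hG | exact: IH].
have cexp (G : T -> L) k : {for x, continuous G} -> {for x, continuous (fun y => G y ^+ k)}.
  move=> hG; elim: k => [|k IH]; first exact: cst_continuous.
  by rewrite (funext (fun y => exprS _ _)); apply: (@continuousM _ _ G (fun y => G y ^+ k)).
apply: csum => mm; apply: continuousM; first exact: cst_continuous.
by apply: cprod => j; apply: cexp.
Qed.

Lemma continuous_mxeval (K L : rcfType) (i : K -> L) n (p : mxpolynomial n K) :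
  continuous (fun A : 'M[L]_n => mxeval i p A).
Proof.
move=> A; apply: (@continuous_peval _ _ i _ A _ p (fun k B => mxvec B 0 k)) => k.
case/mxvec_indexP: k => a b.
by rewrite (funext (fun B => mxvecE _ _ _)); exact: coord_continuous.
Qed.

Lemma closure_mx (L : rcfType) m n (C : set 'M[L]_(m, n)) (M : 'M[L]_(m, n)) : closed C ->
  (forall e, 0 < e -> exists2 N, C N & forall a b, `|M a b - N a b| < e) -> C M.
Proof.
move=> clC h; apply: clC => B /nbhs_ballP[e /= e0 eB]; have [N CN hN] := h e e0.
by exists N; split=> //; apply: eB; split=> // a b; apply: hN.
Qed.

Lemma polynomial_le_closed (K : rcfType) n (p : mxpolynomial n K) :
  closed [set A : 'M[K]_n | 0 <= mxeval idfun p A]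
  /\ closed [set A : 'M[K]_n | mxeval idfun p A <= 0].
Proof.
have c := @continuous_mxeval K K idfun n p.
by split; [apply: (@preimage_closed _ _ (fun A => mxeval idfun p A) [set x : K | 0 <= x])
  | apply: (@preimage_closed _ _ (fun A => mxeval idfun p A) [set x : K | x <= 0])];
  [move=> x _; exact: c | exact: closed_ge | move=> x _; exact: c | exact: closed_le].
Qed.

(** * The identity component of the torus *)

Section Component.
Import -(notations) mpoly.
Variables (n d : nat) (K : rcfType) (S : set (mxpolynomial n K)).
Variables (phi : 'I_n -> 'I_n -> mpoly.mpoly (d + d) K) (psi : 'I_d -> mxpolynomial n K).
Hypothesis hS : alg_subgroup_SL S.
Hypothesis hT : split_by S phi psi.

Lemma semialgebraic_positive (V : set 'M[K]_n) (q : mxpolynomial n K) :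
  semialgebraic V -> semialgebraic (V `&` [set A | 0 < mxeval idfun q A]).
Proof.
move=> [D ->]; exists [seq (c.1, q :: c.2) | c <- D].
apply/seteqP; split=> A; rewrite /saext /= has_map /=.
  move=> [/hasP[c cD /andP[h1 h2]] h]; apply/hasP; exists c => //=.
  by rewrite h1 h2 h.
move=> /hasP[c cD /= /and3P[h1 h h2]]; split=> //; apply/hasP; exists c => //.
by rewrite h1 h2.
Qed.

(** A coordinate [psi j] never vanishes on the torus, so its sign splits [A] into two relatively
    closed semialgebraic pieces; connectedness leaves the one that contains the identity, where the
    coordinate is 1. *)
Lemma sa_component_sub_pos_tor (A : set 'M[K]_n) :
  sa_component (zeros idfun S) 1%:M A -> A `<=` pos_tor S psi idfun.
Proof.
move=> [sA AS A1 cA _] s As; split=> [|j]; first exact: AS.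
have psi0 r : A r -> mxeval idfun (psi j) r != 0.
  by move=> /AS h; exact: (psi_neq0 hT (i := idfun) h j).
have [cl1 cl2] := polynomial_le_closed (psi j).
pose B1 := A `&` [set r | 0 < mxeval idfun (psi j) r].
pose B2 := A `&` [set r | 0 < mxeval idfun (- psi j) r].
have opE r : mxeval idfun (- psi j) r = - mxeval idfun (psi j) r by apply: mmapN.
have [| | | | | |E|E] := cA B1 B2.
- exact: semialgebraic_positive.
- exact: semialgebraic_positive.
- exists [set r | 0 <= mxeval idfun (psi j) r]; split=> //.
  apply/seteqP; split=> r [Ar /=] h; split=> //=; first exact: ltW.
  by rewrite lt_neqAle eq_sym psi0.
- exists [set r | mxeval idfun (psi j) r <= 0]; split=> //.
  apply/seteqP; split=> r [Ar /=]; rewrite ?opE => h; split=> //=.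
    by rewrite ltW // -oppr_gt0.
  by rewrite opE oppr_gt0 lt_neqAle psi0.
- apply/seteqP; split=> r; first by case=> -[].
  move=> Ar; have := psi0 r Ar; rewrite neq_lt => /orP[h|h].
    by right; split=> //=; rewrite opE oppr_gt0.
  by left.
- apply/seteqP; split=> // r [[_ /= h1] [_ /=]]; rewrite opE oppr_gt0 => h2.
  by have := lt_trans h1 h2; rewrite ltxx.
- by move: As; rewrite -E => -[].
- by move: A1; rewrite -E => -[_ /=]; rewrite opE (psi1 hS hT) oppr_gt0 ltr10.
Qed.

(** Relative closedness, with the distance bounded by two polynomial inequalities per entry instead
    of a topology, so that the connectedness condition for two given definable pieces becomes a
    first-order sentence. *)
Definition eps_closed (L : rcfType) (V B : set 'M[L]_n) :=
  forall s, V s -> (forall e, 0 < e -> exists N, [/\ V N, B N &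
    forall a b, s a b - N a b < e /\ N a b - s a b < e]) -> B s.

Definition eps_connected (L : rcfType) (V B1 B2 : set 'M[L]_n) :=
  (forall s, V s -> B1 s \/ B2 s) -> (forall s, V s -> ~ (B1 s /\ B2 s)) ->
  eps_closed V B1 -> eps_closed V B2 -> B1 1%:M -> forall s, V s -> B1 s.

Lemma definable_eps_connected (V B1 B2 : forall L : rcfType, {rmorphism K -> L} -> set 'M[L]_n) :
  (forall (I : Type) M, polymx M -> definable
    (fun (L : rcfType) (i : {rmorphism K -> L}) (x : I -> L) => V L i (M L i x))) ->
  (forall (I : Type) M, polymx M -> definable
    (fun (L : rcfType) (i : {rmorphism K -> L}) (x : I -> L) => B1 L i (M L i x))) ->
  (forall (I : Type) M, polymx M -> definable
    (fun (L : rcfType) (i : {rmorphism K -> L}) (x : I -> L) => B2 L i (M L i x))) ->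
  definable (fun (L : rcfType) (i : {rmorphism K -> L}) (x : void -> L) =>
    eps_connected (V L i) (B1 L i) (B2 L i)).
Proof.
move=> hV h1 h2.
have heps (B : forall L : rcfType, {rmorphism K -> L} -> set 'M[L]_n) :
    (forall (I : Type) M, polymx M -> definable
    (fun (L : rcfType) (i : {rmorphism K -> L}) (x : I -> L) => B L i (M L i x))) ->
    definable (fun (L : rcfType) (i : {rmorphism K -> L}) (x : void -> L) =>
      eps_closed (V L i) (B L i)).
  move=> hB; apply: definable_forall_mx; apply: definable_imply.
    by apply: hV; apply: polymx_var.
  apply: definable_imply; last by apply: hB; apply: polymx_var.
  apply: definable_forall_elt; apply: definable_imply.
    by apply: definable_lt; [exact: polyfam0 | exact: polyfam_var].
  apply: definable_exists_mx.
  apply: (@eq_definable _ _ (fun L i x => V L i (\matrix_(a, b) x (inr (a, b))) /\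
    (B L i (\matrix_(a, b) x (inr (a, b))) /\ forall a b,
    (\matrix_(a, b) x (inl (inl (inr (a, b))))) a b -
       (\matrix_(a, b) x (inr (a, b))) a b < x (inl (inr ord0)) /\
    (\matrix_(a, b) x (inr (a, b))) a b -
       (\matrix_(a, b) x (inl (inl (inr (a, b))))) a b < x (inl (inr ord0))))).
    by move=> L i x; split=> [[? []]|[]].
  apply: definable_and; first by apply: hV; apply: polymx_var.
  apply: definable_and; first by apply: hB; apply: polymx_var.
  apply: definable_forall_fin => a; apply: definable_forall_fin => b.
  by apply: definable_and; apply: definable_lt; try exact: polyfam_var;
    apply: polyfam_add; try apply: polyfam_opp; apply: polymx_var.
apply: definable_imply.
  apply: definable_forall_mx; apply: definable_imply; first by apply: hV; apply: polymx_var.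
  by apply: definable_or; [apply: h1 | apply: h2]; apply: polymx_var.
apply: definable_imply.
  apply: definable_forall_mx; apply: definable_imply; first by apply: hV; apply: polymx_var.
  by apply: definable_not; apply: definable_and; [apply: h1 | apply: h2]; apply: polymx_var.
apply: definable_imply; first exact: heps.
apply: definable_imply; first exact: heps.
apply: definable_imply; first by apply: h1; apply: polymx_scalar; apply: polyfam1.
apply: definable_forall_mx; apply: definable_imply; first by apply: hV; apply: polymx_var.
by apply: h1; apply: polymx_var.
Qed.

(** In torus coordinates the segment from 1 to [s] stays positive; it gives a continuous path, and
    the connectedness of the unit interval, available over [R], concludes. *)
Lemma pos_tor_connected_real (R : realType) (iR : {rmorphism K -> R}) B1 B2 :
  eps_connected (pos_tor S psi iR) B1 B2.
Proof.
move=> cover disj cl1 cl2 B11 s Vs; have [Ss ps] := Vs.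
pose c (u : R) j := 1 + u * (mxeval iR (psi j) s - 1).
pose ga u := tor phi iR (c u) (fun j => (c u j)^-1).
have c_gt0 u j : u \in `[0, 1] -> 0 < c u j.
  rewrite in_itv /= => /andP[u0 u1].
  have -> : c u j = (1 - u) + u * mxeval iR (psi j) s.
    by rewrite /c mulrBr mulr1 addrCA addrC [in LHS]addrC addrA -addrA addrC.
  move: u0; rewrite le_eqVlt => /orP[/eqP <-|u0]; first by rewrite subr0 mul0r addr0.
  by rewrite ltr_wpDl ?subr_ge0 // mulr_gt0.
have c_inv u : u \in `[0, 1] -> forall j, c u j * (c u j)^-1 = 1.
  by move=> hu j; rewrite mulfV // gt_eqF // c_gt0.
have Vga u : u \in `[0, 1] -> pos_tor S psi iR (ga u).
  move=> hu; split=> [|j]; first by apply: (tor_zeros hT); apply: c_inv.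
  by rewrite (psi_tor hT) ?c_gt0 //; apply: c_inv.
have ga_cont u a b : u \in `[0, 1] -> {for u, continuous (fun u => ga u a b)}.
  move=> hu; rewrite (_ : (fun u => ga u a b) =
      (fun u => peval iR (join_pt (c u) (fun j => (c u j)^-1)) (phi a b))); last first.
    by apply/funext => w; rewrite mxE.
  apply: (@continuous_peval _ _ iR _ u _ (phi a b)
    (fun k u => join_pt (c u) (fun j => (c u j)^-1) k)) => k.
  have cc j : {for u, continuous (fun u => c u j)}.
    apply: continuousD; first exact: cst_continuous.
    by apply: continuousM; [exact: cvg_id | exact: cst_continuous].
  rewrite /join_pt; case: fintype.split => j; first exact: cc.
  by apply: continuousV; [rewrite gt_eqF // c_gt0 | exact: cc].
have closU B : eps_closed (pos_tor S psi iR) B ->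
    forall u, u \in `[0, 1] -> closure [set u | u \in `[0, 1] /\ B (ga u)] u -> B (ga u).
  move=> clB u hu cu; apply: clB; first exact: Vga.
  move=> e e0; pose W := [set w | forall a b, `|ga u a b - ga w a b| < e].
  have : nbhs u W.
    apply: (@filter_forall _ _ (fun a w => forall b, `|ga u a b - ga w a b| < e) (nbhs u)).
    move=> a; apply: (@filter_forall _ _ (fun b w => `|ga u a b - ga w a b| < e) (nbhs u)).
    by move=> b; have /cvgrPdist_lt/(_ e e0) := ga_cont u a b hu.
  move=> /cu[w [[hw Bw] Ww]]; exists (ga w); split=> // [|a b]; first exact: Vga.
  have := Ww a b; rewrite ltr_norml => /andP[h1 h2]; split=> //.
  by rewrite -opprB ltrNl.
have h01 u : u \in `[0, 1] -> B1 (ga u) \/ B2 (ga u) by move=> /Vga/cover.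
pose U1 := [set u | u \in `[0, 1] /\ B1 (ga u)].
pose U2 := [set u | u \in `[0, 1] /\ B2 (ga u)].
have E : U1 = `[0, 1]%classic.
  apply: (@segment_connected R 0 1).
  - exists 0; split; first by rewrite in_itv /= lexx ler01.
    suff -> : ga 0 = 1%:M by [].
    rewrite -(tor1 hS hT iR); congr tor; apply/funext => j;
    by rewrite /c mul0r addr0 ?invr1.
  - exists (~` closure U2); first by apply: closed_openC; exact: closed_closure.
    apply/seteqP; split=> u.
      move=> [hu b1]; split; first by rewrite /= hu.
      by move=> /(closU _ cl2 u hu) b2; apply: (disj _ (Vga _ hu)).
    move=> [/= hu nb]; split=> //; have [//|b2] := h01 u hu.
    by exfalso; apply: nb; apply: subset_closure.
  - exists (closure U1); first exact: closed_closure.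
    apply/seteqP; split=> u.
      by move=> [hu b1]; split; [rewrite /= hu | apply: subset_closure].
    by move=> [/= hu b1]; split=> //; exact: closU cl1 u hu b1.
have : U1 1 by rewrite E /= in_itv /= lexx ler01.
move=> [_]; suff -> : ga 1 = s by [].
rewrite -[RHS](tor_psi hT Ss); congr tor; apply/funext => j;
by rewrite /c mul1r addrC subrK.
Qed.

Lemma sa_component_pos_tor (R : realType) (iR : {rmorphism K -> R}) (A : set 'M[K]_n) :
  sa_component (zeros idfun S) 1%:M A -> A = pos_tor S psi idfun.
Proof.
move=> hA; apply/seteqP; split; first exact: sa_component_sub_pos_tor.
have [sA AS A1 cA maxA] := hA; apply: maxA.
- have [l hl] := zeros_finite S.
  have : semialgebraic (zeros idfun S : set 'M[K]_n).
    exists [:: (l, [::])]; apply/seteqP; split=> s; rewrite hl /saext /= orbF andbT.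
      by move=> h; apply/allP => p pl; apply/eqP; apply: h.
    by move=> /allP h p pl; apply/eqP; apply: h.
  rewrite (_ : pos_tor S psi idfun = [set s | zeros idfun S s /\
    forall j, j \in enum 'I_d -> 0 < mxeval idfun (psi j) s]); last first.
    apply/seteqP; split=> s [h1 h2]; split=> // j.
    by apply: h2; rewrite mem_enum.
  move=> hS0; elim: (enum 'I_d) => [|j r IH].
    rewrite (_ : [set s | _] = zeros idfun S) //.
    by apply/seteqP; split=> s //; case.
  have := semialgebraic_positive (psi j) IH.
  set X := _ `&` _; set Y := [set s | _]; suff -> : X = Y by [].
  apply/seteqP; split=> s; rewrite /X /Y /=.
    move=> [[h1 h2] h3]; split=> // k; rewrite inE => /orP[/eqP -> //|]; exact: h2.
  move=> [h1 h2]; split; last by apply: h2; rewrite inE eqxx.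
  by split=> // k kr; apply: h2; rewrite inE kr orbT.
- by move=> s [].
- by split=> [|j]; [exact: (zeros1 hS) | rewrite (psi1 hS hT)].
(* Connectedness quantifies over all semialgebraic pieces and is not one sentence. For each fixed
   pair of descriptions it is, and its truth over [R] carries over to [K]. *)
- have conn (D1 D2 : sadesc n K) :
      eps_connected (pos_tor S psi idfun) (saext idfun D1) (saext idfun D2).
    have v (M : Type) : void -> M by case.
    have h := @definable_eps_connected (fun L i => pos_tor S psi i)
      (fun L i => saext i D1) (fun L i => saext i D2) (@definable_pos_tor _ _ _ _ _)
      (fun I => @definable_saext _ _ _ D1) (fun I => @definable_saext _ _ _ D2).
    apply: (definable_sentence h iR idfun (v _) (v _)).1.
    exact: pos_tor_connected_real.
  have P1 : pos_tor S psi idfun 1%:M.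
    by split=> [|j]; [exact: (zeros1 hS) | rewrite (psi1 hS hT)].
  move=> B1 B2 [D1 ED1] [D2 ED2] [C1 [clC1 EB1]] [C2 [clC2 EB2]] EU EI.
  have eps_cl (C : set 'M[K]_n) B : closed C -> B = pos_tor S psi idfun `&` C ->
      eps_closed (pos_tor S psi idfun) B.
    move=> clC -> s Vs h; split=> //; apply: closure_mx clC _ => e e0.
    have [N [_ [_ CN] hN]] := h e e0; exists N => // a b.
    by have [h1 h2] := hN a b; rewrite ltr_norml h1 andbT ltrNl opprB.
  have cov s : pos_tor S psi idfun s -> B1 s \/ B2 s by rewrite -{1}EU.
  have dis s : ~ (B1 s /\ B2 s) by move=> h; have : (B1 `&` B2) s by []; rewrite EI.
  have : (B1 `|` B2) 1%:M by rewrite EU.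
  case=> b1; [left|right].
    apply/seteqP; split=> s; first by rewrite {1}EB1 => -[].
    move=> Vs; rewrite ED1; apply: (conn D1 D2) Vs; rewrite -?ED1 -?ED2 //.
    - exact: eps_cl clC1 EB1.
    - exact: eps_cl clC2 EB2.
  apply/seteqP; split=> s; first by rewrite {1}EB2 => -[].
  move=> Vs; rewrite ED2; apply: (conn D2 D1) Vs; rewrite -?ED1 -?ED2 //.
  - by move=> r /cov[]; [right|left].
  - by move=> r _ [h1 h2]; apply: (dis r).
  - exact: eps_cl clC2 EB2.
  - exact: eps_cl clC1 EB1.
Qed.

Lemma saext_pos_tor (R : realType) (iR : {rmorphism K -> R}) (A : sadesc n K) :
  sa_component (zeros idfun S) 1%:M (saext idfun A) ->
  forall (L : rcfType) (i : {rmorphism K -> L}), saext i A = pos_tor S psi i.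
Proof.
move=> /(sa_component_pos_tor iR) E L i.
pose D (L : rcfType) (i : {rmorphism K -> L}) (x : void -> L) :=
  forall s : 'M[L]_n, saext i A s <-> pos_tor S psi i s.
have hD : definable D.
  apply: definable_forall_mx; apply: definable_iff.
    by apply: definable_saext; apply: polymx_var.
  by apply: definable_pos_tor; apply: polymx_var.
have v (M : Type) : void -> M by case.
suff : D L i (v _) by move=> h; apply/seteqP; split=> s /h.
by apply: (definable_sentence hD idfun i (v _) (v _)).1 => s; rewrite E.
Qed.

End Component.

(** * Maximality of the split torus *)

(** A saturated sublattice of the integer row vectors is spanned by the first vectors of a basis of
    the whole lattice. The number [r] is taken maximal among unimodular matrices whose first [r]
    rows lie in the sublattice; one more independent vector would allow a larger [r] through the
    Smith normal form. *)
Lemma adapted_basis (n : nat) (triv : 'rV[int]_n -> Prop) :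
  triv 0 -> (forall u w, triv u -> triv w -> triv (u + w)) -> (forall u, triv u -> triv (- u)) ->
  (forall (k : int) u, k != 0 -> triv (k *: u) -> triv u) ->
  exists (U : 'M[int]_n) (r : nat), [/\ U \in unitmx,
    forall l : 'I_n, (l < r)%N -> triv (row l U) &
    forall c : 'rV[int]_n, triv (c *m U) -> forall l : 'I_n, (r <= l)%N -> c 0 l = 0].
Proof.
move=> triv0 trivD trivN trivS.
have trivZ (k : int) u : triv u -> triv (k *: u).
  move=> tu; have nat_case m : triv (m%:Z *: u).
    elim: m => [|m IH]; first by rewrite scale0r.
    by rewrite intS scalerDl scale1r; apply: trivD.
  by case: k => m; [exact: nat_case | rewrite NegzE scaleNr; apply: trivN; apply: nat_case].
have triv_sum m (F : 'I_m -> 'rV[int]_n) : (forall a, triv (F a)) -> triv (\sum_a F a).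
  by move=> hF; elim/big_ind: _.
have triv_comb m (u : 'rV[int]_m) (M : 'M[int]_(m, n)) :
    (forall a, triv (row a M)) -> triv (u *m M).
  by move=> hM; rewrite mulmx_sum_row; apply: triv_sum => a; apply: trivZ.
pose Q r := `[< (r <= n)%N /\ exists U : 'M[int]_n, U \in unitmx /\
  forall l : 'I_n, (l < r)%N -> triv (row l U) >].
have exQ : exists r, Q r by exists 0%N; apply/asboolP; split=> //; exists 1%:M; rewrite unitmx1.
have bQ r : Q r -> (r <= n)%N by move=> /asboolP[].
case: (ex_maxnP exQ bQ) => r /asboolP[rn [U [uU Ur]]] rmax.
exists U, r; split=> // c tc l rl; apply/eqP/negPn/negP => cl0.
have rn' : (r < n)%N by apply: leq_ltn_trans rl (ltn_ord l).
pose c2 : 'rV[int]_n := \row_j (if (j < r)%N then 0 else c 0 j).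
have tc2 : triv (c2 *m U).
  have -> : c2 = c - \row_j (if (j < r)%N then c 0 j else 0).
    by apply/rowP => j; rewrite !mxE; case: ifP; rewrite ?subrr ?subr0.
  rewrite mulmxBl; apply: trivD => //; apply: trivN; rewrite mulmx_sum_row.
  apply: triv_sum => j; rewrite mxE; case: ifP => jr; last by rewrite scale0r.
  by apply: trivZ; apply: Ur.
(* In the basis [U], these are the first [r] basis vectors together with the part of [c] outside
   their span. *)
pose N : 'M[int]_(r.+1, n) :=
  \matrix_(a, j) (if (a < r)%N then (val a == val j)%:R else c2 0 j).
have [L1 uL1 [R1 uR1 [dd _ EN]]] := int_Smith_normal_form N.
have tN a : triv (row a (N *m U)).
  rewrite row_mul; have [ar|ra] := ltnP a r.
    rewrite (_ : row a N *m U = row (Ordinal (ltn_trans ar rn')) U); first exact: Ur.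
    rewrite [RHS]rowE; congr (_ *m _); apply/rowP => j; rewrite !mxE ar eqxx /=.
    by rewrite -val_eqE /= eq_sym.
  rewrite (_ : row a N = c2) //; apply/rowP => j.
  by rewrite [LHS]mxE [LHS]mxE ltnNge ra.
(* The rows of [N] are linearly independent, so none of its elementary divisors vanishes; saturation
   may then divide by them. *)
have dd0 (a : 'I_r.+1) : dd`_a != 0.
  apply/eqP => da; have [u uE] : exists u, u = row a (invmx L1) by eexists.
  have uN : u *m N = 0.
    rewrite EN uE -row_mul -mulmxA mulKmx // row_mul (_ : row a _ = 0) ?mul0mx //.
    by apply/rowP => j; rewrite !mxE da mul0rn.
  have u_lt (b : 'I_r.+1) : (b < r)%N -> u 0 b = 0.
    move=> br; have := congr1 (fun z : 'rV_n => z 0 (Ordinal (ltn_trans br rn'))) uN.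
    rewrite /= [LHS]mxE [RHS]mxE (bigD1 b) //= mxE br eqxx mulr1 big1 ?addr0 // => k kb.
    rewrite !mxE; case: ifP => kr; last by rewrite br mulr0.
    by rewrite (negbTE (_ : val k != val b)) ?mulr0.
  have u_max : u 0 ord_max = 0.
    have := congr1 (fun z : 'rV_n => z 0 l) uN.
    rewrite /= [LHS]mxE [RHS]mxE (bigD1 ord_max) //= mxE ltnn big1 ?addr0.
      rewrite mxE ltnNge rl /= => /eqP; rewrite mulf_eq0 (negbTE cl0) orbF => /eqP //.
    move=> k kb; rewrite u_lt ?mul0r //.
    by rewrite ltn_neqAle -ltnS ltn_ord andbT; apply: contra_neq kb => kr; apply: val_inj.
  have u0 : u = 0.
    apply/rowP => b; rewrite [RHS]mxE; have [br|rb] := ltnP b r; first exact: u_lt.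
    rewrite (_ : b = ord_max) //; apply: val_inj; apply/eqP.
    by rewrite eqn_leq /= -ltnS ltn_ord.
  have := congr1 (mulmx^~ L1) u0; rewrite /= uE -row_mul mulVmx // mul0mx.
  by move=> /rowP/(_ a) /eqP; rewrite !mxE eqxx.
suff : (r.+1 <= r)%N by rewrite ltnn.
apply: rmax; apply/asboolP; split=> //; exists (R1 *m U); split.
  by rewrite unitmx_mul uR1.
move=> k kr; pose a : 'I_r.+1 := Ordinal kr.
apply: (trivS (dd`_a)) => //.
have -> : dd`_a *: row k (R1 *m U) = row a (invmx L1) *m (N *m U).
  rewrite EN -!mulmxA -row_mul mulKmx // [RHS]row_mul rowE scalemxAl.
  congr (_ *m _); apply/rowP => j; rewrite !mxE eqxx /=.
  by rewrite -val_eqE /= eq_sym; case: eqP; rewrite ?mulr1 ?mulr0.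
by apply: triv_comb => b; apply: tN.
Qed.

(** * Tori cut out by integer monomials *)

Section IntegerMonomials.
Variables (L : fieldType) (n : nat).
Implicit Types (x y : 'I_n -> L) (m : 'rV[int]_n).

Definition zmonomial m x := \prod_j x j ^ m 0 j.

Lemma zmonomial_neq0 m x : (forall j, x j != 0) -> zmonomial m x != 0.
Proof. by move=> x0; apply/prodf_neq0 => j _; rewrite expfz_neq0. Qed.

Lemma zmonomial0 x : zmonomial 0 x = 1.
Proof. by rewrite /zmonomial big1 // => j _; rewrite mxE expr0z. Qed.

Lemma zmonomialD m m' x : (forall j, x j != 0) ->
  zmonomial (m + m') x = zmonomial m x * zmonomial m' x.
Proof. by move=> x0; rewrite -big_split; apply: eq_bigr => j _; rewrite mxE expfzDr. Qed.

Lemma zmonomialZ (k : int) m x : zmonomial (k *: m) x = zmonomial m x ^ k.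
Proof.
rewrite /zmonomial (big_morph (fun z : L => z ^ k) (fun a b => expfzMl a b k) (exp1rz _ k)).
by apply: eq_bigr => j _; rewrite mxE mulrC exprz_exp.
Qed.

Lemma zmonomialM m x y : (forall j, x j != 0) -> (forall j, y j != 0) ->
  zmonomial m (fun j => x j * y j) = zmonomial m x * zmonomial m y.
Proof. by move=> x0 y0; rewrite -big_split; apply: eq_bigr => j _; rewrite expfzMl. Qed.

Lemma zmonomial_mulmx p (c : 'rV[int]_p) (U : 'M[int]_(p, n)) x : (forall j, x j != 0) ->
  zmonomial (c *m U) x = \prod_l zmonomial (row l U) x ^ c 0 l.
Proof.
move=> x0; rewrite mulmx_sum_row.
rewrite (big_morph (fun m => zmonomial m x) (id1 := 1) (op1 := *%R)).
- by apply: eq_bigr => l _; rewrite zmonomialZ.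
- by move=> m m'; apply: zmonomialD.
- exact: zmonomial0.
Qed.

End IntegerMonomials.

Section PolynomialMaps.
Import -(notations) mpoly.
Variables (K : fieldType) (m : nat) (X : fieldType -> Type).
Variable pt : forall L : fieldType, X L -> 'I_m -> L.
Implicit Types F H : forall L : fieldType, {rmorphism K -> L} -> X L -> L.

(** Unlike [polyfam], this yields an actual polynomial and covers all fields, among them [K[i]]. The
    equations and the coordinate maps of a new split torus are produced with it. *)
Definition polymap F := exists p : mpoly m K,
  forall (L : fieldType) (i : {rmorphism K -> L}) (x : X L), peval i (pt x) p = F L i x.

Lemma polymap_cst c : polymap (fun (L : fieldType) (i : {rmorphism K -> L}) (x : X L) => i c).
Proof. by exists (mpolyC m c) => L i x; apply: mmapC. Qed.

Lemma polymap_var k : polymap (fun (L : fieldType) (i : {rmorphism K -> L}) (x : X L) => pt x k).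
Proof. by exists (mpolyX K (mnm1 k)) => L i x; rewrite /peval mmapX mmap1U. Qed.

Lemma polymapD F H : polymap F -> polymap H ->
  polymap (fun (L : fieldType) (i : {rmorphism K -> L}) (x : X L) => F L i x + H L i x).
Proof.
by move=> [p hp] [q hq]; exists (p + q) => L i x; rewrite -hp -hq; apply: mmapD.
Qed.

Lemma polymapM F H : polymap F -> polymap H ->
  polymap (fun (L : fieldType) (i : {rmorphism K -> L}) (x : X L) => F L i x * H L i x).
Proof.
move=> [p hp] [q hq]; exists (p * q) => L i x; rewrite -hp -hq.
exact: (mmap_is_multiplicative _ _).1.
Qed.

Lemma eq_polymap F H : (forall L i x, F L i x = H L i x) -> polymap F -> polymap H.
Proof. by move=> E [p hp]; exists p => L i x; rewrite hp E. Qed.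

Lemma polymap1 : polymap (fun (L : fieldType) (i : {rmorphism K -> L}) (x : X L) => 1).
Proof. by apply: eq_polymap (polymap_cst 1) => L i x; rewrite rmorph1. Qed.

Lemma polymapN F : polymap F ->
  polymap (fun (L : fieldType) (i : {rmorphism K -> L}) (x : X L) => - F L i x).
Proof.
move=> hF; apply: eq_polymap (polymapM (polymap_cst (-1)) hF) => L i x.
by rewrite rmorphN1 mulN1r.
Qed.

Lemma polymap_sum (J : Type) (l : seq J) (P : pred J)
    (F : J -> forall L : fieldType, {rmorphism K -> L} -> X L -> L) :
  (forall j, polymap (F j)) ->
  polymap (fun (L : fieldType) (i : {rmorphism K -> L}) (x : X L) => \sum_(j <- l | P j) F j L i x).
Proof.
move=> hF; elim: l => [|j l IH].
  by apply: eq_polymap (polymap_cst 0) => L i x; rewrite big_nil rmorph0.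
have [Pj|/negbTE Pj] := boolP (P j).
  by apply: eq_polymap (polymapD (hF j) IH) => L i x; rewrite big_cons Pj.
by apply: eq_polymap IH => L i x; rewrite big_cons Pj.
Qed.

Lemma polymap_prod (J : Type) (l : seq J) (P : pred J)
    (F : J -> forall L : fieldType, {rmorphism K -> L} -> X L -> L) :
  (forall j, polymap (F j)) ->
  polymap (fun (L : fieldType) (i : {rmorphism K -> L}) (x : X L) =>
    \prod_(j <- l | P j) F j L i x).
Proof.
move=> hF; elim: l => [|j l IH].
  by apply: eq_polymap polymap1 => L i x; rewrite big_nil.
have [Pj|/negbTE Pj] := boolP (P j).
  by apply: eq_polymap (polymapM (hF j) IH) => L i x; rewrite big_cons Pj.
by apply: eq_polymap IH => L i x; rewrite big_cons Pj.
Qed.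

Lemma polymapX F k : polymap F ->
  polymap (fun (L : fieldType) (i : {rmorphism K -> L}) (x : X L) => F L i x ^+ k).
Proof.
move=> hF; elim: k => [|k IH].
  by apply: eq_polymap polymap1 => L i x; rewrite expr0.
by apply: eq_polymap (polymapM hF IH) => L i x; rewrite exprS.
Qed.

Lemma polymap_det p (M : forall L : fieldType, {rmorphism K -> L} -> X L -> 'M[L]_p) :
  (forall a b, polymap (fun (L : fieldType) (i : {rmorphism K -> L}) (x : X L) => M L i x a b)) ->
  polymap (fun (L : fieldType) (i : {rmorphism K -> L}) (x : X L) => \det (M L i x)).
Proof.
move=> hM; apply: polymap_sum => s; apply: polymapM.
  by apply: polymapX; apply: polymapN; apply: polymap1.
exact: polymap_prod.
Qed.

Lemma polymap_adj p (M : forall L : fieldType, {rmorphism K -> L} -> X L -> 'M[L]_p) a b :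
  (forall a b, polymap (fun (L : fieldType) (i : {rmorphism K -> L}) (x : X L) => M L i x a b)) ->
  polymap (fun (L : fieldType) (i : {rmorphism K -> L}) (x : X L) => (\adj (M L i x)) a b).
Proof.
move=> hM; apply: (@eq_polymap (fun L i x => cofactor (M L i x) b a)) => [L i x|].
  by rewrite mxE.
apply: polymapM; first by apply: polymapX; apply: polymapN; apply: polymap1.
apply: (@polymap_det _ (fun L i x => row' b (col' a (M L i x)))) => c e.
by apply: eq_polymap (hM (lift b c) (lift a e)) => L i x; rewrite !mxE.
Qed.

Lemma polymap_conj p (B C : 'M[K]_p) (M : forall L : fieldType, {rmorphism K -> L} -> X L ->
  'M[L]_p) a b :
  (forall a b, polymap (fun (L : fieldType) (i : {rmorphism K -> L}) (x : X L) => M L i x a b)) ->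
  polymap (fun (L : fieldType) (i : {rmorphism K -> L}) (x : X L) =>
    (map_mx i B *m M L i x *m map_mx i C) a b).
Proof.
move=> hM; apply: (@eq_polymap (fun L i x => \sum_k \sum_l i (B a l) * M L i x l k * i (C k b))).
  move=> L i x; rewrite mxE; apply: eq_bigr => k _; rewrite mxE mulr_suml.
  by apply: eq_bigr => l _; rewrite !mxE.
apply: polymap_sum => k; apply: polymap_sum => l.
by apply: polymapM; [apply: polymapM; [exact: polymap_cst | exact: hM] | exact: polymap_cst].
Qed.

End PolynomialMaps.

Lemma polymap_entry (K : fieldType) n a b :
  @polymap K _ (fun L : fieldType => 'M[L]_n) (fun L A k => mxvec A 0 k)
    (fun L i A => A a b).
Proof. by apply: eq_polymap (polymap_var K _ (mxvec_index a b)) => L i A; rewrite mxvecE. Qed.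

(* The exponent is nonnegative on [x] and negative on [y], which stands for [x^-1]. *)
Definition zpow (L : fieldType) (x y : L) (k : int) : L :=
  match k with Posz k => x ^+ k | Negz k => y ^+ k.+1 end.

Lemma zpowE (L : fieldType) (x y : L) k : x * y = 1 -> zpow x y k = x ^ k.
Proof.
move=> xy; have x0 : x != 0 by apply/eqP => x0; move/eqP: xy; rewrite x0 mul0r eq_sym oner_eq0.
have -> : y = x^-1 by apply: (mulfI x0); rewrite mulfV.
by case: k => k //=; rewrite exprVn.
Qed.

(** Zariski density of the positive [K]-points in the torus over [K[i]]: pulled back along [phi],
    [q] is a sum of Laurent monomials, that is, a linear relation between characters of the group of
    positive parameters. *)
Lemma zeros_dense_torus n d (K : rcfType) (S : set (mxpolynomial n K)) phi psi
    (q : mxpolynomial n K) : @split_by n d K S phi psi ->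
  (forall s, pos_tor S psi idfun s -> mxeval idfun q s = 0) ->
  forall s, geom S s -> mxeval (real_complex K) q s = 0.
Proof.
move=> hT qA s Ss; have [_ _ h3 h4 _] := hT.
pose f : {rmorphism K -> K[i]} := real_complex K.
pose T (x : 'I_(d + d) -> K[i]) : 'M[K[i]]_n := \matrix_(a, b) peval f x (phi a b).
have [l hl] : monomial_sum (fun x => mxeval f q (T x)).
  apply: monomial_sum_mxeval => a b.
  have [l hl] := @monomial_sum_peval K[i] (d + d) K f _ (phi a b) (fun k x => x k)
    (fun k => monomial_sum_var _ k).
  by exists l => x; rewrite mxE -hl.
pose ts j := mxeval f (psi j) s.
have ts0 j : ts j != 0 by apply: h3.
rewrite -(h4 s Ss) -[mor_of_Gm _ _]/(T (laurent_pt ts)) hl.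
pose pos (t : 'I_d -> K) := forall j, 0 < t j.
apply: (@dedekind_independence K[i] ('I_d -> K) ('I_(d + d) -> nat) pos
  (fun t u => (fun j => t j * u j)) (fun=> 1)
  (fun m t => monomial m (laurent_pt (f \o t))) _ _ _ _ l
  (fun m => monomial m (laurent_pt ts))).
- by move=> j; apply: ltr01.
- by move=> t u pt pu j; apply: mulr_gt0.
- move=> m; rewrite -[RHS](monomial1 K[i] m); congr monomial; apply/funext => k.
  by rewrite /laurent_pt; case: fintype.split => j /=; rewrite rmorph1 ?invr1.
- move=> m t u _ _; rewrite -monomialM; congr monomial; apply/funext => k.
  by rewrite /laurent_pt; case: fintype.split => j /=; rewrite rmorphM ?invfM.
- move=> t pt; rewrite -hl.
  have ty j : t j * (t j)^-1 = 1 by rewrite mulfV // gt_eqF.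
  have At : pos_tor S psi idfun (tor phi idfun t (fun j => (t j)^-1)).
    split=> [|j]; first exact: (tor_zeros hT).
    by rewrite (psi_tor hT).
  have -> : T (laurent_pt (f \o t)) = map_mx f (tor phi idfun t (fun j => (t j)^-1)).
    by rewrite (tor_real phi ty).
  by rewrite (@mxeval_map _ _ _ _ idfun f f) // qA // rmorph0.
- move=> m m' E.
  have mE (p : 'I_(d + d) -> nat) (x : 'I_d -> K[i]) : (forall j, x j != 0) ->
      monomial p (laurent_pt x) =
      \prod_j x j ^ ((p (lshift d j))%:Z - (p (rshift d j))%:Z).
    move=> x0; rewrite [RHS](eq_bigr (fun j => laurent_pt x (lshift d j) ^+ p (lshift d j)
      * laurent_pt x (rshift d j) ^+ p (rshift d j))).
      by rewrite big_split /monomial big_split_ord.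
    move=> j _; rewrite /laurent_pt (unsplitK (inl j)) (unsplitK (inr j)).
    by rewrite expfzDr // exprVn -exprnN.
  have ex j : (m (lshift d j))%:Z - (m (rshift d j))%:Z
      = (m' (lshift d j))%:Z - (m' (rshift d j))%:Z.
    (* Two Laurent monomials that agree on positive parameters have the same exponents: the value 2
       in one place and 1 elsewhere isolates one exponent, since 2 is not a root of unity. *)
    pose t k : K := if k == j then 2 else 1.
    have t0 k : (f \o t) k != 0.
      by rewrite /= fmorph_eq0 /t; case: (k == j); rewrite ?pnatr_eq0 ?oner_eq0.
    have /E : pos t by move=> k; rewrite /t; case: (k == j); rewrite ?ltr0n ?ltr01.
    rewrite !mE // (bigD1 j) //= [RHS](bigD1 j) //= big1 ?mulr1; last first.
      by move=> k /negbTE kj; rewrite /= /t kj rmorph1 exp1rz.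
    rewrite big1 ?mulr1; last by move=> k /negbTE kj; rewrite /= /t kj rmorph1 exp1rz.
    rewrite /= /t eqxx -!fmorphXz => /fmorph_inj; apply: ieexprIz; first by rewrite ltr0n.
    by rewrite pnatr_eq1.
  by rewrite !mE //; apply: eq_bigr => j _; rewrite ex.
Qed.

Lemma zmonomial_delta (L : fieldType) n (x : 'I_n -> L) l :
  zmonomial (row l 1%:M) x = x l.
Proof.
rewrite /zmonomial (bigD1 l) //= !mxE eqxx expr1z big1 ?mulr1 // => j /negbTE jl.
by rewrite !mxE eq_sym jl expr0z.
Qed.

Lemma zmonomial_comp (L : fieldType) n (U V : 'M[int]_n) (x : 'I_n -> L) l :
  U *m V = 1%:M -> (forall j, x j != 0) ->
  zmonomial (row l U) (fun j => zmonomial (row j V) x) = x l.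
Proof.
move=> UV x0; rewrite -[RHS]zmonomial_delta -UV row_mul zmonomial_mulmx //.
Qed.

Lemma adj_dconj (L : fieldType) n (P : 'M[L]_n) (x : 'I_n -> L) : P \in unitmx ->
  (forall j, x j != 0) -> \det (dconj P (\row_j x j)) = 1 ->
  \adj (dconj P (\row_j x j)) = dconj P (\row_j (x j)^-1).
Proof.
move=> uP x0 d1; have x0' j : (\row_j x j) 0 j != 0 by rewrite mxE.
have ug := dconj_unit uP x0'; have := dconjV uP x0'.
rewrite {1}/invmx ug d1 invr1 scale1r => ->.
by congr (dconj P _); apply/rowP => j; rewrite !mxE.
Qed.

(** As [U] is unimodular, the monomials with exponents the rows of [U] are new coordinates on the
    diagonal torus. Setting the first [r] of them to 1 leaves a power of the multiplicative group
    with [n - r] factors; the last hypothesis places it in the special linear group. *)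
Lemma lattice_torus (K C : fieldType) (f : {rmorphism K -> C}) n
    (B : 'M[K]_n) (U : 'M[int]_n) (r : nat) :
  B \in unitmx -> U \in unitmx ->
  (forall x : 'I_n -> C, (forall j, x j != 0) ->
    (forall l : 'I_n, (l < r)%N -> zmonomial (row l U) x = 1) -> \prod_j x j = 1) ->
  exists T : set (mxpolynomial n K),
    [/\ (forall g : 'M[C]_n, zeros f T g <-> exists x : 'I_n -> C,
          [/\ forall j, x j != 0, forall l : 'I_n, (l < r)%N -> zmonomial (row l U) x = 1 &
          g = dconj (map_mx f B) (\row_j x j)]),
        mxgroup (zeros f T), (forall g, zeros f T g -> \det g = 1) &
        exists (d : nat) (phi : 'I_n -> 'I_n -> mpoly.mpoly (d + d) K)
               (psi : 'I_d -> mxpolynomial n K),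
        let mor t := \matrix_(a, b) peval f (laurent_pt t) (phi a b) in
        [/\ (forall t, (forall i, t i != 0) -> zeros f T (mor t)),
            (forall t u, (forall i, t i != 0) -> (forall i, u i != 0) ->
               mor (fun i => t i * u i) = mor t *m mor u),
            (forall s i, zeros f T s -> mxeval f (psi i) s != 0),
            (forall s, zeros f T s -> mor (fun i => mxeval f (psi i) s) = s) &
            (forall t i, (forall i, t i != 0) -> mxeval f (psi i) (mor t) = t i)]].
Proof.
move=> uB uU hdet.
pose fB := map_mx f B; have ufB : fB \in unitmx by rewrite map_unitmx.
pose V := invmx U.
have UV : U *m V = 1%:M by rewrite mulmxV.
have VU : V *m U = 1%:M by rewrite mulVmx.
pose cj (L : fieldType) (i : {rmorphism K -> L}) (g : 'M[L]_n) :=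
  map_mx i B *m g *m map_mx i (invmx B).
have cj_poly a b : polymap (fun (L : fieldType) (A : 'M[L]_n) k => mxvec A 0 k)
    (fun L i A => cj L i A a b).
  by apply: polymap_conj => c e; exact: polymap_entry.
have adj_poly a b : polymap (fun (L : fieldType) (A : 'M[L]_n) k => mxvec A 0 k)
    (fun L i A => cj L i (\adj A) a b).
  by apply: polymap_conj => c e; apply: polymap_adj => ? ?; exact: polymap_entry.
(* Negative powers of the eigenvalues are read off the adjugate, which is the inverse on matrices of
   determinant 1, so the monomial conditions are polynomial equations. *)
pose zm (L : fieldType) (i : {rmorphism K -> L}) (A : 'M[L]_n) (l : 'I_n) :=
  \prod_j zpow (cj L i A j j) (cj L i (\adj A) j j) (U l j).
have zm_poly l : polymap (fun (L : fieldType) (A : 'M[L]_n) k => mxvec A 0 k)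
    (fun L i A => zm L i A l).
  apply: polymap_prod => j; rewrite /zpow; case: (U l j) => k; exact: polymapX.
have /choice[pE hpE] (ab : 'I_n * 'I_n) := cj_poly ab.1 ab.2.
have /choice[pZ hpZ] := zm_poly.
have [pD hpD] : polymap (fun (L : fieldType) (A : 'M[L]_n) k => mxvec A 0 k)
    (fun (L : fieldType) (i : {rmorphism K -> L}) A => \det A - 1).
  apply: polymapD; last by apply: polymapN; apply: polymap1.
  by apply: polymap_det => a b; apply: polymap_entry.
have /choice[pZ1 hpZ1] (l : 'I_n) : polymap (fun (L : fieldType) (A : 'M[L]_n) k => mxvec A 0 k)
    (fun L i A => zm L i A l - 1).
  by apply: polymapD; [exact: zm_poly | apply: polymapN; apply: polymap1].
pose T : set (mxpolynomial n K) := [set p | (exists2 ab : 'I_n * 'I_n, ab.1 != ab.2 & p = pE ab)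
  \/ p = pD \/ (exists2 l : 'I_n, (l < r)%N & p = pZ1 l)].
pose good (x : 'I_n -> C) := (forall j, x j != 0) /\
  forall l : 'I_n, (l < r)%N -> zmonomial (row l U) x = 1.
have cj_dconj (x : 'rV_n) : cj _ f (dconj fB x) = diag_mx x.
  by rewrite /cj map_invmx; apply/(dconjP _ _ ufB).
have det_dconj (x : 'I_n -> C) : \det (dconj fB (\row_j x j)) = \prod_j x j.
  rewrite !det_mulmx det_inv det_diag mulrAC mulVr ?mul1r -?unitmxE //.
  by apply: eq_bigr => j _; rewrite mxE.
have zmE x l : good x -> zm _ f (dconj fB (\row_j x j)) l = zmonomial (row l U) x.
  move=> [x0 hx]; have d1 : \det (dconj fB (\row_j x j)) = 1 by rewrite det_dconj; apply: hdet.
  have adjE := adj_dconj ufB x0 d1.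
  apply: eq_bigr => j _; rewrite adjE !cj_dconj !mxE eqxx !mulr1n zpowE //.
  by rewrite mulfV.
have TE g : zeros f T g <-> exists2 x, good x & g = dconj fB (\row_j x j).
  split=> [Tg|[x gx ->] p].
    have [x gE] : exists x, g = dconj fB (\row_j x j).
      exists (fun j => cj _ f g j j).
      apply/(dconjP _ _ ufB); rewrite -map_invmx -/(cj _ f g); apply/matrixP => a b.
      have [<-|ab] := eqVneq a b; first by rewrite [RHS]mxE eqxx mulr1n [RHS]mxE.
      rewrite [RHS]mxE (negbTE ab) mulr0n -(hpE (a, b) _ f).
      by apply: Tg; left; exists (a, b).
    have d1 : \det g = 1.
      by apply/eqP; rewrite -subr_eq0 -(hpD _ f); apply/eqP; apply: Tg; right; left.
    have x0 j : x j != 0.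
      have : \prod_j x j != 0 by rewrite -det_dconj -gE d1 oner_neq0.
      by move=> /prodf_neq0; apply.
    exists x => //; split=> // l lr.
    have adjE : \adj g = dconj fB (\row_j (x j)^-1).
      by rewrite gE; apply: adj_dconj => //; rewrite -gE.
    have : zm _ f g l = 1.
      apply/eqP; rewrite -subr_eq0 -(hpZ1 l _ f); apply/eqP; apply: Tg; right; right.
      by exists l.
    move=> <-; apply: eq_bigr => j _; rewrite adjE gE !cj_dconj !mxE eqxx !mulr1n zpowE //.
    by rewrite mulfV.
  move=> [[[a b] /= /negbTE ab ->]|[->|[l lr ->]]].
  - by rewrite -[LHS]/(peval f _ _) hpE cj_dconj !mxE ab.
  - by rewrite -[LHS]/(peval f _ _) hpD det_dconj hdet ?subrr //; case: gx.
  - by rewrite -[LHS]/(peval f _ _) hpZ1 zmE // gx.2 // subrr.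
have good1 : good (fun=> 1).
  split=> [j|l _]; first exact: oner_neq0.
  by rewrite /zmonomial big1 // => j _; rewrite exp1rz.
have goodM x y : good x -> good y -> good (fun j => x j * y j).
  move=> [x0 hx] [y0 hy]; split=> [j|l lr]; first by rewrite mulf_neq0.
  by rewrite zmonomialM // hx // hy // mulr1.
have goodV x : good x -> good (fun j => (x j)^-1).
  move=> [x0 hx]; split=> [j|l lr]; first by rewrite invr_eq0.
  have x0' j : (x j)^-1 != 0 by rewrite invr_eq0.
  have : zmonomial (row l U) (fun j => x j * (x j)^-1) = 1.
    by rewrite -[RHS](good1.2 l lr); congr zmonomial; apply/funext => j; rewrite mulfV.
  by rewrite zmonomialM // hx // mul1r.
exists T; split.
- move=> g; rewrite TE; split=> [[x [x0 hx] ->]|[x [x0 hx ->]]]; first by exists x.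
  by exists x.
- split.
  - apply/TE; exists (fun=> 1) => //; rewrite -(dconj1 ufB); congr dconj.
    by apply/rowP => j; rewrite !mxE.
  - move=> g h /TE[x gx ->] /TE[y gy ->]; apply/TE; exists (fun j => x j * y j).
      exact: goodM.
    by rewrite dconjM //; congr dconj; apply/rowP => j; rewrite !mxE.
  - move=> g /TE[x gx ->]; have x0 j : (\row_j x j) 0 j != 0 by rewrite mxE gx.1.
    split; first exact: dconj_unit.
    apply/TE; exists (fun j => (x j)^-1); first exact: goodV.
    by rewrite dconjV //; congr dconj; apply/rowP => j; rewrite !mxE.
- by move=> g /TE[x gx ->]; rewrite det_dconj; case: gx; apply: hdet.
pose d := (n - r)%N.
pose io (l : 'I_n) : option 'I_d := insub (l - r)%N.
(* The parameters fill the last coordinates and the first [r] are set to 1; the inverse exponent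
   matrix [V] then returns to eigenvalues. *)
pose ext (L : fieldType) (t : 'I_d -> L) (l : 'I_n) : L :=
  if (l < r)%N then 1 else oapp t 1 (io l).
have sh_lt (k : 'I_d) : (r + k < n)%N by rewrite -ltn_subRL.
pose sh (k : 'I_d) : 'I_n := Ordinal (sh_lt k).
have ext_sh (L : fieldType) (t : 'I_d -> L) k : ext L t (sh k) = t k.
  by rewrite /ext /io ltnNge leq_addr /= addKn valK.
have ext_neq0 (L : fieldType) (t : 'I_d -> L) : (forall k, t k != 0) -> forall l, ext L t l != 0.
  by move=> t0 l; rewrite /ext; case: ifP => // _; case: (io l) => [k|] /=; rewrite ?oner_neq0.
have extE (L : fieldType) (h : 'I_n -> L) : (forall l : 'I_n, (l < r)%N -> h l = 1) ->
    ext L (fun k => h (sh k)) = h.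
  move=> h1; apply/funext => l; rewrite /ext; case: ltnP => lr; first by rewrite h1.
  have ld : (l - r < d)%N by rewrite ltn_sub2r // (leq_ltn_trans lr).
  by rewrite /io (insubT (fun k => (k < d)%N) ld) /=; congr h; apply: val_inj; rewrite /= subnKC.
pose xs (L : fieldType) (t : 'I_d -> L) (j : 'I_n) := zmonomial (row j V) (ext L t).
have lp_l (L : fieldType) (t : 'I_d -> L) k : laurent_pt t (lshift d k) = t k.
  by rewrite /laurent_pt (unsplitK (inl k)).
have lp_r (L : fieldType) (t : 'I_d -> L) k : laurent_pt t (rshift d k) = (t k)^-1.
  by rewrite /laurent_pt (unsplitK (inr k)).
have ext_poly l : polymap (@laurent_pt d) (fun L (i : {rmorphism K -> L}) t => ext L t l).
  rewrite /ext; case: (l < r)%N; first exact: polymap1.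
  case: (io l) => [k|] /=; last exact: polymap1.
  by apply: eq_polymap (polymap_var K (@laurent_pt d) (lshift d k)) => L i t; rewrite lp_l.
have ext_polyV l : polymap (@laurent_pt d) (fun L (i : {rmorphism K -> L}) t => (ext L t l)^-1).
  rewrite /ext; case: (l < r)%N; first by apply: eq_polymap (polymap1 _ _) => L i t; rewrite invr1.
  case: (io l) => [k|] /=; last by apply: eq_polymap (polymap1 _ _) => L i t; rewrite invr1.
  by apply: eq_polymap (polymap_var K (@laurent_pt d) (rshift d k)) => L i t; rewrite lp_r.
have xs_poly j : polymap (@laurent_pt d) (fun L (i : {rmorphism K -> L}) t => xs L t j).
  apply: (@eq_polymap _ _ _ (@laurent_pt d) (fun L i t => \prod_l ext L t l ^ V j l)).
    by move=> L i t; apply: eq_bigr => l _; rewrite mxE.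
  apply: polymap_prod => l; case: (V j l) => k; first exact: polymapX.
  by apply: eq_polymap (polymapX k.+1 (ext_polyV l)) => L i t; rewrite exprVn.
have /choice[ph hph] (ab : 'I_n * 'I_n) : polymap (@laurent_pt d) (fun L (i : {rmorphism K ->
  L}) t =>
    (map_mx i (invmx B) *m diag_mx (\row_j xs L t j) *m map_mx i B) ab.1 ab.2).
  apply: polymap_conj => a b; have [<-|/negbTE ab'] := eqVneq a b.
    by apply: eq_polymap (xs_poly a) => L i t; rewrite !mxE eqxx mulr1n.
  by apply: eq_polymap (polymap_cst _ (0 : K)) => L i t; rewrite !mxE ab' mulr0n rmorph0.
exists d, (fun a b => ph (a, b)), (fun k => pZ (sh k)) => mor.
have morE t : mor t = dconj fB (\row_j xs _ t j).
  by apply/matrixP => a b; rewrite mxE hph /= map_invmx.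
have good_xs t : (forall k, t k != 0) -> good (xs C t).
  move=> t0; have e0 := ext_neq0 _ t t0.
  split=> [j|l lr]; first exact: zmonomial_neq0.
  by rewrite /xs (zmonomial_comp _ UV) // /ext lr.
have psiE g k : mxeval f (pZ (sh k)) g = zm _ f g (sh k) by rewrite -hpZ.
split.
- by move=> t t0; rewrite morE; apply/TE; exists (xs _ t) => //; apply: good_xs.
- move=> t u t0 u0; rewrite !morE dconjM //; congr dconj; apply/rowP => j; rewrite !mxE.
  have e0 := ext_neq0 _ t t0; have e0' := ext_neq0 _ u u0.
  rewrite /xs -zmonomialM //; congr zmonomial; apply/funext => l; rewrite /ext.
  by case: ifP => _; rewrite ?mulr1 //; case: (io l) => [k|] /=; rewrite ?mulr1.
- move=> g k /TE[x gx ->]; rewrite psiE zmE //; apply: zmonomial_neq0; exact: gx.1.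
- move=> g /TE[x gx ->]; rewrite morE; congr dconj; apply/rowP => j; rewrite !mxE /xs.
  under [X in ext _ X]eq_fun do rewrite psiE zmE //.
  rewrite (extE _ (fun l => zmonomial (row l U) x)); last exact: gx.2.
  by rewrite (zmonomial_comp _ VU) //; exact: gx.1.
- move=> t k t0; rewrite psiE morE zmE; last exact: good_xs.
  by rewrite /xs (zmonomial_comp _ UV) ?ext_sh //; apply: ext_neq0.
Qed.

Lemma torus_of_lattice (K : rcfType) n (B : 'M[K]_n) (U : 'M[int]_n) (r : nat) :
  B \in unitmx -> U \in unitmx ->
  (forall x : 'I_n -> K[i], (forall j, x j != 0) ->
    (forall l : 'I_n, (l < r)%N -> zmonomial (row l U) x = 1) -> \prod_j x j = 1) ->
  exists T : set (mxpolynomial n K), split_torus T /\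
    forall g : 'M[K[i]]_n, geom T g <-> exists x : 'I_n -> K[i],
      [/\ forall j, x j != 0, forall l : 'I_n, (l < r)%N -> zmonomial (row l U) x = 1 &
          g = dconj (map_mx (real_complex K) B) (\row_j x j)].
Proof.
move=> uB uU hdet.
have [T [TE Tg Td [d [phi [psi h]]]]] := @lattice_torus K K[i] (real_complex K) n B U r uB uU hdet.
by exists T; split=> //; split=> //; exists d, phi, psi.
Qed.

Lemma map_dconj (L L' : fieldType) (f : {rmorphism L -> L'}) n (B : 'M[L]_n) (x : 'I_n -> L) :
  map_mx f (dconj B (\row_j x j)) = dconj (map_mx f B) (\row_j f (x j)).
Proof.
rewrite /dconj !map_mxM map_invmx map_diag_mx; congr (_ *m diag_mx _ *m _).
by apply/rowP => j; rewrite !mxE.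
Qed.

(** * Absorption of commuting positive elements *)

Section MaximalTorus.
Variables (n d : nat) (K : rcfType) (G S : set (mxpolynomial n K)).
Variables (phi : 'I_n -> 'I_n -> mpoly.mpoly (d + d) K) (psi : 'I_d -> mxpolynomial n K).
Hypothesis hG : alg_subgroup_SL G.
Hypothesis hmax : maximal_split_torus G S.
Hypothesis hSsym : forall s, geom S s -> s = s^T.
Hypothesis hT : split_by S phi psi.

Let hS : alg_subgroup_SL S. Proof. by case: hmax => -[]. Qed.

Let v (M : Type) : void -> M. Proof. by case. Qed.

Lemma zeros_torus_sym (L : rcfType) (i : {rmorphism K -> L}) s : zeros i S s -> s^T = s.
Proof.
move: s; pose D (L : rcfType) (i : {rmorphism K -> L}) (x : void -> L) :=
  forall s : 'M[L]_n, zeros i S s -> s^T = s.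
have hD : definable D.
  apply: definable_forall_mx; apply: definable_imply.
    by apply: definable_zeros; apply: polymx_var.
  by apply: definable_mxeq; [apply: polymx_tr; apply: polymx_var | exact: polymx_var].
apply: (definable_sentence hD idfun i (v _) (v _)).1 => s /geom_real/hSsym.
by rewrite map_trmx => /map_mx_inj.
Qed.

Lemma zeros_torus_comm (L : rcfType) (i : {rmorphism K -> L}) s s' :
  zeros i S s -> zeros i S s' -> s *m s' = s' *m s.
Proof.
move=> Ss Ss'; rewrite -(zeros_torus_sym (zerosM hS Ss Ss')) trmx_mul.
by rewrite !(@zeros_torus_sym _ i).
Qed.

Lemma torus_sub_group (L : rcfType) (i : {rmorphism K -> L}) s : zeros i S s -> zeros i G s.
Proof.
move: s; pose D (L : rcfType) (i : {rmorphism K -> L}) (x : void -> L) :=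
  forall s : 'M[L]_n, zeros i S s -> zeros i G s.
have hD : definable D.
  apply: definable_forall_mx; apply: definable_imply;
  by apply: definable_zeros; apply: polymx_var.
apply: (definable_sentence hD idfun i (v _) (v _)).1 => s /geom_real Ss.
by apply/geom_real; case: hmax => _ + _; apply.
Qed.

Lemma pos_torM (L : rcfType) (i : {rmorphism K -> L}) s s' :
  pos_tor S psi i s -> pos_tor S psi i s' -> pos_tor S psi i (s *m s').
Proof.
move=> [Ss ps] [Ss' ps']; split=> [|j]; first exact: zerosM.
by rewrite (psiM hT) // mulr_gt0.
Qed.

Lemma pos_tor1 (L : rcfType) (i : {rmorphism K -> L}) : pos_tor S psi i 1%:M.
Proof. by split=> [|j]; [exact: zeros1 | rewrite (psi1 hS hT)]. Qed.

Lemma pos_torV (L : rcfType) (i : {rmorphism K -> L}) s :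
  pos_tor S psi i s -> pos_tor S psi i (invmx s).
Proof.
move=> [Ss ps]; have SV := zerosV hS Ss; split=> // j.
have := psiM hT j Ss SV; rewrite mulmxV ?(zeros_unitmx hS Ss) // (psi1 hS hT) => /esym E.
have : 0 < mxeval i (psi j) s * mxeval i (psi j) (invmx s) by rewrite E ltr01.
by rewrite pmulr_rgt0.
Qed.

(** The condition on [y] says that it respects all coincidences of monomials on [Gam]. By
    independence of characters every polynomial equation that holds on [Gam] then holds at [y]. *)
Lemma dconj_dense_group (B : 'M[K]_n) (Gam : set ('I_n -> K)) (y : 'I_n -> K[i]) :
  Gam (fun=> 1) -> (forall x x', Gam x -> Gam x' -> Gam (fun j => x j * x' j)) ->
  (forall x, Gam x -> zeros idfun G (dconj B (\row_j x j))) ->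
  (forall m m' : 'I_n -> nat, (forall x, Gam x -> monomial m x = monomial m' x) ->
    monomial m y = monomial m' y) ->
  geom G (dconj (map_mx (real_complex K) B) (\row_j y j)).
Proof.
move=> G1 GM GG hy p Gp; pose f : {rmorphism K -> K[i]} := real_complex K.
have [l hl] := monomial_sum_dconj f p (map_mx f B).
rewrite [LHS]hl; have fm m (x : 'I_n -> K) : monomial m (f \o x) = f (monomial m x).
  by rewrite /monomial rmorph_prod; apply: eq_bigr => j _; rewrite rmorphXn.
apply: (@dedekind_independence K[i] _ ('I_n -> nat) Gam
  (fun x x' => (fun j => x j * x' j)) (fun=> 1)
  (fun m x => monomial m (f \o x)) G1 GM _ _ l (fun m => monomial m y)).
- by move=> m; rewrite fm monomial1 rmorph1.
- by move=> m x x' _ _; rewrite !fm monomialM rmorphM.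
- move=> x Gx; rewrite -[LHS](hl (f \o x)).
  rewrite -(map_dconj f).
  by rewrite (@mxeval_map _ _ _ _ idfun f f) // (GG x Gx p Gp) rmorph0.
- by move=> m m' E; apply: hy => x Gx; apply: (fmorph_inj f); rewrite -!fm E.
Qed.

(* Otherwise the Zariski closure of the group generated by [S] and the element would be
   a larger split torus. *)
Lemma maximal_torus_absorbs (Q : 'M[K]_n) (e : 'rV[K]_n) : Q \in unitmx ->
  (forall j, 0 < e 0 j) -> zeros idfun G (dconj Q e) ->
  (forall s, pos_tor S psi idfun s -> s *m dconj Q e = dconj Q e *m s) ->
  zeros idfun S (dconj Q e).
Proof.
move=> uQ e0 Gp pcomm; set p := dconj Q e.
(* The square root is diagonalized together with the torus, so that in the common basis [B] the
   eigenvalues [pe] of [p] appear as squares, hence positive. *)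
pose q := dconj Q (map_mx Num.sqrt e).
have qq : q *m q = p.
  rewrite /q dconjM //; congr dconj; apply/rowP => j; rewrite !mxE.
  by rewrite -expr2 sqr_sqrtr // ltW.
have qcomm s : pos_tor S psi idfun s -> s *m q = q *m s.
  by move=> As; apply: dconj_commute => //; apply: pcomm.
have uq : q \in unitmx.
  by apply: dconj_unit => // j; rewrite mxE gt_eqF // sqrtr_gt0.
have [B uB diagB] : exists2 B, B \in unitmx & forall A,
    pos_tor S psi idfun A \/ A = q -> exists dd, A = dconj B dd.
  apply: codiagonalizable_set => [A A' [hA|->] [hA'|->]|A [hA|->]] //.
  - by case: hA hA' => hA _ [hA' _]; exact: (zeros_torus_comm (i := idfun)).
  - exact: qcomm.
  - by rewrite qcomm.
  - by apply: symmetric_diagonalizable; apply: (@zeros_torus_sym _ idfun); case: hA.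
  - by exists Q, (map_mx Num.sqrt e).
have diag_unit A (x : 'rV_n) : A \in unitmx -> A = dconj B x -> forall j, x 0 j != 0.
  move=> uA E; move: uA; rewrite E unitmxE !det_mulmx det_inv det_diag mulrAC mulVr -?unitmxE //.
  by rewrite mul1r unitfE => /prodf_neq0 h j; apply: h.
have [qd Eq] := diagB q (or_intror erefl).
pose pe j := qd 0 j ^+ 2.
have pe0 j : 0 < pe j by rewrite /pe exprn_even_gt0 //=; apply: (diag_unit q).
have Ep : p = dconj B (\row_j pe j).
  by rewrite -qq Eq dconjM //; congr dconj; apply/rowP => j; rewrite !mxE -expr2.
pose dg (s : 'M[K]_n) (x : 'I_n -> K) := s = dconj B (\row_j x j).
have dg_ex s : pos_tor S psi idfun s -> exists2 x, dg s x & forall j, 0 < x j.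
  move=> As; have [r Ar Es] := pos_tor_sqrt hT As.
  have [x Ex] := diagB r (or_introl Ar).
  exists (fun j => x 0 j ^+ 2); last first.
    by move=> j; rewrite exprn_even_gt0 //=; apply: (diag_unit r) => //; case: Ar =>
      /(zeros_unitmx hS).
  by rewrite /dg Es Ex dconjM //; congr dconj; apply/rowP => j; rewrite !mxE -expr2.
(* The lattice of integer monomials that equal 1 both on the positive part of the torus and at [p];
   the larger torus [T] is the one it cuts out. *)
pose triv (m : 'rV[int]_n) := (forall s x, pos_tor S psi idfun s -> dg s x ->
  zmonomial m x = 1) /\ zmonomial m pe = 1.
have pe0' j : pe j != 0 by rewrite gt_eqF.
have dg_pos s x : pos_tor S psi idfun s -> dg s x -> forall j, 0 < x j.
  move=> As sx; have [y sy y0] := dg_ex s As; move=> j.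
  have : \row_j x j = \row_j y j by apply: (dconj_inj uB); rewrite -sx -sy.
  by move=> /rowP/(_ j); rewrite !mxE => ->.
have dg_neq0 s x : pos_tor S psi idfun s -> dg s x -> forall j, x j != 0.
  by move=> As sx j; rewrite gt_eqF // (dg_pos s x).
have zm_pos m x : (forall j, 0 < x j) -> 0 < zmonomial m x :> K.
  by move=> x0; apply: prodr_gt0 => j _; rewrite exprz_gt0.
have [U [r [uU Ur Ur']]] : exists (U : 'M[int]_n) (r : nat), [/\ U \in unitmx,
    forall l : 'I_n, (l < r)%N -> triv (row l U) &
    forall c : 'rV[int]_n, triv (c *m U) -> forall l : 'I_n, (r <= l)%N -> c 0 l = 0].
  apply: adapted_basis.
  - by split=> [s x _ _|]; rewrite zmonomial0.
  - move=> m m' [h1 h2] [h1' h2']; split=> [s x As sx|].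
      by rewrite zmonomialD ?(h1 s) ?(h1' s) ?mulr1 //; apply: dg_neq0 sx.
    by rewrite zmonomialD // h2 h2' mulr1.
  - move=> m [h1 h2]; rewrite -scaleN1r.
    by split=> [s x As sx|]; rewrite zmonomialZ ?(h1 s) ?h2 ?exp1rz.
  - move=> k m k0 [h1 h2].
    (* Positivity enters here: a positive element with a nonzero power equal to 1 is 1. The lattice
       is therefore saturated and cuts out a torus, with no finite factor. *)
    have root1 (z : K) : 0 < z -> z ^ k = 1 -> z = 1.
      move=> z0 zk; apply: (@pexpIrz K k k0 z 1); last by rewrite /= zk exp1rz.
        exact: ltW z0.
      exact: ler01.
    split=> [s x As sx|]; apply: root1; rewrite -?zmonomialZ ?(h1 s) //; apply: zm_pos => //.
    exact: dg_pos sx.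
have trivE (V : fieldType) (m : 'rV[int]_n) (y : 'I_n -> V) : (forall j, y j != 0) ->
    (forall l : 'I_n, (l < r)%N -> zmonomial (row l U) y = 1) -> triv m -> zmonomial m y = 1.
  move=> y0 hy tm; rewrite -(mulmxKV uU m) zmonomial_mulmx // big1 // => l _.
  have [lr|rl] := ltnP l r; first by rewrite hy // exp1rz.
  by rewrite (Ur' (m *m invmx U)) ?expr0z // mulmxKV.
have det_dconj (x : 'I_n -> K) : \det (dconj B (\row_j x j)) = \prod_j x j.
  rewrite !det_mulmx det_inv det_diag mulrAC mulVr ?mul1r -?unitmxE //.
  by apply: eq_bigr => j _; rewrite mxE.
have ones (V : fieldType) (x : 'I_n -> V) : zmonomial (const_mx 1) x = \prod_j x j.
  by apply: eq_bigr => j _; rewrite mxE expr1z.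
have [|T [sT TE]] := @torus_of_lattice K n B U r uB uU.
  move=> x x0 hx; rewrite -ones; apply: trivE => //; split=> [s x' As sx'|].
    by rewrite ones -det_dconj -sx'; apply: (det_zeros hS (i := idfun)); case: As.
  by rewrite ones -det_dconj -Ep; exact: (det_zeros hG (i := idfun)).
have Tp : geom T (map_mx (real_complex K) p).
  apply/TE; exists (real_complex K \o pe); split.
  - by move=> j; rewrite /= fmorph_eq0.
  - move=> l lr; have [_ h2] := Ur l lr.
    transitivity (real_complex K (zmonomial (row l U) pe)); last by rewrite h2 rmorph1.
    by rewrite /zmonomial rmorph_prod; apply: eq_bigr => j _; rewrite fmorphXz.
  - by rewrite Ep map_dconj.
have ST : geom S `<=` geom T.
  move=> s Ss t Tt; apply: (zeros_dense_torus hT) Ss => s' As'.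
  have [x sx x0] := dg_ex s' As'.
  suff /(_ _ Tt) : geom T (map_mx (real_complex K) s').
    rewrite -[mxeval _ _ _]/(mxeval (real_complex K) t (map_mx (real_complex K) s')).
    rewrite (@mxeval_map _ _ _ _ idfun (real_complex K) (real_complex K)) // => /eqP.
    by rewrite fmorph_eq0 => /eqP.
  apply/TE; exists (real_complex K \o x); split.
  - by move=> j; rewrite /= fmorph_eq0 gt_eqF.
  - move=> l lr; have [h1 _] := Ur l lr.
    transitivity (real_complex K (zmonomial (row l U) x)); last by rewrite (h1 s') ?rmorph1.
    by rewrite /zmonomial rmorph_prod; apply: eq_bigr => j _; rewrite fmorphXz.
  - by rewrite sx map_dconj.
have TG : geom T `<=` geom G.
  move=> g /TE[y [y0 hy ->]].
  (* The diagonal coordinates of the monoid generated by the positive torus and [p], which lies in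
     [G]. A monomial identity on [Gam] is an element of [triv], so every point of [T] satisfies
     it. *)
  pose Gam : set ('I_n -> K) := [set z | exists s x k, [/\ pos_tor S psi idfun s, dg s x &
    z = (fun j => x j * pe j ^+ k)]].
  apply: (@dconj_dense_group B Gam).
  - exists 1%:M, (fun=> 1), 0%N; split; first exact: pos_tor1.
      by rewrite /dg -(dconj1 uB); congr dconj; apply/rowP => j; rewrite !mxE.
    by apply/funext => j; rewrite expr0 mulr1.
  - move=> _ _ [s [x [k [As sx ->]]]] [s' [x' [k' [As' sx' ->]]]].
    exists (s *m s'), (fun j => x j * x' j), (k + k')%N; split.
    + exact: pos_torM.
    + by rewrite /dg sx sx' dconjM //; congr dconj; apply/rowP => j; rewrite !mxE.
    + by apply/funext => j; rewrite exprD mulrACA.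
  - move=> _ [s [x [k [As sx ->]]]].
    have -> : dconj B (\row_j (x j * pe j ^+ k)) = s *m iter k (mulmx p) 1%:M.
      rewrite Ep dconj_exp // sx dconjM //; congr dconj.
      by apply/rowP => j; rewrite !mxE.
    apply: (zerosM hG (i := idfun)); first by apply: (torus_sub_group (i := idfun)); case: As.
    elim: k {x sx} => [|k IH]; first exact: (zeros1 hG idfun).
    exact: (zerosM hG (i := idfun)).
  - move=> m m' E; pose u : 'rV[int]_n := \row_j ((m j)%:Z - (m' j)%:Z).
    have uE (V : fieldType) (x : 'I_n -> V) : (forall j, x j != 0) ->
        monomial m x = zmonomial u x * monomial m' x.
      move=> x0; rewrite /monomial /zmonomial -big_split; apply: eq_bigr => j _.
      by rewrite mxE expfzDr // -exprnN /= mulfVK // expf_neq0.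
    have mon0 (x : 'I_n -> K) : (forall j, x j != 0) -> monomial m' x != 0.
      by move=> x0; apply/prodf_neq0 => j _; rewrite expf_neq0.
    rewrite uE // (trivE _ u y) ?mul1r //; split=> [s x As sx|].
      have x0 := dg_neq0 s x As sx; have /E : Gam x.
        by exists s, x, 0%N; split=> //; apply/funext => j; rewrite expr0 mulr1.
      by rewrite uE // -[RHS]mul1r => /(mulIf (mon0 _ x0)).
    have /E : Gam pe.
      exists 1%:M, (fun=> 1), 1%N; split; first exact: pos_tor1.
        by rewrite /dg -(dconj1 uB); congr dconj; apply/rowP => j; rewrite !mxE.
      by apply/funext => j; rewrite expr1 mul1r.
    by rewrite uE // -[RHS]mul1r => /(mulIf (mon0 _ pe0')).
have [_ _ maxS] := hmax; have ETS := maxS T sT TG ST.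
by apply/geom_real; rewrite -ETS.
Qed.

(** Maximality speaks of tori over [K], so it is applied to elements over [K]; the resulting
    statement is first-order and reaches [L] by transfer. *)
Lemma pos_tor_absorbs (L : rcfType) (i : {rmorphism K -> L}) (Q : 'M[L]_n) (e : 'rV[L]_n) :
  Q \in unitmx -> (forall j, 0 < e 0 j) -> zeros i G (dconj Q e) ->
  (forall s, pos_tor S psi i s -> s *m dconj Q e = dconj Q e *m s) ->
  pos_tor S psi i (dconj Q e).
Proof.
pose D (L : rcfType) (i : {rmorphism K -> L}) (x : void -> L) :=
  forall (Q Q' : 'M[L]_n) (e : 'rV[L]_n), Q' *m Q = 1%:M -> (forall j, 0 < e 0 j) ->
  zeros i G (Q' *m diag_mx e *m Q) ->
  (forall s, pos_tor S psi i s -> s *m (Q' *m diag_mx e *m Q) = (Q' *m diag_mx e *m Q) *m s) ->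
  pos_tor S psi i (Q' *m diag_mx e *m Q).
suff h : D L i (v _) by move=> uQ e0 Gp cp; apply: h => //; rewrite mulVmx.
have hD : definable D.
  have pm (J : Type) (k k' : 'I_n -> 'I_n -> J) (k'' : 'I_1 -> 'I_n -> J) :
    polymx (fun (L : rcfType) (i : {rmorphism K -> L}) (x : J -> L) =>
    (\matrix_(a, b) x (k a b)) *m diag_mx (\matrix_(a, b) x (k'' a b)) *m (\matrix_(a,
      b) x (k' a b))).
    by apply: polymx_mul; [apply: polymx_mul; [|apply: polymx_diag]|]; apply: polymx_var.
  do 3!apply: definable_forall_mx; apply: definable_imply.
    apply: definable_mxeq; first by apply: polymx_mul; apply: polymx_var.
    by apply: polymx_scalar; apply: polyfam1.
  apply: definable_imply.
    apply: definable_forall_fin => j; apply: definable_lt; first exact: polyfam0.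
    exact: polymx_var.
  apply: definable_imply; first by apply: definable_zeros; apply: pm.
  apply: definable_imply; last by apply: definable_pos_tor; apply: pm.
  apply: definable_forall_mx; apply: definable_imply.
    by apply: definable_pos_tor; apply: polymx_var.
  by apply: definable_mxeq; apply: polymx_mul; (apply: pm || apply: polymx_var).
apply: (definable_sentence hD idfun i (v _) (v _)).1 => {}Q Q' {}e QQ e0 Gp cp.
have [_ uQ] := mulmx1_unit QQ.
have Q'E : Q' = invmx Q by rewrite -(mulmxK uQ Q') QQ mul1mx.
(* Absorption only places an element in [S]. Applied to the square root [r], it makes the
   coordinates of [p] squares, hence positive. *)
subst Q'; pose p := dconj Q e; pose r := dconj Q (map_mx Num.sqrt e).
have rr : r *m r = p.
  rewrite /r dconjM //; congr dconj; apply/rowP => j; rewrite !mxE.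
  by rewrite -expr2 sqr_sqrtr // ltW.
have re0 j : 0 < (map_mx Num.sqrt e) 0 j by rewrite mxE sqrtr_gt0.
have Gr : zeros idfun G r.
  apply: zeros_generalized_power => //; last exact: sqrtr1.
    move=> k; rewrite -dconj_exp //; elim: k => [|k IH]; first exact: (zeros1 hG idfun).
    exact: (zerosM hG (i := idfun)).
  by move=> x y x0 y0; rewrite sqrtrM // ltW.
have Sr : zeros idfun S r.
  apply: maximal_torus_absorbs => // s As; apply: dconj_commute => //; exact: cp.
rewrite -[_ *m _ *m _]/p -rr; split=> [|j]; first exact: (zerosM hS (i := idfun)).
by rewrite (psiM hT) // -expr2 exprn_even_gt0 //=; apply: (psi_neq0 hT (i := idfun)).
Qed.

End MaximalTorus.

(** * The matrix exponential and Lie algebras *)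

Section MatrixDerivative.
Variable R : realType.

Definition is_dmx m n (f : R -> 'M[R]_(m, n)) (t : R) (D : 'M[R]_(m, n)) :=
  forall a b, is_derive t 1 (fun s => f s a b) (D a b).

Lemma is_dmx_cst m n (C : 'M[R]_(m, n)) t : is_dmx (fun=> C) t 0.
Proof. by move=> a b; rewrite mxE; exact: is_derive_cst. Qed.

Lemma is_dmxM m n p (f : R -> 'M[R]_(m, n)) (g : R -> 'M[R]_(n, p)) t D E :
  is_dmx f t D -> is_dmx g t E -> is_dmx (fun s => f s *m g s) t (D *m g t + f t *m E).
Proof.
move=> hf hg a b.
rewrite (_ : (fun s => (f s *m g s) a b) = \sum_k (fun s => f s a k * g s k b)); last first.
  by apply/funext => s; rewrite mxE fct_sumE.
rewrite !mxE -big_split /=; apply: is_derive_sum => k.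
have := is_deriveM (hf a k) (hg k b).
by rewrite addrC /GRing.scale /= [_ * D a k]mulrC.
Qed.

Lemma is_dmx_mulmxl m n p (C : 'M[R]_(m, n)) (f : R -> 'M[R]_(n, p)) t D :
  is_dmx f t D -> is_dmx (fun s => C *m f s) t (C *m D).
Proof. by move=> hf; have := is_dmxM (is_dmx_cst C t) hf; rewrite mul0mx add0r. Qed.

Lemma is_dmx_mulmxr m n p (C : 'M[R]_(n, p)) (f : R -> 'M[R]_(m, n)) t D :
  is_dmx f t D -> is_dmx (fun s => f s *m C) t (D *m C).
Proof. by move=> hf; have := is_dmxM hf (is_dmx_cst C t); rewrite mulmx0 addr0. Qed.

Lemma is_dmxN m n (f : R -> 'M[R]_(m, n)) t D :
  is_dmx f (- t) D -> is_dmx (fun s => f (- s)) t (- D).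
Proof.
move=> hf a b; rewrite mxE -[- D a b]mulrN1.
have := @is_derive1_comp R (fun s => f s a b) (fun s => - s) t _ _ (hf a b) _.
by apply; have := @is_deriveN R R R (fun s => s) t 1 1 _; apply.
Qed.

Lemma dmx0_cst m n (f : R -> 'M[R]_(m, n)) : (forall t, is_dmx f t 0) ->
  forall t, f t = f 0.
Proof.
move=> hf t; apply/matrixP => a b.
apply: (@is_derive_0_is_cst R (fun s => f s a b)) => s.
by have := hf s a b; rewrite mxE.
Qed.

End MatrixDerivative.

Lemma cvg_fsum (R : realType) T (F : set_system T) (I : finType) (f : I -> T -> R) (l : I -> R) :
  Filter F -> (forall i, f i @ F --> l i) ->
  (fun x => \sum_i f i x) @ F --> \sum_i l i.
Proof.
move=> FF cv.
rewrite (_ : (fun x => _) = \sum_i f i); last by apply/funext => x; rewrite fct_sumE.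
elim/big_rec2: _ => [|i g r _ h]; first exact: cvg_cst.
by apply: cvgD.
Qed.

Section Expmx.
Variables (R : realType) (n : nat).
Implicit Types X : 'M[R]_n.

Lemma expmxS X k : X ^+ k.+1 = X *m X ^+ k.
Proof. exact: exprS. Qed.

Lemma expmxSr X k : X ^+ k.+1 = X ^+ k *m X.
Proof. exact: exprSr. Qed.

Lemma exp_scalemx t X k : (t *: X) ^+ k = t ^+ k *: X ^+ k.
Proof.
elim: k => [|k IH]; first by rewrite !expr0 scale1r.
by rewrite !expmxS IH -scalemxAl -scalemxAr scalerA -exprS.
Qed.

Lemma norm_expmx_coef X a b k :
  `|(X ^+ k) a b| <= (\sum_i \sum_j `|X i j|) ^+ k.
Proof.
set M := \sum_i _; have M0 : 0 <= M by apply: sumr_ge0 => i _; apply: sumr_ge0.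
elim: k a b => [|k IH] a b.
  by rewrite !expr0 mxE; case: (a == b); rewrite ?normr1 ?normr0 ?ler01.
rewrite expmxS mxE exprS; apply: le_trans (ler_norm_sum _ _ _) _.
apply: (@le_trans _ _ (\sum_j `|X a j| * M ^+ k)).
  by apply: ler_sum => j _; rewrite normrM ler_wpM2l.
rewrite -mulr_suml ler_wpM2r ?exprn_ge0 // /M [leRHS](bigD1 a) //= lerDl.
by apply: sumr_ge0 => i _; apply: sumr_ge0.
Qed.

(** Coefficients of the power series in [t] for the entries of [C] times the exponential of
    [t *: X]. The left factor [C] makes the family stable under differentiation, which replaces [C]
    by [C *m X]. *)
Definition expmx_coef m (C : 'M[R]_(m, n)) X a b (k : nat) : R := (C *m X ^+ k) a b / k`!%:R.

Lemma pseries_expmx_coef m (C : 'M[R]_(m, n)) X a b t : pseries (expmx_coef C X a b) t =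
  \sum_l (fun N => C a l * pseries (expmx_coef 1%:M X l b) t N).
Proof.
apply/funext => N; rewrite fct_sumE /pseries /series /=.
under [RHS]eq_bigr do rewrite mulr_sumr.
rewrite exchange_big; apply: eq_bigr => k _; rewrite /expmx_coef mxE !mulr_suml.
by apply: eq_bigr => l _; rewrite mul1mx !mulrA.
Qed.

Lemma cvg_expmx m (C : 'M[R]_(m, n)) X t a b :
  pseries (expmx_coef C X a b) t @ \oo --> (C *m expmx (t *: X)) a b.
Proof.
set M := \sum_i \sum_j `|X i j|.
have cv l : pseries (expmx_coef 1%:M X l b) t @ \oo --> expmx (t *: X) l b.
  have -> : expmx (t *: X) l b = limn (pseries (expmx_coef 1%:M X l b) t).
    rewrite mxE; congr (limn _); apply/funext => N; rewrite /pseries /series /= big_mkord.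
    apply: eq_bigr => k _; rewrite exp_scalemx mxE /expmx_coef mul1mx.
    by rewrite [RHS]mulrC mulrA.
  suff: cvgn (pseries (expmx_coef 1%:M X l b) t) by [].
  apply (@normed_cvg R R (fun k => expmx_coef 1%:M X l b k * t ^+ k)).
  refine (@series_le_cvg R (fun k => `|expmx_coef 1%:M X l b k * t ^+ k|) (exp_coeff (M * `|t|))
    _ _ _ _) => [k|k|k|].
  - exact: normr_ge0.
  - by apply: exp_coeff_ge0; rewrite mulr_ge0 // sumr_ge0 // => i _; apply: sumr_ge0.
  - rewrite /exp_coeff /expmx_coef /= !normrM normfV normrX exprMn mul1mx.
    rewrite [`|k`!%:R|]ger0_norm ?ler0n // mulrAC ler_wpM2r ?invr_ge0 ?ler0n //.
    by rewrite ler_wpM2r ?exprn_ge0 // norm_expmx_coef.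
  - exact: is_cvg_series_exp_coeff.
rewrite pseries_expmx_coef mxE.
rewrite (_ : \sum_l _ = (fun N => \sum_l C a l * pseries (expmx_coef 1%:M X l b) t N)); last first.
  by apply/funext => N; rewrite fct_sumE.
by apply: cvg_fsum => l; apply: cvgMl_tmp; exact: cv.
Qed.

Lemma pseries_diffs_expmx m (C : 'M[R]_(m, n)) X a b :
  pseries_diffs (expmx_coef C X a b) = expmx_coef (C *m X) X a b.
Proof.
apply/funext => k; rewrite /pseries_diffs /expmx_coef factS natrM invfM mulrCA.
by rewrite mulVKf ?pnatr_eq0 // expmxS mulmxA.
Qed.

Lemma is_dmx_expmx m (C : 'M[R]_(m, n)) X t :
  is_dmx (fun s => C *m expmx (s *: X)) t (C *m X *m expmx (t *: X)).
Proof.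
have E D s a b : (D *m expmx (s *: X)) a b = limn (pseries (expmx_coef D X a b) s).
  by apply/esym/cvg_lim => //; exact: cvg_expmx.
have cv D s a b : cvgn (pseries (expmx_coef D X a b) s).
  by apply/cvg_ex; eexists; exact: cvg_expmx.
move=> a b; rewrite E -pseries_diffs_expmx.
rewrite (_ : (fun s => _) = (fun s => limn (pseries (expmx_coef C X a b) s))); last first.
  by apply/funext => s; rewrite E.
apply: (@pseries_snd_diffs _ _ (`|t| + 1)); rewrite ?pseries_diffs_expmx //.
by rewrite [ltRHS]ger0_norm ?addr_ge0 // ltrDl.
Qed.

Lemma expmx_comm X t : X *m expmx (t *: X) = expmx (t *: X) *m X.
Proof.
apply/matrixP => a b.
have h1 := @cvg_expmx _ X X t a b.
have h2 : pseries (expmx_coef X X a b) t @ \oo --> (expmx (t *: X) *m X) a b.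
  rewrite (_ : pseries _ _ = fun N => \sum_l pseries (expmx_coef 1%:M X a l) t N * X l b);
    last first.
    apply/funext => N; rewrite /pseries /series /=.
    under [RHS]eq_bigr do rewrite mulr_suml.
    rewrite exchange_big; apply: eq_bigr => k _.
    rewrite /expmx_coef -expmxS expmxSr mxE !mulr_suml.
    apply: eq_bigr => l _; rewrite mul1mx -!mulrA; congr (_ * _); by rewrite mulrC -mulrA.
  have -> : (expmx (t *: X) *m X) a b = \sum_l expmx (t *: X) a l * X l b by rewrite mxE.
  apply: cvg_fsum => l; apply: cvgMr_tmp.
  by have := @cvg_expmx _ 1%:M X t a l; rewrite mul1mx.
by apply: (cvg_unique _ h1 h2).
Qed.

Lemma expmx0 : expmx (0 : 'M[R]_n) = 1%:M.
Proof.
apply/matrixP => a b; rewrite mxE; apply/cvg_lim => //.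
apply: cvg_near_cst; exists 1%N => // -[|N] //= _.
rewrite big_ord_recl big1 ?addr0 => [|k _]; first by rewrite expr0 divr1.
by rewrite /bump /= expmxS mul0mx mxE mul0r.
Qed.

Lemma is_dmx_expmx1 X t : is_dmx (fun s => expmx (s *: X)) t (X *m expmx (t *: X)).
Proof.
have := @is_dmx_expmx _ 1%:M X t; rewrite mul1mx.
rewrite (_ : (fun s => 1%:M *m _) = (fun s => expmx (s *: X))) //.
by apply/funext => s; rewrite mul1mx.
Qed.

Lemma expmxNr X t : expmx (t *: X) *m expmx (- t *: X) = 1%:M.
Proof.
pose f s := expmx (s *: X) *m expmx (- s *: X).
have hf s : is_dmx f s 0.
  have := is_dmxM (is_dmx_expmx1 X s) (is_dmxN (is_dmx_expmx1 X (- s))).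
  by rewrite mulmxN mulmxA -expmx_comm subrr.
have := dmx0_cst hf t; rewrite /f => ->.
by rewrite oppr0 scale0r expmx0 mulmx1.
Qed.

(** The product of [W t] and the exponential of [- t *: D] has zero derivative. Conjugation,
    transposition and diagonal forms of the exponential all follow from this uniqueness. *)
Lemma expmx_unique (W : R -> 'M[R]_n) D :
  (forall t, is_dmx W t (W t *m D)) -> W 0 = 1%:M -> forall t, W t = expmx (t *: D).
Proof.
move=> hW W0 t.
pose f s := W s *m expmx (- s *: D).
have hf s : is_dmx f s 0.
  have := is_dmxM (hW s) (is_dmxN (is_dmx_expmx1 D (- s))).
  by rewrite mulmxN mulmxA subrr.
have := dmx0_cst hf t; rewrite /f oppr0 scale0r expmx0 mulmx1 W0 => E.
have /mulmx1C := expmxNr D t; move: E; set B := expmx (- t *: D); set C := expmx (t *: D).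
by move=> E1 E2; rewrite -[W t]mulmx1 -E2 mulmxA E1 mul1mx.
Qed.

Lemma expmx_conj X (P : 'M[R]_n) t : P \in unitmx ->
  P *m expmx (t *: X) *m invmx P = expmx (t *: (P *m X *m invmx P)).
Proof.
move=> uP; move: t.
apply: expmx_unique => [t|]; last by rewrite scale0r expmx0 mulmx1 mulmxV.
have := is_dmx_mulmxr (invmx P) (is_dmx_mulmxl P (is_dmx_expmx1 X t)).
by rewrite expmx_comm !mulmxA mulmxKV.
Qed.

Lemma expmx_tr X t : (expmx (t *: X))^T = expmx (t *: X^T).
Proof.
move: t; apply: expmx_unique => [t a b|]; last by rewrite scale0r expmx0 trmx1.
rewrite -trmx_mul mxE (_ : (fun s => _) = (fun s => expmx (s *: X) b a)); first exact:
  is_dmx_expmx1.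
by apply/funext => s; rewrite mxE.
Qed.

End Expmx.

Lemma expmx_dconj (R : realType) n (P : 'M[R]_n) (h : 'rV[R]_n) t : P \in unitmx ->
  expmx (t *: dconj P h) = dconj P (map_mx expR (t *: h)).
Proof.
move=> uP; apply/esym; move: t.
apply: expmx_unique => [t|]; last first.
  by rewrite scale0r -(dconj1 uP); congr dconj; apply/rowP => j; rewrite !mxE expR0.
pose E s : 'M[R]_n := diag_mx (map_mx expR (s *: h)).
suff /(is_dmx_mulmxl (invmx P)) /(is_dmx_mulmxr P) : is_dmx E t (E t *m diag_mx h).
  by rewrite /dconj !mulmxA mulmxK.
move=> a b; rewrite /E mulmx_diag.
rewrite (_ : (fun s => _) = (fun s => expR (s * h 0 a) *+ (a == b))); last first.
  by apply/funext => s; rewrite !mxE.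
rewrite !mxE; case: eqVneq => _; last exact: is_derive_cst.
rewrite !mulr1n.
apply: (@is_derive1_comp R expR (fun s => s * h 0 a)).
have := is_deriveM (is_derive_id t (1 : R)) (is_derive_cst (h 0 a) t (1 : R)).
by rewrite scaler0 add0r /GRing.scale /= mulr1.
Qed.

(** * The Lie algebra as a tangent space *)

Section SmoothRepresentations.
Import -(notations) mpoly.
Variables (R : realType) (n : nat).

(* The last condition says that [drho] is the differential of [rho] at [1]. *)
Definition smooth_rep N (rho drho : 'M[R]_n -> 'M[R]_N) : Prop :=
  [/\ rho 1%:M = 1%:M, (forall A B, rho (A *m B) = rho A *m rho B),
      (forall c X Y, drho (c *: X + Y) = c *: drho X + drho Y) &
      (forall c t X, is_dmx c t (c t *m X) ->
         is_dmx (fun s => rho (c s)) t (rho (c t) *m drho X))].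

(** Such functions include the entries and are closed under sums, by direct sums of representations,
    and products, by tensor products. Every polynomial in the entries is thus a linear functional of
    some representation. *)
Definition rep_coefficient (f : 'M[R]_n -> R) : Prop :=
  exists N (rho drho : 'M[R]_n -> 'M[R]_N) (u : 'rV[R]_N) (w : 'cV[R]_N),
    smooth_rep rho drho /\ forall A, f A = (u *m rho A *m w) 0 0.

Lemma rep_coefficient_cst c : rep_coefficient (fun=> c).
Proof.
exists 1%N, (fun=> 1%:M), (fun=> 0), c%:M, 1%:M; split; last first.
  by move=> A; rewrite !mulmx1 mxE eqxx.
split=> // [A B|c' X Y|c' t X _]; first by rewrite mulmx1.
  by rewrite scaler0 addr0.
by rewrite mulmx0; exact: is_dmx_cst.
Qed.

Lemma rep_coefficient_entry i j : rep_coefficient (fun A => A i j).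
Proof.
exists n, id, id, (delta_mx 0 i), (delta_mx j 0); split; first by split.
by move=> A; rewrite -rowE -colE !mxE.
Qed.

Lemma is_dmx_block N N' (f : R -> 'M[R]_N) (g : R -> 'M[R]_N') t D E :
  is_dmx f t D -> is_dmx g t E ->
  is_dmx (fun s => block_mx (f s) 0 0 (g s)) t (block_mx D 0 0 E).
Proof.
move=> hf hg a b.
case: (split_ordP a) => i ->; case: (split_ordP b) => j ->.
- rewrite block_mxEul; under eq_fun do rewrite block_mxEul; exact: hf.
- rewrite block_mxEur; under eq_fun do rewrite block_mxEur; exact: is_dmx_cst.
- rewrite block_mxEdl; under eq_fun do rewrite block_mxEdl; exact: is_dmx_cst.
- rewrite block_mxEdr; under eq_fun do rewrite block_mxEdr; exact: hg.
Qed.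

Lemma rep_coefficientD f g : rep_coefficient f -> rep_coefficient g ->
  rep_coefficient (fun A => f A + g A).
Proof.
move=> [N [r [dr [u [w [[r1 rM rL rd] fE]]]]]] [N' [r' [dr' [u' [w' [[r1' rM' rL' rd'] gE]]]]]].
exists (N + N')%N, (fun A => block_mx (r A) 0 0 (r' A)),
  (fun A => block_mx (dr A) 0 0 (dr' A)), (row_mx u u'), (col_mx w w'); split; last first.
  move=> A; rewrite mul_row_block !mulmx0 addr0 add0r mul_row_col fE gE.
  by rewrite [in RHS]mxE.
split=> [|A B|c X Y|c t X hc].
- by rewrite r1 r1' -scalar_mx_block.
- by rewrite rM rM' mulmx_block !(mulmx0, mul0mx) !addr0 add0r.
- by rewrite rL rL' scale_block_mx add_block_mx !scaler0 !addr0.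
- rewrite mulmx_block !(mulmx0, mul0mx) !addr0 add0r.
  exact: is_dmx_block (rd _ _ _ hc) (rd' _ _ _ hc).
Qed.

Lemma is_dmx_tens N N' (f : R -> 'M[R]_N) (g : R -> 'M[R]_N') t D E :
  is_dmx f t D -> is_dmx g t E ->
  is_dmx (fun s => mxtens.tensmx (f s) (g s)) t
         (mxtens.tensmx D (g t) + mxtens.tensmx (f t) E).
Proof.
move=> hf hg a b.
case: (mxtens.mxtens_indexP a) => i j; case: (mxtens.mxtens_indexP b) => k l.
rewrite mxE !mxtens.tensmxE; under eq_fun do rewrite mxtens.tensmxE.
have := is_deriveM (hf i k) (hg j l).
by rewrite addrC /GRing.scale /= [_ * D i k]mulrC.
Qed.

Lemma tensmxDl m1 n1 m2 n2 (A B : 'M[R]_(m1, n1)) (C : 'M[R]_(m2, n2)) :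
  mxtens.tensmx (A + B) C = mxtens.tensmx A C + mxtens.tensmx B C.
Proof. by apply/matrixP => a b; rewrite !mxE mulrDl. Qed.

Lemma tensmxDr m1 n1 m2 n2 (C : 'M[R]_(m1, n1)) (A B : 'M[R]_(m2, n2)) :
  mxtens.tensmx C (A + B) = mxtens.tensmx C A + mxtens.tensmx C B.
Proof. by apply/matrixP => a b; rewrite !mxE mulrDr. Qed.

Lemma tensmxZl m1 n1 m2 n2 c (A : 'M[R]_(m1, n1)) (C : 'M[R]_(m2, n2)) :
  mxtens.tensmx (c *: A) C = c *: mxtens.tensmx A C.
Proof. by apply/matrixP => a b; rewrite !mxE mulrA. Qed.

Lemma tensmxZr m1 n1 m2 n2 c (C : 'M[R]_(m1, n1)) (A : 'M[R]_(m2, n2)) :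
  mxtens.tensmx C (c *: A) = c *: mxtens.tensmx C A.
Proof. by apply/matrixP => a b; rewrite !mxE mulrCA. Qed.

Lemma tensmx11 m1 m2 : mxtens.tensmx (1%:M : 'M[R]_m1) (1%:M : 'M[R]_m2) = 1%:M.
Proof.
apply/matrixP => a b; case: (mxtens.mxtens_indexP a) => i j.
case: (mxtens.mxtens_indexP b) => k l; rewrite mxtens.tensmxE !mxE.
by rewrite (can_eq (@mxtens.mxtens_indexK _ _)) xpair_eqE -natrM mulnb.
Qed.

Lemma rep_coefficientM f g : rep_coefficient f -> rep_coefficient g ->
  rep_coefficient (fun A => f A * g A).
Proof.
move=> [N [r [dr [u [w [[r1 rM rL rd] fE]]]]]] [N' [r' [dr' [u' [w' [[r1' rM' rL' rd'] gE]]]]]].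
exists (N * N')%N, (fun A => mxtens.tensmx (r A) (r' A)),
  (fun A => mxtens.tensmx (dr A) 1%:M + mxtens.tensmx 1%:M (dr' A)),
  (mxtens.tensmx u u'), (mxtens.tensmx w w'); split; last first.
  move=> A; rewrite fE gE -mxtens.tensmxE -!mxtens.tensmx_mul.
  by apply: congr2; exact: ord1.
split=> [|A B|c X Y|c t X hc].
- by rewrite r1 r1' tensmx11.
- by rewrite rM rM' mxtens.tensmx_mul.
- by rewrite rL rL' tensmxDl tensmxDr tensmxZl tensmxZr scalerDr addrACA.
- rewrite mulmxDr !mxtens.tensmx_mul !mulmx1.
  exact: is_dmx_tens (rd _ _ _ hc) (rd' _ _ _ hc).
Qed.

Lemma rep_coefficient_mxeval (K : comNzRingType) (i : K -> R) (p : mxpolynomial n K) :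
  rep_coefficient (mxeval i p).
Proof.
have ext f g : f =1 g -> rep_coefficient f -> rep_coefficient g.
  by move=> /funext ->.
rewrite /mxeval /peval /mpoly.mmap.
elim: (mpoly.msupp p) => [|m s IH].
  by apply: ext (rep_coefficient_cst 0) => A; rewrite big_nil.
apply: (ext (fun A => _ + _)) => [A|]; first by rewrite big_cons.
apply: rep_coefficientD IH; apply: rep_coefficientM; first exact: rep_coefficient_cst.
rewrite /mpoly.mmap1; elim: (index_enum _) => [|j r IH].
  by apply: ext (rep_coefficient_cst 1) => A; rewrite big_nil.
apply: (ext (fun A => _ * _)) => [A|]; first by rewrite big_cons.
apply: rep_coefficientM IH; case: (mxvec_indexP j) => a b.
apply: (ext (fun A => A a b ^+ _)) => [A|]; first by rewrite mxvecE.
elim: (m _) => [|k IH].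
  by apply: ext (rep_coefficient_cst 1) => A; rewrite expr0.
apply: (ext (fun A => A a b * A a b ^+ k)) => [A|]; first by rewrite exprS.
exact: rep_coefficientM (rep_coefficient_entry a b) IH.
Qed.

(* [X] satisfies to first order all linear relations between matrix coefficients of
   representations that hold on [H]; these include the polynomial equations of [H]. *)
Definition tangent (H : set 'M[R]_n) : set 'M[R]_n :=
  [set X | forall N (rho drho : 'M[R]_n -> 'M[R]_N) (u : 'rV[R]_N) (w : 'cV[R]_N),
     smooth_rep rho drho -> (forall h, H h -> u *m rho h *m w = 0) ->
     u *m drho X *m w = 0].

Lemma tangent_lin H c X Y : tangent H X -> tangent H Y -> tangent H (c *: X + Y).
Proof.
move=> hX hY N r dr u w hr hu; have [_ _ rL _] := hr.
rewrite rL mulmxDr mulmxDl -scalemxAr -scalemxAl (hX _ _ _ _ _ hr hu).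
by rewrite (hY _ _ _ _ _ hr hu) scaler0 addr0.
Qed.

Section Lie.
Variables (K : comNzRingType) (i : K -> R) (G : set (mxpolynomial n K)).
Let H := zeros i G.
Hypotheses (H1 : H 1%:M) (HM : forall A B, H A -> H B -> H (A *m B)).

(** The right-hand side is linear in [X] by construction, so this equivalence shows that the
    one-parameter definition is closed under addition without any product formula for
    exponentials. *)
Lemma lie_tangent X : lie H X <-> tangent H X.
Proof.
split=> [hX N r dr u w [r1 rM rL rd] hu|hX t p Gp].
  have hd : is_dmx (fun s => u *m r (expmx (s *: X)) *m w) 0 (u *m dr X *m w).
    apply: is_dmx_mulmxr; apply: is_dmx_mulmxl.
    have := rd (fun s => expmx (s *: X)) 0 X.
    rewrite scale0r expmx0 r1 !mul1mx; apply.
    by have := is_dmx_expmx1 X 0; rewrite scale0r expmx0 mulmx1.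
  have hd0 : is_dmx (fun s => u *m r (expmx (s *: X)) *m w) 0 0.
    rewrite (_ : (fun s => _) = fun=> 0); first exact: is_dmx_cst.
    by apply/funext => s; exact/hu/hX.
  apply/matrixP => a b; have := hd a b; have := hd0 a b.
  by move=> /@derive_val + /@derive_val => <- ->.
have [N [r [dr [u [w [hr pE]]]]]] := rep_coefficient_mxeval i p.
have [r1 rM rL rd] := hr.
have E : r (expmx (t *: X)) = expmx (t *: dr X).
  move: t; apply: expmx_unique => [t|]; last by rewrite scale0r expmx0 r1.
  by apply: rd; rewrite -expmx_comm; exact: is_dmx_expmx1.
(* Tangency applied to the relation obtained by translating by [h] inserts one factor [dr X].
   Iterating it kills every term of the exponential series of [dr X]. *)
have I k h : H h -> u *m r h *m ((dr X) ^+ k *m w) = 0.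
  elim: k h => [|k IH] h Hh.
    rewrite expr0 mul1mx; apply/matrixP => a b; rewrite !ord1 -pE mxE; exact: Hh.
  rewrite expmxS -(mulmxA (dr X)) (mulmxA (u *m r h)).
  apply: (hX _ _ _ _ _ hr) => h' Hh'; rewrite -[u *m _ *m _]mulmxA -rM.
  exact/IH/HM.
rewrite pE E.
have cv : (fun N : nat => 0 : R) @ \oo --> (u *m expmx (t *: dr X) *m w) 0 0.
  rewrite (_ : (fun _ => 0) = fun N => \sum_j pseries (expmx_coef u (dr X) 0 j) t N * w j 0).
    rewrite [X in _ --> X]mxE; apply: cvg_fsum => j; apply: cvgMr_tmp.
    exact: cvg_expmx.
  apply/funext => M; rewrite /pseries /series /=.
  under eq_bigr do rewrite mulr_suml.
  rewrite exchange_big big1 // => k _.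
  have := I k _ H1; rewrite r1 mulmx1 mulmxA => /matrixP /(_ 0 0); rewrite !mxE => Ik.
  rewrite (eq_bigr (fun j => (u *m (dr X) ^+ k) 0 j * w j 0 * (k`!%:R^-1 * t ^+ k))).
    by rewrite -mulr_suml Ik mul0r.
  by move=> j _; rewrite /expmx_coef -!mulrA; congr (_ * _);
    rewrite mulrC mulrA [RHS]mulrC -!mulrA; congr (_ * _); rewrite mulrC.
by rewrite -(cvg_lim _ cv) ?lim_cst.
Qed.

Lemma lieD X Y : lie H X -> lie H Y -> lie H (X + Y).
Proof.
rewrite !lie_tangent => hX hY; rewrite -[X]scale1r; exact: tangent_lin.
Qed.

Lemma lieZ c X : lie H X -> lie H (c *: X).
Proof. by move=> hX t; rewrite scalerA; exact: hX. Qed.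


Lemma lie_conj g X : g \in unitmx -> H g -> H (invmx g) -> lie H X -> lie H (mxconj g X).
Proof.
by move=> ug Hg Hg' hX t; rewrite /mxconj -expmx_conj //; apply/HM => //; exact/HM.
Qed.

Lemma lie_tr X : (forall A, H A -> H A^T) -> lie H X -> lie H X^T.
Proof. by move=> HT hX t; rewrite -expmx_tr; exact/HT. Qed.

End Lie.
End SmoothRepresentations.

(** * Extrema over the orthogonal part of the group *)

Section SecondDerivative.
Variable R : realType.

Lemma second_derivative_test (F G : R -> R) (c : R) : 0 < c ->
  (forall t : R, is_derive t (1 : R) F (G t)) -> G 0 = 0 -> is_derive (0 : R) (1 : R) G c ->
  (forall t, F t <= F 0) -> False.
Proof.
move=> c0 dF G0 dG hmax.
have : h^-1 *: ((G \o shift 0) (h *: 1) - G 0) @[h --> 0^'] --> c.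
  by rewrite -(@derive_val _ _ _ _ _ _ _ dG); exact: (@ex_derive _ _ _ _ _ _ _ dG).
move=> /cvgr_gt /(_ 0 c0) [e /= e0 he].
have Gpos s : 0 < s -> s < e -> 0 < G s.
  move=> s0 se; have := he s; rewrite /ball_ /= sub0r normrN gtr0_norm // se gt_eqF //.
  rewrite G0 subr0 addr0 [s *: 1]mulr1 => /(_ isT isT).
  by rewrite pmulr_rgt0 // invr_gt0.
have e2 : 0 < e / 2 by rewrite divr_gt0.
have [|s] := @MVT R F G 0 (e / 2) e2 (fun x _ => dF x).
  by apply: derivable_within_continuous => x _; exact: (@ex_derive _ _ _ _ _ _ _ (dF x)).
rewrite in_itv /= => /andP[s0 se] E.
have : 0 < F (e / 2) - F 0.
  rewrite E subr0 mulr_gt0 // Gpos // (lt_trans se) //.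
  by rewrite ltr_pdivrMr // ltr_pMr // ltr1n.
by rewrite subr_gt0 ltNge hmax.
Qed.

End SecondDerivative.

Section OrthogonalMaximum.
Variable R : realType.

Let continuous_mx (T : topologicalType) m n (F : T -> 'M[R]_(m, n)) :=
  forall a b, continuous (fun v => F v a b).

Let continuous_sum (T : topologicalType) (I : Type) (l : seq I) (G : I -> T -> R) :
  (forall k, continuous (G k)) -> continuous (fun y => \sum_(k <- l) G k y).
Proof.
move=> hG; elim: l => [|k l IH].
  by rewrite (_ : (fun y => _) = fun=> 0); [move=> x; exact: cst_continuous|
    apply/funext => x; rewrite big_nil].
rewrite (_ : (fun y => _) = fun y => G k y + \sum_(k <- l) G k y).
  by move=> x; apply: continuousD; [exact: hG | exact: IH].
by apply/funext => x; rewrite big_cons.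
Qed.

Let continuous_mxM (T : topologicalType) m n p (F : T -> 'M[R]_(m, n)) (F' : T -> 'M[R]_(n, p)) :
  continuous_mx F -> continuous_mx F' -> continuous_mx (fun v => F v *m F' v).
Proof.
move=> hF hF' a b.
rewrite (_ : (fun v => _) = fun v => \sum_k F v a k * F' v k b); last first.
  by apply/funext => v; rewrite mxE.
by apply: continuous_sum => k v; apply: continuousM; [exact: hF | exact: hF'].
Qed.

Let continuous_vec_mx m n : continuous_mx (fun v : 'rV[R]_(m * n) => (vec_mx v : 'M[R]_(m, n))).
Proof.
move=> a b; rewrite (_ : (fun v => _) = fun v : 'rV[R]_(m * n) => v 0 (mxvec_index a b)).
  exact: coord_continuous.
by apply/funext => v; rewrite mxE.
Qed.

Let continuous_tr (T : topologicalType) m n (F : T -> 'M[R]_(m, n)) :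
  continuous_mx F -> continuous_mx (fun v => (F v)^T).
Proof.
by move=> hF a b; rewrite (_ : (fun v => _) = fun v => F v b a) //; apply/funext => v; rewrite mxE.
Qed.

Lemma orthogonal_entry (L : realDomainType) n (k : 'M[L]_n) : k *m k^T = 1%:M ->
  forall a b, `|k a b| <= 1.
Proof.
move=> E a b; move/matrixP: (E) => /(_ a a); rewrite !mxE eqxx (bigD1 b) //= mxE => E1.
rewrite -(@expr_le1 _ 2) // real_normK ?num_real // expr2 -[leRHS]E1 lerDl.
by apply: sumr_ge0 => j _; rewrite mxE -expr2 sqr_ge0.
Qed.

(** Compactness: the orthogonal matrices in the group form a closed set with entries bounded by 1.
    Matrices are flattened to row vectors to use that closed bounded sets are compact there. *)
Lemma orthogonal_trace_max (K : rcfType) (i : K -> R) n (G : set (mxpolynomial n K))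
    (X Y : 'M[R]_n) : zeros i G 1%:M ->
  exists k0, [/\ zeros i G k0, k0 *m k0^T = 1%:M &
    forall k, zeros i G k -> k *m k^T = 1%:M ->
      \tr (k *m X *m k^T *m Y) <= \tr (k0 *m X *m k0^T *m Y)].
Proof.
move=> G1.
pose C := [set v : 'rV[R]_(n * n) | zeros i G (vec_mx v) /\ vec_mx v *m (vec_mx v)^T = 1%:M].
pose f (v : 'rV[R]_(n * n)) := \tr (vec_mx v *m X *m (vec_mx v)^T *m Y).
have cst_c m p (M : 'M[R]_(m, p)) : continuous_mx (fun _ : 'rV[R]_(n * n) => M).
  by move=> a b v; exact: cst_continuous.
pose V v : 'M[R]_n := vec_mx v.
have cv : continuous_mx V by exact: (@continuous_vec_mx n n).
have ct : continuous_mx (fun v => (V v)^T) by exact: (@continuous_tr _ _ _ V cv).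
have fc : continuous f.
  rewrite /f /mxtrace; apply: continuous_sum => a.
  have c1 := @continuous_mxM _ _ _ _ V _ cv (cst_c _ _ X).
  have c2 := @continuous_mxM _ _ _ _ _ _ c1 ct.
  exact: (@continuous_mxM _ _ _ _ _ _ c2 (cst_c _ _ Y) a a).
have clC : closed C.
  have -> : C = \bigcap_(p in G) [set v | mxeval i p (vec_mx v) = 0] `&`
      \bigcap_(ab : 'I_n * 'I_n) [set v | (vec_mx v *m (vec_mx v)^T) ab.1 ab.2 = (1%:M :
        'M[R]_n) ab.1 ab.2].
    apply/seteqP; split=> v [h1 h2]; split=> //.
    - by move=> ab _ /=; rewrite h2.
    - by apply/matrixP => a b; exact: (h2 (a, b)).
  apply: closedI; last apply: closed_bigI => -[a b] _ /=.
    apply: closed_bigI => p _; apply: (@preimage_closed _ _ (fun v =>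
      mxeval i p (vec_mx v)) [set 0]); last exact: closed_eq.
    move=> v _; rewrite /mxeval.
    apply: (@continuous_peval _ _ i _ v _ p (fun k w => mxvec (vec_mx w) 0 k)) => k.
    rewrite (_ : (fun w => _) = fun w : 'rV[R]_(n * n) => w 0 k); first exact: coord_continuous.
    by apply/funext => w; rewrite vec_mxK.
  apply: (@preimage_closed _ _ (fun v => (V v *m (V v)^T) a b) [set (1%:M : 'M[R]_n) a b]);
    last exact: closed_eq.
  by move=> v _; exact: (@continuous_mxM _ _ _ _ _ _ cv ct a b v).
have bC : bounded_set C.
  exists 1; split; first exact: real1.
  move=> M hM v [_ ov]; apply/ltW/(le_lt_trans _ hM).
  suff : mx_norm v <= 1 by [].
  have [->|/mx_norm_neq0[[a j] /= E]] := eqVneq (mx_norm v) 0; first exact: ler01.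
  rewrite E (ord1 a); case: (mxvec_indexP j) => b c.
  by have := orthogonal_entry ov b c; rewrite mxE.
have [||k0] := @compact_EVT_max _ R f C _ (bounded_closed_compact bC clC).
- by exists (mxvec 1%:M); rewrite /C /= mxvecK trmx1 mulmx1.
- by apply: continuous_subspaceT.
rewrite inE => -[Gk ok] hk; exists (vec_mx k0); split=> // k Gk' ok'.
have := hk (mxvec k); rewrite /f inE /C /= mxvecK; apply.
by [].
Qed.

End OrthogonalMaximum.

(** * Brackets and logarithms in the Lie algebra *)

Section LieBracket.
Variables (R : realType) (n : nat).

Lemma is_dmx_unique m p (f : R -> 'M[R]_(m, p)) t D E : is_dmx f t D -> is_dmx f t E -> D = E.
Proof.
by move=> hD hE; apply/matrixP => a b; have := hD a b; have := hE a b; move=>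
  /@derive_val + /@derive_val => <- ->.
Qed.

Lemma expmx_at0 (X : 'M[R]_n) : is_dmx (fun s => expmx (s *: X)) 0 X.
Proof. by have := is_dmx_expmx1 X 0; rewrite scale0r expmx0 mulmx1. Qed.

Lemma expmx_inj (X Y : 'M[R]_n) : (forall t, expmx (t *: X) = expmx (t *: Y)) -> X = Y.
Proof.
move=> h; apply: is_dmx_unique (expmx_at0 X) _.
by rewrite (funext h); exact: expmx_at0.
Qed.



Lemma expmx_unit (X : 'M[R]_n) t : expmx (t *: X) \in unitmx.
Proof. by have [] := mulmx1_unit (expmxNr X t). Qed.

Lemma invmx_expmx (X : 'M[R]_n) t : invmx (expmx (t *: X)) = expmx (- t *: X).
Proof. by rewrite -[RHS](mulKmx (expmx_unit X t)) expmxNr mulmx1. Qed.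

Lemma is_dmx_conj (X Y : 'M[R]_n) t :
  is_dmx (fun s => expmx (s *: X) *m Y *m expmx (- s *: X)) t
    (expmx (t *: X) *m (X *m Y - Y *m X) *m expmx (- t *: X)).
Proof.
have h := is_dmxM (is_dmx_mulmxr Y (is_dmx_expmx1 X t)) (is_dmxN (is_dmx_expmx1 X (- t))).
move: h; rewrite mulmxBr mulmxBl mulmxN !mulmxA expmx_comm.
by [].
Qed.

(** The tangent space is cut out by linear equations with constant coefficients, and these may be
    differentiated along a curve. *)
Lemma tangent_derivative (H : set 'M[R]_n) (c : R -> 'M[R]_n) t D :
  (forall s, tangent H (c s)) -> is_dmx c t D -> tangent H D.
Proof.
move=> hc cD N r dr u w hr hu; have [_ _ rL _] := hr.
have r0 : dr 0 = 0.
  by have := rL (-1) 0 0; rewrite scaler0 addr0 scaleN1r addNr.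
have rS (I : Type) (l : seq I) (x : I -> R) (M : I -> 'M[R]_n) :
    dr (\sum_(k <- l) x k *: M k) = \sum_(k <- l) x k *: dr (M k).
  by elim: l => [|k l IH]; rewrite ?big_nil // !big_cons rL IH.
have E X : u *m dr X *m w = \sum_a \sum_b X a b *: (u *m dr (delta_mx a b) *m w).
  rewrite {1}(matrix_sum_delta X) pair_bigA /= rS pair_bigA /= mulmx_sumr mulmx_suml.
  by apply: eq_bigr => -[a b] _; rewrite -scalemxAr -scalemxAl.
apply: (@is_dmx_unique _ _ (fun s => u *m dr (c s) *m w) t); last first.
  rewrite (_ : (fun s => _) = fun=> 0); first exact: is_dmx_cst.
  by apply/funext => s; exact: (hc s _ _ _ _ _ hr hu).
move=> p q; rewrite E.
rewrite (_ : (fun s => _) = \sum_a \sum_b (fun s =>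
  c s a b * (u *m dr (delta_mx a b) *m w) p q)); last first.
  apply/funext => s; rewrite E fct_sumE summxE; apply: eq_bigr => a _.
  by rewrite fct_sumE summxE; apply: eq_bigr => b _; rewrite mxE.
rewrite summxE; apply: is_derive_sum => a; rewrite summxE; apply: is_derive_sum => b.
have -> : (D a b *: (u *m dr (delta_mx a b) *m w)) p q = D a b * (u *m dr (delta_mx a b) *m w) p
  q by rewrite mxE.
have := is_deriveM (cD a b) (is_derive_cst ((u *m dr (delta_mx a b) *m w) p q) t (1 : R)).
by rewrite scaler0 add0r /GRing.scale /= [_ * D a b]mulrC.
Qed.

Section Group.
Variables (K : rcfType) (i : {rmorphism K -> R}) (G : set (mxpolynomial n K)).
Hypothesis hG : alg_subgroup_SL G.
Let H := zeros i G.

(** The bracket is the derivative at 0 of the conjugates of [Y] by the exponentials of [s *: X], all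
    of which lie in the Lie algebra. *)
Lemma lie_bracket X Y : lie H X -> lie H Y -> lie H (X *m Y - Y *m X).
Proof.
have lt := lie_tangent (zeros1 hG i) (fun A B => @zerosM _ _ _ hG _ i A B).
move=> hX hY; apply/lt; have := is_dmx_conj X Y 0.
rewrite oppr0 scale0r expmx0 mul1mx mulmx1; apply: tangent_derivative => s.
apply/lt; have := lie_conj (fun A B => @zerosM _ _ _ hG _ i A B) (expmx_unit X s) (hX s) _ hY.
by rewrite /mxconj invmx_expmx; apply; exact: hX.
Qed.

(** Real powers of positive numbers are multiplicative functions, so a group containing a positive
    diagonalizable element contains its whole one-parameter group. *)
Lemma lie_log (P : 'M[R]_n) (d : 'rV[R]_n) : P \in unitmx -> (forall j, 0 < d 0 j) ->
  H (dconj P d) -> lie H (dconj P (map_mx (@ln R) d)).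
Proof.
move=> uP d0 Hd t; rewrite expmx_dconj //.
have -> : map_mx expR (t *: map_mx (@ln R) d) = map_mx (fun x => expR (t * ln x)) d.
  by apply/rowP => j; rewrite !mxE.
apply: zeros_generalized_power => // [k|x y x0 y0|].
- rewrite -dconj_exp //; elim: k => [|k IH]; first exact: zeros1.
  by rewrite iterS; exact: zerosM.
- by rewrite lnM // mulrDr expRD.
- by rewrite ln1 mulr0 expR0.
Qed.

End Group.

Lemma expmx_log (P : 'M[R]_n) (d : 'rV[R]_n) : P \in unitmx -> (forall j, 0 < d 0 j) ->
  expmx (dconj P (map_mx (@ln R) d)) = dconj P d.
Proof.
move=> uP d0; have := expmx_dconj (map_mx (@ln R) d) 1 uP; rewrite scale1r => ->.
by congr dconj; apply/rowP => j; rewrite !mxE mul1r lnK // posrE.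
Qed.

End LieBracket.

(** * Roots and the Cartan decomposition *)

Lemma linear_form_ex (F : fieldType) (vT wT : vectType F) (f : vT -> wT) : linear f ->
  exists alpha : 'Hom(vT, wT), forall x, alpha x = f x.
Proof.
move=> hf; pose lf : {linear vT -> wT} := HB.pack f (GRing.isLinear.Build F vT wT _ f hf).
by exists (linfun lf) => x; rewrite lfunE.
Qed.

(** Evaluation at the members of a basis of the dual space is injective, hence bijective by
    dimension; the point sought is the preimage of the all-ones vector. *)
Lemma dual_basis_sum_point (F : fieldType) (vT : vectType F) (Delta : seq 'Hom(vT, F^o)) :
  basis_of fullv Delta -> exists H : vT, forall alpha, alpha \in Delta -> (alpha H : F) = 1.
Proof.
move=> bD.
have sD : size Delta = dim vT.
  by have := size_basis (X := in_tuple Delta) bD; rewrite dimvf => <-; rewrite [LHS]muln1.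
have [f fE] : exists f : 'Hom(vT, 'rV[F]_(size Delta)), forall x, f x = \row_k (Delta`_k x : F).
  by apply: linear_form_ex => c x y; apply/rowP => k; rewrite !mxE linearP.
have f0 : lker f == 0%VS.
  apply/lker0P => x y; rewrite !fE => /rowP E; apply/eqP; rewrite -subr_eq0; apply/eqP.
  have z (alpha : 'Hom(vT, F^o)) : (alpha (x - y) : F) = 0.
    have : alpha \in <<in_tuple Delta>>%VS by rewrite (span_basis bD) memvf.
    move=> /coord_span ->; rewrite sum_lfunE big1 // => k _.
    by rewrite scale_lfunE linearB /=; have := E k; rewrite !mxE => ->; rewrite subrr scaler0.
  rewrite (coord_vbasis (memvf (x - y))) big1 // => j _.
  have [|alpha aE] := @linear_form_ex F vT F^o (coord (vbasis fullv) j).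
    by move=> c u w; rewrite linearP.
  by rewrite -aE z scale0r.
have imf : limg f = fullv.
  apply/eqP; rewrite eqEdim subvf /= limg_dim_eq; last by rewrite (eqP f0) capv0.
  by rewrite !dimvf sD -[leqRHS]mul1n.
have : const_mx 1 \in limg f by rewrite imf memvf.
case/memv_imgP=> H _ E; exists H => alpha hal.
have lt : (index alpha Delta < size Delta)%N by rewrite index_mem.
move/rowP: E => /(_ (Ordinal lt)); rewrite fE !mxE /= nth_index //.
Qed.

(** * Weights and roots of the real group *)

Section RootsOverR.
Variables (n d : nat) (K : rcfType) (G S : set (mxpolynomial n K)).
Variables (phi : 'I_n -> 'I_n -> mpoly.mpoly (d + d) K) (psi : 'I_d -> mxpolynomial n K).
Hypothesis hG : alg_subgroup_SL G.
Hypothesis hmax : maximal_split_torus G S.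
Hypothesis hSsym : forall s, geom S s -> s = s^T.
Hypothesis hT : split_by S phi psi.

Let hS : alg_subgroup_SL S. Proof. by case: hmax => -[]. Qed.
Let v (M : Type) : void -> M. Proof. by case. Qed.

(** One matrix [B] over [K] diagonalizes the torus over all extensions. That its entries come from
    [K] matters later: over [F] they and those of the inverse lie in [O]. *)
Lemma torus_diagonalizable : exists2 B : 'M[K]_n, B \in unitmx &
  forall (L : rcfType) (i : {rmorphism K -> L}) s, zeros i S s ->
    forall a b, a != b -> (map_mx i B *m s *m map_mx i (invmx B)) a b = 0.
Proof.
have [s s' Ss Ss'|s Ss|B uB hB] := @codiagonalizable_set K n (zeros idfun S).
- exact: (zeros_torus_comm hmax hSsym Ss Ss').
- by apply: symmetric_diagonalizable; exact: (zeros_torus_sym hSsym Ss).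
exists B => // L i.
pose D (L : rcfType) (i : {rmorphism K -> L}) (x : void -> L) :=
  forall s : 'M[L]_n, zeros i S s -> forall a b : 'I_n, a != b ->
    (map_mx i B *m s *m map_mx i (invmx B)) a b = 0.
have hD : definable D.
  apply: definable_forall_mx; apply: definable_imply.
    by apply: definable_zeros; apply: polymx_var.
  apply: definable_forall_fin => a; apply: definable_forall_fin => b.
  apply: definable_imply; first exact: definable_cst.
  apply: definable_eq; last exact: polyfam0.
  have p : polymx (fun (L : rcfType) (i : {rmorphism K -> L}) (x : (void + 'I_n * 'I_n) -> L) =>
      map_mx i B *m (\matrix_(a, b) x (inr (a, b))) *m map_mx i (invmx B)).
    by apply: polymx_mul; [apply: polymx_mul; [exact: polymx_cst|exact: polymx_var]|exact:
      polymx_cst].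
  exact: p.
apply: (definable_sentence hD idfun i (v _) (v _)).1 => s Ss a b ab.
have [e] := hB s Ss; rewrite (dconjP _ _ uB) => E.
have -> : map_mx idfun B *m s *m map_mx idfun (invmx B) = diag_mx e.
  by rewrite -E; congr (_ *m _ *m _); apply/matrixP => p q; rewrite mxE.
by rewrite mxE (negbTE ab).
Qed.

Variable B : 'M[K]_n.
Hypotheses (uB : B \in unitmx) (hB : forall (L : rcfType) (i : {rmorphism K -> L}) s,
  zeros i S s -> forall a b, a != b -> (map_mx i B *m s *m map_mx i (invmx B)) a b = 0).

Definition bconj (L : rcfType) (i : {rmorphism K -> L}) (M : 'M[L]_n) :=
  map_mx i B *m M *m map_mx i (invmx B).

Section Conj.
Variables (L : rcfType) (i : {rmorphism K -> L}).

Lemma bconj_unit : map_mx i B \in unitmx.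
Proof. by rewrite map_unitmx. Qed.

Lemma bconjM (M N : 'M[L]_n) : bconj i (M *m N) = bconj i M *m bconj i N.
Proof. by rewrite /bconj !mulmxA map_invmx mulmxKV ?bconj_unit. Qed.

Lemma bconj1 : bconj i 1%:M = 1%:M.
Proof. by rewrite /bconj mulmx1 map_invmx mulmxV ?bconj_unit. Qed.

Lemma bconj_lin c (M N : 'M[L]_n) : bconj i (c *: M + N) = c *: bconj i M + bconj i N.
Proof. by rewrite /bconj mulmxDr mulmxDl -scalemxAr -scalemxAl. Qed.

Lemma bconj_inj : injective (bconj i).
Proof.
move=> M N /(can_inj (mulmxK _)) E; apply: (can_inj (mulKmx bconj_unit)).
by apply: E; rewrite map_invmx unitmx_inv bconj_unit.
Qed.

Lemma bconj_dconj e : bconj i (dconj (map_mx i B) e) = diag_mx e.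
Proof. by rewrite /bconj map_invmx; apply/dconjP; rewrite ?bconj_unit. Qed.

Lemma bconj_torus s : zeros i S s -> s = dconj (map_mx i B) (\row_j bconj i s j j).
Proof.
move=> Ss; apply: bconj_inj; rewrite bconj_dconj; apply/matrixP => a b.
rewrite [RHS]mxE [X in _ = X *+ _]mxE.
by case: eqVneq => [<-|ab]; rewrite ?mulr1n //; exact: hB.
Qed.

Lemma torus_eigen_unit s j : zeros i S s -> bconj i s j j != 0.
Proof.
move=> Ss; apply/eqP => E.
have := zeros_unitmx hS Ss; rewrite (bconj_torus Ss) unitmxE !det_mulmx det_diag.
by rewrite (bigD1 j) //= mxE E mul0r mulr0 mul0r unitr0.
Qed.

Lemma torus_eigenM s s' j : zeros i S s -> zeros i S s' ->
  bconj i (s *m s') j j = bconj i s j j * bconj i s' j j.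
Proof.
move=> Ss Ss'; rewrite bconjM [LHS]mxE (bigD1 j) //= big1 ?addr0 // => k kj.
by rewrite [X in X * _](hB Ss) ?mul0r // eq_sym.
Qed.

Lemma pos_tor_eigen_gt0 s j : pos_tor S psi i s -> 0 < bconj i s j j.
Proof.
move=> /(pos_tor_sqrt hT)[r [Sr _] ->].
by rewrite torus_eigenM // -expr2 exprn_even_gt0 //= torus_eigen_unit.
Qed.

End Conj.
End RootsOverR.

Section RootsOfRealGroup.
Variables (n d : nat) (K : rcfType) (G S : set (mxpolynomial n K)).
Variables (phi : 'I_n -> 'I_n -> mpoly.mpoly (d + d) K) (psi : 'I_d -> mxpolynomial n K).
Hypothesis hG : alg_subgroup_SL G.
Hypothesis hGadj : forall g, geom G g -> geom G g^T.
Hypothesis hmax : maximal_split_torus G S.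
Hypothesis hSsym : forall s, geom S s -> s = s^T.
Hypothesis hT : split_by S phi psi.
Variable B : 'M[K]_n.
Hypotheses (uB : B \in unitmx) (hB : forall (L : rcfType) (i : {rmorphism K -> L}) s,
  zeros i S s -> forall a b, a != b -> (map_mx i B *m s *m map_mx i (invmx B)) a b = 0).
Variables (R : realType) (iR : {rmorphism K -> R}) (a : {vspace 'M[R]_n}).
Hypothesis ha : forall X, (X \in a) <-> lie (pos_tor S psi iR) X.

Let hS : alg_subgroup_SL S. Proof. by case: hmax => -[]. Qed.
Let BR := map_mx iR B.
Let cB := bconj B iR.
Let g := lie (zeros iR G).
Let Sigma := root_system g a.

Let uBR : BR \in unitmx. Proof. by rewrite map_unitmx. Qed.
Let zGM X Y : zeros iR G X -> zeros iR G Y -> zeros iR G (X *m Y).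
Proof. exact: zerosM. Qed.

Let gD X Y : g X -> g Y -> g (X + Y).
Proof. exact/lieD/zGM/zeros1. Qed.

Let gZ c X : g X -> g (c *: X).
Proof. exact: lieZ. Qed.

Lemma expmx_double (X : 'M[R]_n) t :
  expmx (t *: X) *m expmx (t *: X) = expmx (t *: (X + X)).
Proof.
move: t; apply: (expmx_unique (W := fun t => expmx (t *: X) *m expmx (t *: X))) => [t|]; last first.
  by rewrite scale0r expmx0 mulmx1.
have := is_dmxM (is_dmx_expmx1 X t) (is_dmx_expmx1 X t).
by rewrite mulmxDr expmx_comm -!mulmxA expmx_comm.
Qed.

(** Positivity of the coordinates is automatic on a one-parameter group, since every element is the
    square of another. *)
Lemma split_lie_torus X : (X \in a) <-> lie (zeros iR S) X.
Proof.
split=> [/ha hX t|hX]; first by case: (hX t).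
apply/ha => t; split=> [|j]; first exact: hX.
have -> : t *: X = (t / 2) *: (X + X).
  by rewrite scalerDr -scalerDl -splitr.
rewrite -expmx_double (psiM hT) // -expr2 exprn_even_gt0 //=.
exact: (psi_neq0 hT).
Qed.

Lemma split_lie_offdiag X : X \in a -> forall j k, j != k -> cB X j k = 0.
Proof.
move=> /split_lie_torus hX j k jk.
have h := is_dmx_mulmxr (map_mx iR (invmx B)) (is_dmx_mulmxl BR (expmx_at0 X)).
have := h j k; rewrite (_ : (fun s => _) = fun=> 0); last first.
  by apply/funext => s; exact: (hB (hX s)).
by move=> /@derive_val <-; rewrite derive_cst.
Qed.

Lemma split_lie_mulmxl X M j k : X \in a -> cB (X *m M) j k = cB X j j * cB M j k.
Proof.
move=> aX; rewrite /cB bconjM // [LHS]mxE (bigD1 j) //= big1 ?addr0 // => l lj.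
by rewrite [X in X * _]split_lie_offdiag ?mul0r // eq_sym.
Qed.

Lemma split_lie_mulmxr X M j k : X \in a -> cB (M *m X) j k = cB M j k * cB X k k.
Proof.
move=> aX; rewrite /cB bconjM // [LHS]mxE (bigD1 k) //= big1 ?addr0 // => l lk.
by rewrite [X in _ * X]split_lie_offdiag ?mulr0.
Qed.

Lemma split_lie_dconj X : X \in a -> X = dconj BR (\row_j cB X j j).
Proof.
move=> aX; apply: (@bconj_inj _ _ _ uB _ iR); rewrite bconj_dconj //; apply/matrixP => j k.
rewrite [RHS]mxE [X in _ = X *+ _]mxE.
by case: eqVneq => [<-|jk]; rewrite ?mulr1n //; exact: split_lie_offdiag.
Qed.

Lemma split_lie_eigen X j : X \in a -> cB (expmx X) j j = expR (cB X j j).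
Proof.
move=> aX; rewrite {1}(split_lie_dconj aX) -[dconj _ _]scale1r expmx_dconj //.
rewrite /cB /BR bconj_dconj // [LHS]mxE eqxx mulr1n [LHS]mxE [X in expR X]mxE.
by rewrite mul1r mxE.
Qed.

Lemma split_lie_sym X : X \in a -> X^T = X.
Proof.
move=> /split_lie_torus hX; apply: expmx_inj => t.
by rewrite -expmx_tr (zeros_torus_sym hSsym (hX t)).
Qed.

Lemma pos_tor_exp c : pos_tor S psi iR c -> exists2 X, X \in a & c = expmx X.
Proof.
move=> Ac; have [Sc _] := Ac.
have c0 j : 0 < (\row_j cB c j j) 0 j by rewrite mxE (pos_tor_eigen_gt0 hmax hT uB hB).
have E := bconj_torus uB hB Sc.
exists (dconj BR (map_mx (@ln R) (\row_j cB c j j))); last by rewrite expmx_log.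
apply/split_lie_torus; apply: lie_log => //.
by rewrite -E.
Qed.

Lemma weight_form j k : exists lam : dual a, forall X, (lam X :
  R) = cB (vsval X) j j - cB (vsval X) k k.
Proof.
apply: linear_form_ex => c X Y.
have E l : cB (vsval (c *: X + Y)) l l = c * cB (vsval X) l l + cB (vsval Y) l l.
  by rewrite linearP /cB bconj_lin [LHS]mxE [X in X + _]mxE.
rewrite !E opprD addrACA; congr (_ + _); exact: (esym (mulrBr _ _ _)).
Qed.

Let cBB M N j k : cB (M - N) j k = cB M j k - cB N j k.
Proof. by rewrite -scaleN1r addrC /cB bconj_lin [LHS]mxE [X in X + _]mxE mulN1r addrC. Qed.

Let cBZ c M j k : cB (c *: M) j k = c * cB M j k.
Proof. by rewrite /cB /bconj -scalemxAr -scalemxAl [LHS]mxE. Qed.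

Let cB0 j k : cB 0 j k = 0.
Proof. by rewrite /cB /bconj mulmx0 mul0mx mxE. Qed.

Let form (jk : 'I_n * 'I_n) : dual a := projT1 (cid (weight_form jk.1 jk.2)).

Let formE jk X : (form jk X : R) = cB (vsval X) jk.1 jk.1 - cB (vsval X) jk.2 jk.2.
Proof. by rewrite /form; case: cid. Qed.

(** In the basis [B] the bracket with an element of [a] multiplies the entry at [j], [k] by the
    difference of two eigenvalues; a nonzero entry of a root vector identifies the root with that
    difference. *)
Lemma root_weight alpha : Sigma alpha -> exists jk, alpha = form jk.
Proof.
move=> [_ [X [_ X0 hX]]].
have [jk nz] : exists jk : 'I_n * 'I_n, cB X jk.1 jk.2 != 0.
  apply: contrapT => /forallNP h; apply: X0; apply: (@bconj_inj _ _ _ uB _ iR).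
  apply/matrixP => j k; have /negP/negPn/eqP := h (j, k); rewrite /= => E.
  by rewrite [LHS]E -[RHS]/(cB 0 j k) cB0.
exists jk; apply/lfunP => H; apply/(mulIf nz); rewrite formE mulrBl.
have aH : vsval H \in a by apply: subvsP.
have := congr1 (fun M => cB M jk.1 jk.2) (hX H).
rewrite cBB cBZ split_lie_mulmxl // split_lie_mulmxr // => <-.
by congr (_ - _); exact: mulrC.
Qed.

Lemma root_system_finite : finite_set Sigma.
Proof.
apply: (@sub_finite_set _ _ [set form jk | jk in [set: 'I_n * 'I_n]]).
  by move=> alpha /root_weight[jk ->]; exists jk.
exact/finite_image/finite_finset.
Qed.

(* Applying (ad X - mu X) / (lam X - mu X), for suitable X, kills the component of weight mu. *)
Lemma weight_component_lie Z jk : g Z -> exists2 W, g W &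
  forall pq, cB W pq.1 pq.2 = if form pq == form jk then cB Z pq.1 pq.2 else 0.
Proof.
move=> gZZ; set lam := form jk.
suff [W gW hW] : exists2 W, g W & forall pq,
    (form pq == lam -> cB W pq.1 pq.2 = cB Z pq.1 pq.2) /\
    (form pq \in [seq mu <- [seq form pq | pq <- enum [set: 'I_n * 'I_n]%SET] | mu != lam] ->
      cB W pq.1 pq.2 = 0).
  exists W => // pq; case: ifPn => [/(hW pq).1//|ne]; apply: (hW pq).2.
  by rewrite mem_filter ne /=; apply: map_f; rewrite mem_enum inE.
have : all (fun mu => mu != lam) [seq mu <- [seq form pq | pq <- enum [set:
  'I_n * 'I_n]%SET] | mu != lam].
  exact: filter_all.
elim: [seq mu <- _ | _] => [_|mu l IH /= /andP[ml al]]; first by exists Z.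
have [W gW hW] := IH al.
have [X nX] : exists X, (mu X : R) != lam X.
  apply: contrapT => /forallNP h; move/eqP: ml; apply; apply/lfunP => X.
  by have /negP/negPn/eqP := h X.
have aX : vsval X \in a by apply: subvsP.
have nX' : (lam X : R) - mu X != 0 by rewrite subr_eq0 eq_sym.
have gX : g (vsval X) by move=> t; apply: (torus_sub_group hmax); exact:
  ((split_lie_torus _).1 aX t).
pose V := ((lam X : R) - mu X)^-1 *: ((vsval X *m W - W *m vsval X) - (mu X : R) *: W).
have hV pq : cB V pq.1 pq.2 =
    ((lam X : R) - mu X)^-1 * ((form pq X : R) - mu X) * cB W pq.1 pq.2.
  rewrite /V cBZ !cBB cBZ split_lie_mulmxl // split_lie_mulmxr // formE -mulrA.
  by congr (_ * _); rewrite !mulrBl; congr (_ - _ - _); exact: mulrC.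
exists V.
  apply: gZ; rewrite -scaleNr; apply: gD; last exact: gZ.
  exact: lie_bracket.
move=> pq; rewrite hV; split=> [/[dup] /(hW pq).1 -> /eqP ->|].
  by rewrite mulVf // mul1r.
rewrite inE => /orP[/eqP ->|/(hW pq).2 ->]; last by rewrite mulr0.
by rewrite subrr mulr0 mul0r.
Qed.

Lemma weight_root Z jk : g Z -> cB Z jk.1 jk.2 != 0 -> form jk <> 0 -> Sigma (form jk).
Proof.
move=> gZZ nz f0; split=> //; have [W gW hW] := weight_component_lie jk gZZ.
exists W; split=> //.
  by move=> W0; move: (hW jk); rewrite eqxx W0 cB0 => E; rewrite -E eqxx in nz.
move=> H; apply: (@bconj_inj _ _ _ uB _ iR); apply/matrixP => j k.
have aH : vsval H \in a by apply: subvsP.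
rewrite -!/cB cBB cBZ split_lie_mulmxl // split_lie_mulmxr // [X in _ - X]mulrC -mulrBl.
rewrite -(formE (j, k)); have := hW (j, k) => /= ->.
by case: eqP => [->|_]; rewrite ?mulr0.
Qed.

Lemma root_weight_ex alpha : Sigma alpha -> exists j k,
  forall X : subvs_of a, (alpha X : R) = cB (vsval X) j j - cB (vsval X) k k.
Proof. by move=> /root_weight[[j k] ->]; exists j, k => X; rewrite formE. Qed.

Lemma weight_root_ex Z j k X : g Z -> cB Z j k != 0 -> X \in a -> cB X j j != cB X k k ->
  exists2 alpha, Sigma alpha &
    forall X : subvs_of a, (alpha X : R) = cB (vsval X) j j - cB (vsval X) k k.
Proof.
move=> gZZ nz aX nX; exists (form (j, k)); last by move=> Y; rewrite formE.
apply: (weight_root gZZ) => // f0.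
have := formE (j, k) (Subvs aX); rewrite f0 lfunE /= => /esym/eqP.
by rewrite subr_eq0 (negbTE nX).
Qed.

End RootsOfRealGroup.

(** * Cartan decomposition over the reals *)

Section OrbitMaximum.
Variables (R : realType) (n : nat).
Implicit Types X Y Z H : 'M[R]_n.

Lemma is_derive_trace (f : R -> 'M[R]_n) t D : is_dmx f t D ->
  is_derive t (1 : R) (fun s => \tr (f s)) (\tr D).
Proof.
move=> hf; rewrite (_ : (fun s => _) = \sum_j (fun s => f s j j)); last first.
  by apply/funext => s; rewrite fct_sumE.
by apply: is_derive_sum => j; exact: hf.
Qed.

Lemma orbit_max_derivatives Y Z H :
  (forall t, \tr (expmx (t *: Y) *m Z *m expmx (- t *: Y) *m H) <= \tr (Z *m H)) ->
  \tr ((Y *m Z - Z *m Y) *m H) = 0 /\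
  \tr ((Y *m (Y *m Z - Z *m Y) - (Y *m Z - Z *m Y) *m Y) *m H) <= 0.
Proof.
move=> hm.
pose F W t := \tr (expmx (t *: Y) *m W *m expmx (- t *: Y) *m H).
have dF W t : is_derive t (1 : R) (F W) (F (Y *m W - W *m Y) t).
  by apply: is_derive_trace; apply: is_dmx_mulmxr; exact: is_dmx_conj.
have F0 W : F W 0 = \tr (W *m H).
  by rewrite /F oppr0 scale0r expmx0 mul1mx mulmx1.
have hm' t : F Z t <= F Z 0 by rewrite F0; exact: hm.
have z0 : F (Y *m Z - Z *m Y) 0 = 0.
  have i0 : (0 : R) \in `](-1), 1[ by rewrite in_itv /= ltrN10 ltr01.
  have d0 : is_derive (0 : R) (1 : R) (F Z) 0.
    apply: (@derive1_at_max R (F Z) (-1) 1 0 _ _ i0 (fun t _ => hm' t)).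
    - by rewrite (le_trans (lerN10 _)).
    - by move=> t _; exact: (@ex_derive _ _ _ _ _ _ _ (dF Z t)).
  by rewrite -(@derive_val _ _ _ _ _ _ _ (dF Z 0)) (@derive_val _ _ _ _ _ _ _ d0).
split; first by rewrite -F0.
rewrite leNgt; apply/negP => c0.
apply: (second_derivative_test c0 (dF Z) z0 _ hm').
by rewrite -F0; exact: dF.
Qed.

End OrbitMaximum.

Lemma trace_gram_gt0 (L : realDomainType) m n (W : 'M[L]_(m, n)) : W != 0 ->
  0 < \tr (W *m W^T).
Proof.
move=> W0; have E : \tr (W *m W^T) = \sum_j \sum_k W j k ^+ 2.
  by apply: eq_bigr => j _; rewrite mxE; apply: eq_bigr => k _; rewrite mxE.
have h j : 0 <= \sum_k W j k ^+ 2 by apply: sumr_ge0 => k _; exact: sqr_ge0.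
rewrite E lt_def sumr_ge0 ?andbT //; apply: contraNneq W0 => /eqP.
rewrite psumr_eq0 // => /allP hj; apply/eqP/matrixP => j k.
have := hj j; rewrite mem_index_enum psumr_eq0 => [/(_ isT)/allP/(_ k)|l _]; last exact: sqr_ge0.
by rewrite mem_index_enum sqrf_eq0 mxE => /(_ isT)/eqP.
Qed.

Section RealCartan.
Variables (n d : nat) (K : rcfType) (G S : set (mxpolynomial n K)).
Variables (phi : 'I_n -> 'I_n -> mpoly.mpoly (d + d) K) (psi : 'I_d -> mxpolynomial n K).
Hypothesis hG : alg_subgroup_SL G.
Hypothesis hGadj : forall g, geom G g -> geom G g^T.
Hypothesis hmax : maximal_split_torus G S.
Hypothesis hSsym : forall s, geom S s -> s = s^T.
Hypothesis hT : split_by S phi psi.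
Variable B : 'M[K]_n.
Hypotheses (uB : B \in unitmx) (hB : forall (L : rcfType) (i : {rmorphism K -> L}) s,
  zeros i S s -> forall a b, a != b -> (map_mx i B *m s *m map_mx i (invmx B)) a b = 0).
Variables (R : realType) (iR : {rmorphism K -> R}) (a : {vspace 'M[R]_n}).
Hypothesis ha : forall X, (X \in a) <-> lie (pos_tor S psi iR) X.
Variable Delta : seq (dual a).
Hypothesis hDelta : root_basis (root_system (lie (zeros iR G)) a) Delta.

Let BR := map_mx iR B.
Let cB := bconj B iR.
Let g := lie (zeros iR G).
Let Sigma := root_system g a.

Let uBR : BR \in unitmx. Proof. by rewrite map_unitmx. Qed.

Let split_lie_g X : X \in a -> g X.
Proof. by move=> /(split_lie_torus hT ha) hX t; exact/(torus_sub_group hmax)/hX. Qed.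

(** A nonzero entry of [Z] at a weight that does not vanish on [a] makes this weight a root, and
    commutation makes the root vanish at [H]. But up to sign its value there is the sum of its
    nonnegative coefficients on [Delta], so the root would be zero. *)
Lemma commute_regular Z (H : subvs_of a) : (forall alpha, alpha \in Delta -> (alpha H : R) = 1) ->
  g Z -> Z *m vsval H = vsval H *m Z -> forall X, X \in a -> Z *m X = X *m Z.
Proof.
move=> hH gZ ZH X aX; apply: (@bconj_inj _ _ _ uB _ iR); apply/matrixP => j k.
rewrite (split_lie_mulmxl hT uB hB ha) // (split_lie_mulmxr hT uB hB ha) //.
have [->|nz] := eqVneq (bconj B iR Z j k) 0; first by rewrite mul0r mulr0.
have [->|nX] := eqVneq (bconj B iR X j j) (bconj B iR X k k); first exact: mulrC.
have [alpha Sa alphaE] := weight_root_ex hG hmax hT uB hB ha gZ nz aX nX.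
have aH : vsval H \in a by apply: subvsP.
have a0 : (alpha H : R) = 0.
  apply/(mulIf nz); rewrite mul0r alphaE mulrBl.
  rewrite -(split_lie_mulmxl hT uB hB ha) // [_ * _]mulrC -(split_lie_mulmxr hT uB hB ha) //.
  by rewrite ZH subrr.
have [_ _ /(_ alpha Sa)[c hc]] := hDelta.
have sumE : ((\sum_(beta <- Delta) beta *+ c beta) H : R) = \sum_(beta <- Delta) (c beta)%:R.
  rewrite sum_lfunE; apply: eq_big_seq => beta hb.
  by rewrite -scaler_nat scale_lfunE hH //; exact: mulr1.
have : (\sum_(beta <- Delta) (c beta)%:R : R) = 0.
  rewrite -sumE; case: hc a0 => ->; first by [].
  by rewrite opp_lfunE => /eqP; rewrite oppr_eq0 => /eqP.
move=> /eqP; rewrite -natr_sum pnatr_eq0 sum_nat_seq_eq0 => /allP c0.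
have [[]] : Sigma alpha by [].
suff -> : alpha = 0 by [].
have s0 : \sum_(beta <- Delta) beta *+ c beta = 0.
  by apply: big1_seq => beta /andP[_ /c0 /eqP ->].
by case: hc => ->; rewrite s0 ?oppr0.
Qed.

(** The exponentials of [t *: Z] are positive diagonalizable elements of the group that commute with
    the torus, so they are absorbed by it. *)
Lemma symmetric_centralizer_lie Z : g Z -> Z^T = Z -> (forall X, X \in a -> Z *m X = X *m Z) ->
  Z \in a.
Proof.
move=> gZ sZ hZ; apply/ha => t.
have [Q [z [uQ ZE]]] := symmetric_diagonalizable sZ.
have E : expmx (t *: Z) = dconj Q (map_mx (fun x => expR (t * x)) z).
  by rewrite ZE expmx_dconj //; congr dconj; apply/rowP => j; rewrite !mxE.
rewrite E; apply: (pos_tor_absorbs hG hmax hSsym hT) => // [j||s].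
- by rewrite mxE expR_gt0.
- by rewrite -E; exact: gZ.
move=> /(pos_tor_exp hmax hT uB hB ha)[X aX ->].
apply: dconj_commute => //; rewrite -ZE; apply/esym.
rewrite (split_lie_dconj hT uB hB ha aX) -[dconj _ _]scale1r expmx_dconj //.
rewrite (_ : map_mx expR _ = map_mx expR (\row_j bconj B iR X j j)); last by rewrite scale1r.
apply: dconj_commute => //; rewrite -(split_lie_dconj hT uB hB ha aX).
exact: hZ.
Qed.

Lemma root_nonneg Z (H : subvs_of a) alpha : Z \in a -> Sigma alpha -> (alpha H : R) = 1 ->
  (forall Y, g Y -> Y^T = - Y -> forall t,
     \tr (expmx (t *: Y) *m Z *m expmx (- t *: Y) *m vsval H) <= \tr (Z *m vsval H)) ->
  forall aZ : Z \in a, 0 <= (alpha (Subvs aZ) : R).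
Proof.
move=> aZ Sa a1 hmaxZ aZ'; have [_ [X [gX X0 hX]]] := Sa.
set z : R := alpha (Subvs aZ').
have symH (H' : subvs_of a) : (vsval H')^T = vsval H'.
  by apply: (split_lie_sym hSsym hT ha); apply: subvsP.
have hXt (H' : subvs_of a) : vsval H' *m X^T - X^T *m vsval H' = - ((alpha H' : R) *: X^T).
  by have := congr1 trmx (hX H'); rewrite linearB /= !trmx_mul symH linearZ /= => <-; rewrite opprB.
(* [Y] generates orthogonal matrices, and brackets with elements of [a] send it to multiples of [W].
   The second derivative in the direction [Y] is then minus [z] times the positive number
   [\tr (W *m W^T)]. *)
pose Y := X - X^T; pose W := X + X^T.
have gY : g Y.
  apply: (lieD (zeros1 hG iR) (fun A B => @zerosM _ _ _ hG _ iR A B)) => //.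
  rewrite -scaleN1r; apply: lieZ; apply: lie_tr => // A; exact: zeros_tr.
have YT : Y^T = - Y by rewrite /Y linearB /= trmxK opprB.
have WT : W^T = W by rewrite /W linearD /= trmxK addrC.
have brY (H' : subvs_of a) : vsval H' *m Y - Y *m vsval H' = (alpha H' : R) *: W.
  have E : (alpha H' : R) *: X^T = X^T *m vsval H' - vsval H' *m X^T.
    by rewrite -[LHS]opprK -hXt opprB.
  rewrite /Y /W mulmxBr mulmxBl scalerDr -hX E opprB [LHS]addrACA [RHS]addrACA.
  by congr (_ + _); rewrite addrC.
have W0 : W != 0.
  apply/eqP => WE; apply: X0.
  have XT : X^T = - X by apply/eqP; rewrite -addr_eq0 addrC -/W WE.
  have := hXt H; rewrite XT a1 scale1r mulmxN mulNmx -opprD hX a1 scale1r opprK => /eqP.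
  by rewrite eq_sym -addr_eq0 -mulr2n -scaler_nat scaler_eq0 pnatr_eq0 /= => /eqP.
have [_] := orbit_max_derivatives (hmaxZ Y gY YT).
have -> : Y *m Z - Z *m Y = - (z *: W).
  by have := brY (Subvs aZ'); rewrite /= => <-; rewrite opprB.
have -> : \tr ((Y *m (- (z *: W)) - - (z *: W) *m Y) *m vsval H) = - z * \tr (W *m W^T).
  have -> : Y *m (- (z *: W)) - - (z *: W) *m Y = (- z) *: (Y *m W - W *m Y).
    by rewrite mulmxN mulNmx -scalemxAr -scalemxAl -opprD scaleNr scalerBr.
  rewrite -scalemxAl mxtraceZ; congr (_ * _); rewrite mulmxBl linearB /= -!mulmxA.
  by rewrite mxtrace_mulC -mulmxA -linearB -mulmxBr brY a1 scale1r WT.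
by rewrite mulNr oppr_le0 pmulr_lge0 // trace_gram_gt0.
Qed.

End RealCartan.

Lemma trace_bracket (L : comNzRingType) n (Y Z H : 'M[L]_n) :
  \tr ((Y *m Z - Z *m Y) *m H) = \tr (Y *m (Z *m H - H *m Z)).
Proof.
by rewrite mulmxBl mulmxBr !linearB /= -!mulmxA [\tr (Z *m _)]mxtrace_mulC -mulmxA.
Qed.

Section RealCartanDecomposition.
Variables (n d : nat) (K : rcfType) (G S : set (mxpolynomial n K)).
Variables (phi : 'I_n -> 'I_n -> mpoly.mpoly (d + d) K) (psi : 'I_d -> mxpolynomial n K).
Hypothesis hG : alg_subgroup_SL G.
Hypothesis hGadj : forall g, geom G g -> geom G g^T.
Hypothesis hmax : maximal_split_torus G S.
Hypothesis hSsym : forall s, geom S s -> s = s^T.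
Hypothesis hT : split_by S phi psi.
Variable B : 'M[K]_n.
Hypotheses (uB : B \in unitmx) (hB : forall (L : rcfType) (i : {rmorphism K -> L}) s,
  zeros i S s -> forall a b, a != b -> (map_mx i B *m s *m map_mx i (invmx B)) a b = 0).
Variables (R : realType) (iR : {rmorphism K -> R}) (a : {vspace 'M[R]_n}).
Hypothesis ha : forall X, (X \in a) <-> lie (pos_tor S psi iR) X.
Variable Delta : seq (dual a).
Hypothesis hDelta : root_basis (root_system (lie (zeros iR G)) a) Delta.

Let BR := map_mx iR B.
Let cB := bconj B iR.
Let g := lie (zeros iR G).
Let Sigma := root_system g a.

Let uBR : BR \in unitmx. Proof. by rewrite map_unitmx. Qed.

Let split_lie_g X : X \in a -> g X.
Proof. by move=> /(split_lie_torus hT ha) hX t; exact/(torus_sub_group hmax)/hX. Qed.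

Lemma expmx_orthogonal_conj (X k : 'M[R]_n) t : k^T *m k = 1%:M ->
  expmx (t *: (k *m X *m k^T)) = k *m expmx (t *: X) *m k^T.
Proof.
move=> kk; have [_ uk] := mulmx1_unit kk.
have -> : k^T = invmx k by rewrite -[LHS](mulmxK uk) kk mul1mx.
by rewrite expmx_conj.
Qed.

Lemma real_cartan h : zeros iR G h -> exists k1 (H : subvs_of a) k2,
  [/\ zeros iR G k1, k1 *m k1^T = 1%:M, zeros iR G k2, k2 *m k2^T = 1%:M &
    (forall alpha, alpha \in Delta -> 0 <= (alpha H : R)) /\
    h = k1 *m expmx (vsval H) *m k2].
Proof.
move=> Gh; have uh := zeros_unitmx hG Gh.
have [P [e [uP e0 hE]]] := gram_diagonalizable uh.
set X := dconj P (map_mx (@ln R) e).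
have gX : g X.
  by apply: (lie_log hG uP e0); rewrite -hE; apply: zerosM => //; exact: (zeros_tr hGadj).
have expX : expmx X = h^T *m h by rewrite hE expmx_log.
have symX : X^T = X.
  by apply: dconj_sym => //; rewrite -hE trmx_mul trmxK.
have [H0 hH0] : exists H0 : subvs_of a, forall alpha, alpha \in Delta -> (alpha H0 : R) = 1.
  by apply: dual_basis_sum_point; case: hDelta.
have [k [Gk kk kmax]] := orthogonal_trace_max X (vsval H0) (zeros1 hG iR).
have kk' : k^T *m k = 1%:M by apply: mulmx1C.
have uk := zeros_unitmx hG Gk.
have kV : invmx k = k^T by rewrite -[RHS](mulmxK uk) kk' mul1mx.
pose Z := k *m X *m k^T.
have gZ : g Z.
  have := lie_conj (fun A B => @zerosM _ _ _ hG _ iR A B) uk Gk (zerosV hG Gk) gX.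
  by rewrite /mxconj kV.
have symZ : Z^T = Z by rewrite /Z trmx_mul trmxK trmx_mul symX mulmxA.
have Zmax Y : g Y -> Y^T = - Y -> forall t,
    \tr (expmx (t *: Y) *m Z *m expmx (- t *: Y) *m vsval H0) <= \tr (Z *m vsval H0).
  move=> gY YT t.
  have ET : (expmx (t *: Y))^T = expmx (- t *: Y) by rewrite expmx_tr YT scalerN scaleNr.
  have := kmax (expmx (t *: Y) *m k) (zerosM hG (gY t) Gk).
  rewrite trmx_mul ET !mulmxA -(mulmxA _ k) kk mulmx1 expmxNr => /(_ erefl).
  by rewrite /Z !mulmxA.
(* The skew-symmetric direction in which the first derivative equals [\tr (Y0 *m Y0)], that is,
   minus the squared norm of [Y0]; at a maximum it must vanish. *)
pose Y0 := Z *m vsval H0 - vsval H0 *m Z.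
have aH0 : vsval H0 \in a by apply: subvsP.
have symH0 := split_lie_sym hSsym hT ha aH0.
have Y00 : Y0 = 0.
  have Y0T : Y0^T = - Y0 by rewrite /Y0 linearB /= (trmx_mul Z) (trmx_mul _ Z) symH0 symZ opprB.
  apply/eqP; apply: contraT => /trace_gram_gt0; rewrite Y0T mulmxN linearN /= oppr_gt0.
  have [] := orbit_max_derivatives (Zmax Y0 (lie_bracket hG gZ (split_lie_g aH0)) Y0T).
  by rewrite trace_bracket -/Y0 => ->; rewrite ltxx.
have ZH0 : Z *m vsval H0 = vsval H0 *m Z by apply/eqP; rewrite -subr_eq0 -/Y0 Y00.
have aZ : Z \in a.
  apply: (symmetric_centralizer_lie hG hmax hSsym hT uB hB ha) => //.
  exact: (commute_regular hG hmax hT uB hB ha hDelta hH0).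
(* Since [Z] is conjugate to the logarithm of [h^T *m h], the torus component of [h] is the
   exponential of half of [Z]; dividing it out leaves an orthogonal factor. *)
have aZ2 : 2^-1 *: Z \in a by apply: memvZ.
pose H := Subvs aZ2; pose c := expmx (vsval H).
have Ec : c *m c = expmx Z.
  have := expmx_double (2^-1 *: Z) 1; rewrite !scale1r -scalerDl -[2^-1]mul1r.
  by rewrite -splitr scale1r mul1r.
have uc : c \in unitmx by have := expmx_unit (vsval H) 1; rewrite scale1r.
have cT : c^T = c.
  have := expmx_tr (vsval H) 1; rewrite !scale1r => ->.
  by rewrite (split_lie_sym hSsym hT ha aZ2).
have Gc : zeros iR G c.
  by have := split_lie_g aZ2 1; rewrite scale1r.
have uM : h *m k^T *m invmx c *m (c *m k) = h.
  by rewrite !mulmxA mulmxKV // -mulmxA kk' mulmx1.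
exists (h *m k^T *m invmx c), H, k; split=> //.
- apply: (zerosM hG); last exact: zerosV.
  by apply: (zerosM hG) => //; exact: (zeros_tr hGadj).
- apply: mulmx1C; rewrite !trmx_mul trmxK trmx_inv cT !mulmxA.
  rewrite -[_ *m h^T *m h]mulmxA -expX.
  rewrite -(mulmxA (invmx c) k) -(mulmxA (invmx c) (k *m _) k^T).
  have := expmx_orthogonal_conj X 1 kk'; rewrite !scale1r -/Z => <-.
  by rewrite -Ec !mulmxA mulVmx // mul1mx mulmxV.
- split; last by rewrite -mulmxA uM.
  move=> alpha hal; have [hS' _ _] := hDelta.
  have := root_nonneg hG hGadj hSsym hT ha aZ (hS' _ hal) (hH0 _ hal) Zmax aZ.
  have -> : H = 2^-1 *: Subvs aZ by apply: val_inj.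
  by move=> z0; rewrite linearZ /=; apply: mulr_ge0.
Qed.

End RealCartanDecomposition.

(** * Transfer of the Cartan decomposition and of root estimates *)

Section TransferToF.
Variables (n d : nat) (K : rcfType) (G S : set (mxpolynomial n K)).
Variables (phi : 'I_n -> 'I_n -> mpoly.mpoly (d + d) K) (psi : 'I_d -> mxpolynomial n K).
Hypothesis hG : alg_subgroup_SL G.
Hypothesis hGadj : forall g, geom G g -> geom G g^T.
Hypothesis hmax : maximal_split_torus G S.
Hypothesis hSsym : forall s, geom S s -> s = s^T.
Hypothesis hT : split_by S phi psi.
Variable B : 'M[K]_n.
Hypotheses (uB : B \in unitmx) (hB : forall (L : rcfType) (i : {rmorphism K -> L}) s,
  zeros i S s -> forall a b, a != b -> (map_mx i B *m s *m map_mx i (invmx B)) a b = 0).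
Variables (R : realType) (iR : {rmorphism K -> R}) (a : {vspace 'M[R]_n}).
Hypothesis ha : forall X, (X \in a) <-> lie (pos_tor S psi iR) X.
Variable Delta : seq (dual a).
Hypothesis hDelta : root_basis (root_system (lie (zeros iR G)) a) Delta.

Variable chi : dual a -> mxpolynomial n K.
Hypothesis hchi : root_characters iR S (root_system (lie (zeros iR G)) a) chi.

Let Sigma := root_system (lie (zeros iR G)) a.
Let v (M : Type) : void -> M. Proof. by case. Qed.

Definition eig (L : rcfType) (i : {rmorphism K -> L}) (c : 'M[L]_n) j := bconj B i c j j.

Lemma polyfam_eig (I : Type) (M : forall L : rcfType, {rmorphism K -> L} -> (I -> L) -> 'M[L]_n) j :
  polymx M -> polyfam (fun (L : rcfType) (i : {rmorphism K -> L}) x => eig i (M L i x) j).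
Proof.
move=> hM; have p : polymx (fun (L : rcfType) (i : {rmorphism K -> L}) (x : I -> L) =>
    map_mx i B *m M L i x *m map_mx i (invmx B)).
  by apply: polymx_mul; [apply: polymx_mul => //|]; exact: polymx_cst.
exact: p.
Qed.

Let DeltaSigma alpha : alpha \in Delta -> Sigma alpha.
Proof. by case: hDelta => + _ _; apply. Qed.

Lemma cartan (L : rcfType) (i : {rmorphism K -> L}) h : zeros i G h ->
  exists k1 c k2, [/\ zeros i G k1 /\ k1 *m k1^T = 1%:M, zeros i G k2 /\ k2 *m k2^T = 1%:M,
    pos_tor S psi i c, forall alpha, alpha \in Delta -> 1 <= mxeval i (chi alpha) c &
    h = k1 *m c *m k2].
Proof.
move: h; pose D (L : rcfType) (i : {rmorphism K -> L}) (x : void -> L) :=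
  forall h : 'M[L]_n, zeros i G h -> exists k1 c k2,
    (zeros i G k1 /\ k1 *m k1^T = 1%:M) /\ (zeros i G k2 /\ k2 *m k2^T = 1%:M) /\
    pos_tor S psi i c /\ (forall alpha, alpha \in Delta -> 1 <= mxeval i (chi alpha) c) /\
    h = k1 *m c *m k2.
have hD : definable D.
  apply: definable_forall_mx; apply: definable_imply.
    by apply: definable_zeros; apply: polymx_var.
  do 3!apply: definable_exists_mx.
  have orth J (M : forall L : rcfType, {rmorphism K -> L} -> (J -> L) -> 'M[L]_n) : polymx M ->
      definable (fun (L : rcfType) (i : {rmorphism K -> L}) x =>
        zeros i G (M L i x) /\ M L i x *m (M L i x)^T = 1%:M).
    move=> hM; apply: definable_and; first exact: definable_zeros.
    apply: definable_mxeq; first by apply: polymx_mul => //; exact: polymx_tr.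
    by apply: polymx_scalar; exact: polyfam1.
  apply: definable_and; first by apply: orth; apply: polymx_var.
  apply: definable_and; first by apply: orth; apply: polymx_var.
  apply: definable_and; first by apply: definable_pos_tor; apply: polymx_var.
  apply: definable_and.
    apply: definable_all => alpha _; apply: definable_le; first exact: polyfam1.
    by apply: polyfam_mxeval; apply: polymx_var.
  apply: definable_mxeq; first exact: polymx_var.
  by apply: polymx_mul; first apply: polymx_mul; apply: polymx_var.
suff h0 : D R iR (v _).
  move=> h /((definable_sentence hD iR i (v _) (v _)).1 h0)[k1 [c [k2 [h1 [h2 [h3 [h4 h5]]]]]]].
  by exists k1, c, k2.
move=> h Gh.
have [k1 [H [k2 [G1 o1 G2 o2 [Hpos ->]]]]] := real_cartan hG hGadj hmax hSsym hT uB hB ha hDelta Gh.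
exists k1, (expmx (vsval H)), k2; split=> //; split=> //; split; last split=> //.
  have aH : vsval H \in a by apply: subvsP.
  by have := (ha _).1 aH 1; rewrite scale1r.
move=> alpha hal; have [_ ->] := hchi (DeltaSigma hal).
by rewrite -[leLHS]expR0 ler_expR; exact: Hpos.
Qed.

Lemma root_character_ratio alpha : Sigma alpha -> exists j k,
  forall (L : rcfType) (i : {rmorphism K -> L}) c, pos_tor S psi i c ->
    0 < mxeval i (chi alpha) c /\ mxeval i (chi alpha) c * eig i c k = eig i c j.
Proof.
move=> Sa; have [j [k hjk]] := root_weight_ex hT uB hB ha Sa.
exists j, k => L i; pose D (L : rcfType) (i : {rmorphism K -> L}) (x : void -> L) :=
  forall c : 'M[L]_n, pos_tor S psi i c ->
    0 < mxeval i (chi alpha) c /\ mxeval i (chi alpha) c * eig i c k = eig i c j.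
have hD : definable D.
  apply: definable_forall_mx; apply: definable_imply.
    by apply: definable_pos_tor; apply: polymx_var.
  apply: definable_and.
    apply: definable_lt; first exact: polyfam0.
    by apply: polyfam_mxeval; apply: polymx_var.
  apply: definable_eq; last by apply: polyfam_eig; apply: polymx_var.
  apply: polyfam_mul; last by apply: polyfam_eig; apply: polymx_var.
  by apply: polyfam_mxeval; apply: polymx_var.
apply: (definable_sentence hD iR i (v _) (v _)).1 => c.
move=> /(pos_tor_exp hmax hT uB hB ha)[X aX ->].
have [_ /(_ (Subvs aX)) /= ->] := hchi Sa.
rewrite /eig !(split_lie_eigen hT uB hB ha) // expR_gt0; split=> //.
by rewrite hjk /= -expRD subrK.
Qed.

(** Over [R] the logarithm of a coordinate is a linear combination of the simple roots. Its real
    coefficients cannot leave [R], but an integer [N] bounding the sums of their absolute values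
    can, and it serves all fields. *)
Lemma eigen_dominated : exists N, forall (L : rcfType) (i : {rmorphism K -> L}) c u j,
  pos_tor S psi i c -> 1 <= u ->
  (forall alpha, alpha \in Delta -> mxeval i (chi alpha) c <= u /\ 1 <= u * mxeval i (chi alpha)
    c) ->
  eig i c j <= u ^+ N.
Proof.
have [q hq] : exists q : 'I_n -> dual a -> R, forall j (X : subvs_of a),
    bconj B iR (vsval X) j j = \sum_(alpha <- Delta) q j alpha * (alpha X : R).
  suff h j : exists q : dual a -> R, forall X : subvs_of a,
      bconj B iR (vsval X) j j = \sum_(alpha <- Delta) q alpha * (alpha X : R).
    by exists (fun j => projT1 (cid (h j))) => j; case: cid.
  have [|f fE] := @linear_form_ex _ _ R^o (fun X : subvs_of a => bconj B iR (vsval X) j j).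
    by move=> c X Y; rewrite linearP bconj_lin [LHS]mxE [X in X + _]mxE.
  have [_ bD _] := hDelta; have uD : uniq Delta := free_uniq (basis_free bD).
  pose q (alpha : dual a) := if insub (index alpha Delta) is Some k then coord (in_tuple Delta) k
    f else 0.
  exists q => X; have : f \in <<in_tuple Delta>>%VS by rewrite (span_basis bD) memvf.
  rewrite -fE => /coord_span {1}->; rewrite sum_lfunE (big_nth 0) big_mkord.
  apply: eq_bigr => k _; rewrite scale_lfunE /q index_uniq //.
  by rewrite valK.
have [N hN] : exists N : nat, forall j, \sum_(alpha <- Delta) `|q j alpha| <= N%:R.
  exists (\max_j Num.bound (\sum_(alpha <- Delta) `|q j alpha|)) => j.
  apply: (@le_trans _ _ (Num.bound (\sum_(alpha <- Delta) `|q j alpha|))%:R).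
    by apply/ltW/archi_boundP; apply: sumr_ge0.
  by rewrite ler_nat leq_bigmax.
exists N => L i; pose D (L : rcfType) (i : {rmorphism K -> L}) (x : void -> L) :=
  forall (c : 'M[L]_n) (u : L), pos_tor S psi i c -> 1 <= u ->
  (forall alpha, alpha \in Delta -> mxeval i (chi alpha) c <= u /\ 1 <= u * mxeval i (chi alpha)
    c) ->
  forall j, eig i c j <= u ^+ N.
have hD : definable D.
  apply: definable_forall_mx; apply: definable_forall_elt; apply: definable_imply.
    by apply: definable_pos_tor; apply: polymx_var.
  have pu : polyfam (fun (L : rcfType) (i : {rmorphism K -> L}) (x :
    ((void + 'I_n * 'I_n) + 'I_1) -> L) => x (inr ord0)).
    exact: polyfam_var.
  apply: definable_imply; first by apply: definable_le => //; exact: polyfam1.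
  have pc alpha : polyfam (fun (L : rcfType) (i : {rmorphism K -> L}) (x :
    ((void + 'I_n * 'I_n) + 'I_1) -> L) =>
      mxeval i (chi alpha) (\matrix_(a, b) (x \o inl) (inr (a, b)))).
    by apply: polyfam_mxeval; apply: (polymx_var K (fun a b => inl (inr (a, b)))).
  apply: definable_imply.
    apply: definable_all => alpha _; apply: definable_and; first exact: definable_le.
    by apply: definable_le; [exact: polyfam1 | exact: polyfam_mul].
  apply: definable_forall_fin => j; apply: definable_le; last exact: polyfam_exp.
  by apply: polyfam_eig; apply: (polymx_var K (fun a b => inl (inr (a, b)))).
suff h0 : D R iR (v _).
  by move=> c u j Ac u1 hu; exact: ((definable_sentence hD iR i (v _) (v _)).1 h0).
move=> c u Ac u1 hu j.
have [X aX cX] := pos_tor_exp hmax hT uB hB ha Ac.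
have u0 : 0 < u by apply: lt_le_trans u1.
rewrite cX /eig (split_lie_eigen hT uB hB ha) // -[u]lnK ?posrE // -expRM_natl ler_expR.
rewrite -[X]/(vsval (Subvs aX)) hq.
apply: (@le_trans _ _ (\sum_(alpha <- Delta) `|q j alpha| * ln u)); last first.
  by rewrite -mulr_suml ler_wpM2r // ln_ge0.
rewrite big_seq [leRHS]big_seq; apply: ler_sum => alpha hal.
apply: le_trans (ler_norm _) _; rewrite normrM ler_wpM2l //.
have [] := hu _ hal; rewrite cX; have [_ /(_ (Subvs aX)) /= ->] := hchi (DeltaSigma hal).
move=> h1 h2; rewrite ler_norml; apply/andP; split; last first.
  by rewrite -ler_expR lnK ?posrE.
by rewrite lerNl -ler_expR lnK ?posrE // expRN -[leLHS]mul1r ler_pdivrMr ?expR_gt0.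
Qed.

(** Over [R] two distinct coordinates differ along some one-parameter group, on which their quotient
    is an exponential and takes every positive value; [s] solves for the value [t]. The statement
    then transfers. *)
Lemma eigen_ratio_surj j k (L : rcfType) (i : {rmorphism K -> L}) c t :
  pos_tor S psi i c -> eig i c j <> eig i c k -> 0 < t ->
  exists2 b, pos_tor S psi i b & eig i b k = t * eig i b j.
Proof.
pose D (L : rcfType) (i : {rmorphism K -> L}) (x : void -> L) :=
  forall c : 'M[L]_n, pos_tor S psi i c -> ~ (eig i c j = eig i c k) -> forall t : L, 0 < t ->
  exists b : 'M[L]_n, pos_tor S psi i b /\ eig i b k = t * eig i b j.
have hD : definable D.
  apply: definable_forall_mx; apply: definable_imply.
    by apply: definable_pos_tor; apply: polymx_var.
  apply: definable_imply.
    by apply: definable_not; apply: definable_eq; apply: polyfam_eig; apply: polymx_var.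
  apply: definable_forall_elt; apply: definable_imply.
    by apply: definable_lt; [exact: polyfam0 | exact: polyfam_var].
  apply: definable_exists_mx; apply: definable_and.
    by apply: definable_pos_tor; apply: polymx_var.
  apply: definable_eq; first by apply: polyfam_eig; apply: polymx_var.
  apply: polyfam_mul; last by apply: polyfam_eig; apply: polymx_var.
  exact: polyfam_var.
suff h0 : D R iR (v _).
  move=> Ac ne t0.
  by have [b [h1 h2]] := (definable_sentence hD iR i (v _) (v _)).1 h0 c Ac ne t t0; exists b.
move=> {}c /(pos_tor_exp hmax hT uB hB ha)[X aX ->].
rewrite /eig !(split_lie_eigen hT uB hB ha) // => ne {}t t0.
have ne' : bconj B iR X k k - bconj B iR X j j != 0.
  by rewrite subr_eq0; apply/eqP => E; apply: ne; rewrite E.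
pose s := ln t / (bconj B iR X k k - bconj B iR X j j).
have asX : s *: X \in a by apply: memvZ.
exists (expmx (s *: X)); split; first by have := (ha _).1 asX 1; rewrite scale1r.
rewrite !(split_lie_eigen hT uB hB ha) // -{1}[t]lnK ?posrE // -expRD.
have E l : bconj B iR (s *: X) l l = s * bconj B iR X l l.
  by rewrite /bconj -scalemxAr -scalemxAl [LHS]mxE.
congr expR; rewrite !E -[LHS](subrK (s * bconj B iR X j j)) -mulrBr.
by rewrite /s divfK.
Qed.

(** The existence of a separating point is a sentence over [K], so if it holds over some extension
    it holds over [K]. *)
Lemma eigen_separated_base j k (L : rcfType) (i : {rmorphism K -> L}) c :
  pos_tor S psi i c -> eig i c j <> eig i c k ->
  exists2 b : 'M[K]_n, pos_tor S psi idfun b & eig idfun b j <> eig idfun b k.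
Proof.
pose D (L : rcfType) (i : {rmorphism K -> L}) (x : void -> L) :=
  exists c : 'M[L]_n, pos_tor S psi i c /\ ~ (eig i c j = eig i c k).
have hD : definable D.
  apply: definable_exists_mx; apply: definable_and.
    by apply: definable_pos_tor; apply: polymx_var.
  by apply: definable_not; apply: definable_eq; apply: polyfam_eig; apply: polymx_var.
move=> Ac ne; have h0 : D L i (v _) by exists c.
by have [b []] := (definable_sentence hD i idfun (v _) (v _)).1 h0; exists b.
Qed.

End TransferToF.

(** * The building and the apartment *)

Section ConvexSubring.
Variables (F : rcfType) (O : set F).
Hypothesis hO : order_convex_subring O.

Lemma convex_subring_sub x y : O x -> O y -> O (x - y). Proof. by case: hO => _ + _ _; apply. Qed.
Lemma convex_subringM x y : O x -> O y -> O (x * y). Proof. by case: hO => _ _ + _; apply. Qed.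
Lemma convex_subring1 : O 1. Proof. by case: hO. Qed.
Lemma convex_subring0 : O 0.
Proof. by rewrite -(subrr 1); apply: convex_subring_sub; exact: convex_subring1. Qed.
Lemma convex_subringN x : O x -> O (- x).
Proof. by rewrite -sub0r; apply: convex_subring_sub; exact: convex_subring0. Qed.
Lemma convex_subringD x y : O x -> O y -> O (x + y).
Proof. by move=> Ox Oy; rewrite -[y]opprK; apply/convex_subring_sub/convex_subringN. Qed.

Lemma convex_subring_abs x y : `|x| <= y -> O y -> O x.
Proof.
rewrite ler_norml => /andP[h1 h2] Oy; case: hO => _ _ _ /(_ (- y) y x); apply=> //.
exact: convex_subringN.
Qed.


Lemma convex_subring_sum (I : Type) (r : seq I) (P : pred I) (f : I -> F) :
  (forall k, P k -> O (f k)) -> O (\sum_(k <- r | P k) f k).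
Proof. by move=> h; elim/big_ind: _ => //; [exact: convex_subring0 | exact: convex_subringD]. Qed.

Lemma convex_subring_prod (I : Type) (r : seq I) (P : pred I) (f : I -> F) :
  (forall k, P k -> O (f k)) -> O (\prod_(k <- r | P k) f k).
Proof. by move=> h; elim/big_ind: _ => //; [exact: convex_subring1 | exact: convex_subringM]. Qed.

Lemma convex_subringX x k : O x -> O (x ^+ k).
Proof.
move=> Ox; elim: k => [|k IH]; first by rewrite expr0; exact: convex_subring1.
by rewrite exprS; exact: convex_subringM.
Qed.

Lemma convex_subring_nat k : O k%:R.
Proof.
elim: k => [|k IH]; first exact: convex_subring0.
by rewrite -addn1 natrD; apply: convex_subringD => //; exact: convex_subring1.
Qed.

Lemma convex_subring_sqr x : O (x ^+ 2) -> O x.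
Proof.
move=> Ox; apply: (convex_subring_abs (y := 1 + x ^+ 2)); last first.
  exact: convex_subringD convex_subring1 Ox.
rewrite -real_normK ?num_real //; set y := `|x|.
have [y1|y1] := leP y 1; first by rewrite (le_trans y1) // lerDl sqr_ge0.
by rewrite (@le_trans _ _ (y ^+ 2)) ?lerDr // expr2 ler_peMl // ltW // (lt_trans _ y1).
Qed.

(** The embedding in [R] bounds an element of [K] by a natural number; this bound is inherited in
    [F], and a convex subring contains the natural numbers. *)
Lemma archimedean_convex_subring (K : rcfType) (R : realType) (iR : {rmorphism K -> R})
    (iF : {rmorphism K -> F}) x : O (iF x).
Proof.
apply: (convex_subring_abs (y := (Num.bound `|iR x|)%:R)); last exact: convex_subring_nat.
have : `|iR x| < (Num.bound `|iR x|)%:R by apply: archi_boundP.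
set N := Num.bound _ => /ltW; rewrite !ler_norml => /andP[h1 h2].
rewrite -(rmorph_nat iF N) -rmorphN !ler_rcf_rmorph.
by rewrite -!(ler_rcf_rmorph iR) rmorphN rmorph_nat h1 h2.
Qed.

Lemma vl_unit x : x != 0 -> (vl O x = vl O 1) <-> ounit O x.
Proof.
have u1 : ounit O 1 by split; rewrite ?oner_neq0 ?invr1 //; exact: convex_subring1.
move=> x0; split=> [E|[_ Ox Ox']].
  have : vl O 1 x by rewrite -E; exists 1; rewrite ?mulr1.
  by move=> [u uu <-]; rewrite mul1r.
apply/seteqP; split=> y [u [u0 Ou Ou'] <-].
  exists (x * u); last by rewrite mul1r.
  by split; [exact: mulf_neq0 | exact: convex_subringM | rewrite invfM; exact: convex_subringM].
exists (x^-1 * u); last by rewrite mulVKf // mul1r.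
split; [by rewrite mulf_neq0 // invr_eq0 | exact: convex_subringM |].
by rewrite invfM invrK; exact: convex_subringM.
Qed.

Definition integral_mx m n (M : 'M[F]_(m, n)) := forall j k, O (M j k).

Lemma integral_mxM m n p (M : 'M[F]_(m, n)) (N : 'M[F]_(n, p)) :
  integral_mx M -> integral_mx N -> integral_mx (M *m N).
Proof.
move=> hM hN j k; rewrite mxE; apply: convex_subring_sum => l _.
exact: convex_subringM.
Qed.

Lemma integral_mx_det m (M : 'M[F]_m) : integral_mx M -> O (\det M).
Proof.
move=> hM; apply: convex_subring_sum => s _; apply: convex_subringM.
  by apply/convex_subringX/convex_subringN/convex_subring1.
by apply: convex_subring_prod.
Qed.

Lemma integral_mx_inv m (M : 'M[F]_m) : \det M = 1 -> integral_mx M -> integral_mx (invmx M).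
Proof.
move=> d1 hM j k; rewrite /invmx unitmxE d1 unitr1 invr1 scale1r mxE.
apply: convex_subringM; first by apply/convex_subringX/convex_subringN/convex_subring1.
by apply: integral_mx_det => p q; rewrite !mxE.
Qed.

Lemma integral_mx_orthogonal m (k : 'M[F]_m) : k *m k^T = 1%:M -> integral_mx k.
Proof.
move=> kk j l; apply: (convex_subring_abs (y := 1)); last exact: convex_subring1.
exact: orthogonal_entry.
Qed.

Lemma integral_mx_tr m n (M : 'M[F]_(m, n)) : integral_mx M -> integral_mx M^T.
Proof. by move=> hM j k; rewrite mxE. Qed.

(** The diagonal entries of [M *m M^T] are sums of squares of entries of [M], so they dominate each
    of these squares. *)
Lemma integral_mx_gram m n (M : 'M[F]_(m, n)) : integral_mx (M *m M^T) -> integral_mx M.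
Proof.
move=> h j k; apply: convex_subring_sqr; apply: convex_subring_abs (h j j).
rewrite mxE ger0_norm ?sqr_ge0 // (bigD1 k) //= mxE -expr2 lerDl.
by apply: sumr_ge0 => l _; rewrite mxE -expr2 sqr_ge0.
Qed.

End ConvexSubring.

(** * Stabilizers of the base point and of the apartment *)

Section ApartmentStabilizer.
Variables (n d : nat) (K : rcfType) (G S : set (mxpolynomial n K)).
Variables (phi : 'I_n -> 'I_n -> mpoly.mpoly (d + d) K) (psi : 'I_d -> mxpolynomial n K).
Hypothesis hG : alg_subgroup_SL G.
Hypothesis hGadj : forall g, geom G g -> geom G g^T.
Hypothesis hmax : maximal_split_torus G S.
Hypothesis hSsym : forall s, geom S s -> s = s^T.
Hypothesis hT : split_by S phi psi.
Variable B : 'M[K]_n.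
Hypotheses (uB : B \in unitmx) (hB : forall (L : rcfType) (i : {rmorphism K -> L}) s,
  zeros i S s -> forall a b, a != b -> (map_mx i B *m s *m map_mx i (invmx B)) a b = 0).
Variables (R : realType) (iR : {rmorphism K -> R}) (a : {vspace 'M[R]_n}).
Hypothesis ha : forall X, (X \in a) <-> lie (pos_tor S psi iR) X.
Variable Delta : seq (dual a).
Hypothesis hDelta : root_basis (root_system (lie (zeros iR G)) a) Delta.

Variable chi : dual a -> mxpolynomial n K.
Hypothesis hchi : root_characters iR S (root_system (lie (zeros iR G)) a) chi.
Variables (F : rcfType) (iF : {rmorphism K -> F}) (O : set F).
Hypothesis hO : order_convex_subring O.

Let Sigma := root_system (lie (zeros iR G)) a.
Let GF := zeros iF G.
Let AF := pos_tor S psi iF.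
Let BF := map_mx iF B.
Let cB := bconj B iF.
Let e := eig B iF.
Let hS : alg_subgroup_SL S. Proof. by case: hmax => -[]. Qed.

Let OmxK (M : 'M[K]_n) : integral_mx O (map_mx iF M).
Proof. by move=> j k; rewrite mxE; exact: (archimedean_convex_subring hO iR). Qed.

Let Omx_conj M : integral_mx O M -> integral_mx O (cB M).
Proof.
move=> hM; rewrite /cB /bconj.
by apply: (integral_mxM hO) => //; exact: (integral_mxM hO).
Qed.

Let A_S c : AF c -> zeros iF S c. Proof. by case. Qed.
Let A_G c : AF c -> GF c. Proof. by move=> /A_S/(torus_sub_group hmax). Qed.
Let A_sym c : AF c -> c^T = c. Proof. by move=> /A_S/(zeros_torus_sym hSsym). Qed.
Let A_unit c : AF c -> c \in unitmx. Proof. by move=> /A_S/(zeros_unitmx hS). Qed.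
Let A_comm c c' : AF c -> AF c' -> c *m c' = c' *m c.
Proof. by move=> /A_S + /A_S; exact: (zeros_torus_comm hmax hSsym). Qed.
Let AM c c' : AF c -> AF c' -> AF (c *m c'). Proof. exact: (pos_torM hmax hT). Qed.
Let AV c : AF c -> AF (invmx c). Proof. exact: (pos_torV hmax hT). Qed.
Let A1 : AF 1%:M. Proof. exact: (pos_tor1 hmax hT). Qed.
Let e_gt0 c j : AF c -> 0 < e c j. Proof. exact: (pos_tor_eigen_gt0 hmax hT uB hB). Qed.
Let eM c c' j : AF c -> AF c' -> e (c *m c') j = e c j * e c' j.
Proof. by move=> /A_S + /A_S; exact: (torus_eigenM uB hB). Qed.
Let e1 j : e 1%:M j = 1. Proof. by rewrite /e /eig bconj1 // mxE eqxx. Qed.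
Let eV c j : AF c -> e (invmx c) j = (e c j)^-1.
Proof.
move=> Ac; apply: (mulfI (lt0r_neq0 (e_gt0 j Ac))).
by rewrite -(eM _ Ac (AV Ac)) mulmxV ?A_unit // e1 mulfV // gt_eqF ?e_gt0.
Qed.
Let Adconj c : AF c -> c = dconj BF (\row_j e c j).
Proof. by move=> /A_S; exact: (bconj_torus uB hB). Qed.

Let G1 : GF 1%:M. Proof. exact: zeros1. Qed.
Let GM g h : GF g -> GF h -> GF (g *m h). Proof. exact: zerosM. Qed.
Let GV g : GF g -> GF (invmx g). Proof. exact: zerosV. Qed.
Let GT g : GF g -> GF g^T. Proof. exact: (zeros_tr hGadj). Qed.
Let Gunit g : GF g -> g \in unitmx. Proof. exact: (zeros_unitmx hG). Qed.
Let Gdet g : GF g -> \det g = 1. Proof. exact: (det_zeros hG). Qed.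
Let KFE k : KF GF k <-> GF k /\ k *m k^T = 1%:M.
Proof. by split=> [[Gk []]|[Gk kk]]; do !split=> //; exact: Gdet. Qed.

Let dominant c alpha := Num.max (mxeval iF (chi alpha) c) (mxeval iF (chi alpha) c)^-1.

Lemma integral_mx_of_eigen c : AF c -> (forall j, O (e c j)) -> integral_mx O c.
Proof.
move=> Ac hc; rewrite (Adconj Ac) /dconj -map_invmx.
apply: (integral_mxM hO); last exact: OmxK.
apply: (integral_mxM hO); first exact: OmxK.
by move=> j k; rewrite mxE; case: eqP => _; rewrite ?mxE ?mulr0n ?mulr1n //; exact: convex_subring0.
Qed.

Lemma chi_gt0 c alpha : AF c -> Sigma alpha -> 0 < mxeval iF (chi alpha) c.
Proof.
by move=> Ac /(root_character_ratio hmax hT uB hB ha hchi)[j [k /(_ _ _ _ Ac)[]]].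
Qed.

Let dominant_ge1 c alpha : AF c -> Sigma alpha -> 1 <= dominant c alpha.
Proof.
move=> Ac Sa; have := chi_gt0 Ac Sa; rewrite /dominant; set x := mxeval _ _ _ => x0.
have [x1|x1] := leP 1 x; first by rewrite le_max x1.
by rewrite le_max orbC invf_ge1 // ltW.
Qed.

Let mnormE c : mnorm iF Sigma chi c = \prod_(alpha <- finmap.enum_fset (fset_set Sigma)) dominant
  c alpha.
Proof. by rewrite /mnorm fsbig_finite //; exact: (root_system_finite G hT uB hB ha). Qed.

Let mem_Sigma alpha : (alpha \in finmap.enum_fset (fset_set Sigma)) <-> Sigma alpha.
Proof.
have fS : finite_set Sigma by exact: (root_system_finite G hT uB hB ha).
by rewrite (in_fset_set fS) inE.
Qed.

Let mnorm_ge1 c : AF c -> 1 <= mnorm iF Sigma chi c.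
Proof.
move=> Ac; rewrite mnormE big_seq; elim/big_rec: _ => // alpha x /mem_Sigma Sa x1.
by rewrite -[1]mulr1 ler_pM // dominant_ge1.
Qed.

(* The coordinates of an element of the split torus are bounded by powers of the values of
   the simple roots; conversely roots are quotients of coordinates. *)
Lemma integral_mx_mnorm c : AF c -> ounit O (mnorm iF Sigma chi c)^-1 <-> integral_mx O (c *m c).
Proof.
move=> Ac; have m0 : 0 < mnorm iF Sigma chi c by apply: lt_le_trans (mnorm_ge1 Ac).
split=> [[_ _]|hcc].
  rewrite invrK => Om.
  suff : integral_mx O c by move=> hc; exact: (integral_mxM hO).
  apply: integral_mx_of_eigen => // j.
  have hd alpha : Sigma alpha -> dominant c alpha <= mnorm iF Sigma chi c.
    move=> Sa; have /mem_Sigma Sa' := Sa; rewrite mnormE (big_rem alpha Sa') /=.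
    rewrite ler_peMr ?(le_trans ler01) ?dominant_ge1 //.
    rewrite big_seq; elim/big_rec: _ => // beta x /mem_rem/mem_Sigma Sb x1.
    by rewrite -[1]mulr1 ler_pM // dominant_ge1.
  have [N hN] := eigen_dominated hmax hT uB hB ha hDelta hchi.
  apply: (convex_subring_abs hO (y := mnorm iF Sigma chi c ^+ N)); last exact: convex_subringX.
  rewrite gtr0_norm ?e_gt0 //; apply: hN => //; first exact: mnorm_ge1.
  move=> alpha hal; have Sa : Sigma alpha by case: hDelta => + _ _; apply.
  have := hd _ Sa; rewrite ge_max => /andP[h1 h2]; split=> //.
  by rewrite -ler_pdivrMr ?chi_gt0 // mul1r.
have eO c' j : AF c' -> integral_mx O (c' *m c') -> O (e c' j).
  move=> Ac' h; apply: (convex_subring_sqr hO); rewrite expr2 -eM //.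
  exact: Omx_conj.
have Oe j : O (e c j) by exact: eO.
(* Determinant 1 makes the inverse of [c *m c] integral too, so the coordinates of [c] are units of
   [O], and so are their quotients, the characters. *)
have OeV j : O (e (invmx c) j).
  apply: eO; first exact: AV.
  have : integral_mx O (invmx (c *m c)) by apply: integral_mx_inv => //;
    rewrite det_mulmx !Gdet ?mulr1 //; exact: A_G.
  suff -> : invmx (c *m c) = invmx c *m invmx c by [].
  have uc := A_unit Ac; have ucc : c *m c \in unitmx by rewrite unitmx_mul uc.
  by rewrite -[RHS](mulKmx ucc) -!mulmxA (mulKVmx uc) mulmxV // mulmx1.
have Od alpha : Sigma alpha -> O (dominant c alpha).
  move=> Sa; have [j [k /(_ _ _ _ Ac)[x0 xE]]] := root_character_ratio hmax hT uB hB ha hchi Sa.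
  rewrite /dominant; move: x0 xE; set x := mxeval _ _ _ => x0 xE.
  have xE' : x = e c j * e (invmx c) k.
    by rewrite eV // /e -xE mulfK // gt_eqF // -/(e _ _) e_gt0.
  have Ox : O x by rewrite xE'; exact: convex_subringM.
  have Ox' : O x^-1.
    rewrite xE' invfM eV // invrK -eV //; exact: convex_subringM.
  by rewrite /Num.max; case: ifP.
split; first by rewrite invr_eq0 gt_eqF.
  apply: (convex_subring_abs hO (y := 1)); last exact: convex_subring1.
  by rewrite gtr0_norm ?invr_gt0 // invf_le1 // mnorm_ge1.
rewrite invrK mnormE big_seq; apply: (convex_subring_prod hO) => alpha /mem_Sigma.
exact: Od.
Qed.

Lemma act_comp g h x : act (g *m h) x = act g (act h x) :> 'M[F]_n.
Proof. by rewrite /act trmx_mul !mulmxA. Qed.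

(** If [c] is the Cartan component of a point [y], then [y] is the conjugate of [c *m c] by an
    orthogonal matrix, and orthogonal matrices are integral. Distance zero from the identity
    therefore means integral entries. *)
Lemma base_ptE : base_pt iF O GF AF Sigma Delta chi = [set y | XX GF y /\ integral_mx O y].
Proof.
have AE (c u v y : 'M[F]_n) : AF c -> u *m v = 1%:M -> y = u *m (c *m c) *m v ->
    integral_mx O u -> integral_mx O v -> integral_mx O (c *m c) <-> integral_mx O y.
  move=> Ac uv -> Ou Ov; split=> h; first by do 2?apply: (integral_mxM hO).
  have vu := mulmx1C uv.
  rewrite (_ : c *m c = v *m (u *m (c *m c) *m v) *m u); first by do 2?apply: (integral_mxM hO).
  by rewrite !mulmxA vu mul1mx -mulmxA vu mulmx1.
suff key y : XX GF y -> (dist iF O GF AF Sigma Delta chi 1%:M y = vl O 1) <-> integral_mx O y.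
  by apply/seteqP; split=> y [Xy h]; split=> //; apply/key.
move=> [h Gh hy]; rewrite /dist /negv; set c := delta _ _ _ _ _ _ _.
(* The Cartan decomposition guarantees that the choice in [delta] is made from a nonempty set. Any
   such choice leads to the same conclusion, so uniqueness does not enter. *)
have : exists c, chamber iF AF Delta chi c /\ exists g h, [/\ GF g, GF h,
    1%:M = act g 1%:M, y = act h 1%:M &
    exists k1 k2, [/\ KF GF k1, KF GF k2 & invmx g *m h = k1 *m c *m k2]].
  have [k1 [c' [k2 [[G1' o1] [G2' o2] Ac' hc' hE]]]] :=
    cartan hG hGadj hmax hSsym hT uB hB ha hDelta hchi Gh.
  exists c'; split; first by split.
  exists 1%:M, h; split=> //; first by rewrite /act mulmx1 mul1mx trmx1.
  by exists k1, k2; rewrite invmx1 mul1mx; split=> //; apply/KFE.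
move=> /(xgetPex 1%:M); rewrite -/(delta iF GF AF Delta chi 1%:M y) -/c.
move=> [[Ac _] [g [h' [Gg Gh' gE yE [k1 [k2 [/KFE[Gk1 o1] /KFE[Gk2 o2] cE]]]]]]].
have m0 : 0 < mnorm iF Sigma chi c by apply: lt_le_trans (mnorm_ge1 Ac).
rewrite vl_unit ?invr_eq0 ?gt_eqF // integral_mx_mnorm //.
have gg : g *m g^T = 1%:M by rewrite [RHS]gE /act mulmx1.
pose u := g *m k1.
have uu : u *m u^T = 1%:M by rewrite /u trmx_mul -!mulmxA (mulmxA k1) o1 mul1mx.
apply: (AE c u u^T) => //.
- have -> : y = h' *m h'^T by rewrite yE /act mulmx1.
  have -> : h' = u *m c *m k2 by rewrite -[h'](mulKVmx (Gunit Gg)) cE /u !mulmxA.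
  rewrite !trmx_mul (A_sym Ac) /u !mulmxA -[_ *m k2 *m _]mulmxA o2 mulmx1.
  by [].
- exact: integral_mx_orthogonal.
- by apply: integral_mx_tr; exact: integral_mx_orthogonal.
Qed.

Let B0 := [set y | XX GF y /\ integral_mx O y].

Lemma bact_comp g h (p : set 'M[F]_n) : bact (g *m h) p = bact g (bact h p).
Proof.
apply/seteqP; split=> y.
  by move=> [x px <-]; exists (act h x); rewrite ?act_comp //; exists x.
by move=> [_ [x px <-] <-]; exists x; rewrite ?act_comp.
Qed.

Lemma bact1 (p : set 'M[F]_n) : bact 1%:M p = p.
Proof.
have E (x : 'M[F]_n) : act 1%:M x = x by rewrite /act trmx1 mulmx1 mul1mx.
by apply/seteqP; split=> y; [move=> [x px <-] | move=> py; exists y]; rewrite ?E.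
Qed.

(** If [g] fixes the base point then [g *m g^T], the image of the identity, is integral, hence so is
    [g]. Conversely the inverse of an integral [g] is integral, as the determinant is 1. *)
Lemma base_fixed g : GF g -> bact g B0 = B0 <-> integral_mx O g.
Proof.
move=> Gg; have sub h : GF h -> integral_mx O h -> bact h B0 `<=` B0.
  move=> Gh Oh _ [x [[h' Gh' <-] Ox] <-]; split.
    by exists (h *m h'); [exact: GM | rewrite act_comp].
  by rewrite /act; do 2?apply: (integral_mxM hO) => //; exact: integral_mx_tr.
split=> [E|Og].
  have [_] : B0 (act g 1%:M).
    rewrite -E; exists 1%:M => //; split.
      by exists 1%:M => //; rewrite /act mulmx1 mul1mx trmx1.
    by move=> j k; rewrite mxE; exact: convex_subring_nat.
  by rewrite /act mulmx1; exact: integral_mx_gram.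
apply/seteqP; split; first exact: sub.
have Og' : integral_mx O (invmx g) by apply: integral_mx_inv => //; exact: Gdet.
rewrite -[B0 in X in X `<=` _]bact1 -(mulmxV (Gunit Gg)) bact_comp.
by move=> _ [x hx <-]; exists x => //; apply: (sub (invmx g)) hx => //; exact: GV.
Qed.

Let apt := apartment iF O GF AF Sigma Delta chi.

Let aptE : apt = [set bact b B0 | b in AF].
Proof. by rewrite /apt /apartment base_ptE. Qed.

Let stab := stab_apartment iF O GF AF Sigma Delta chi.

Lemma stabV g : stab g -> stab (invmx g).
Proof.
move=> [Gg E]; split; first exact: GV.
have K' p : bact (invmx g) (bact g p) = p by rewrite -bact_comp mulVmx ?bact1 ?Gunit.
rewrite -/apt in E *; apply/seteqP; split=> [_ [p ap <-]|p ap].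
  by move: ap; rewrite -{1}E => -[p' ap' <-]; rewrite K'.
by exists (bact g p); rewrite ?K' // -E; exists p.
Qed.

Lemma fixes_apartment h : GF h ->
  (forall b, AF b -> bact h (bact b B0) = bact b B0) <->
  (forall b, AF b -> integral_mx O (invmx b *m h *m b)).
Proof.
move=> Gh; have G' b : AF b -> GF (invmx b *m h *m b).
  by move=> Ab; apply: GM; [apply: GM => //; apply: GV|]; exact: A_G.
split=> E b Ab; first apply/(base_fixed (G' b Ab)).
  by rewrite !bact_comp E // -bact_comp mulVmx ?bact1 ?A_unit.
have /(base_fixed (G' b Ab)) := E b Ab.
rewrite !bact_comp => E'.
by rewrite -[LHS]bact1 -(mulmxV (A_unit Ab)) [LHS]bact_comp E'.
Qed.

Lemma torus_mulmxl c M j k : AF c -> cB (c *m M) j k = e c j * cB M j k.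
Proof.
move=> Ac; rewrite /cB bconjM // [LHS]mxE (bigD1 j) //= big1 ?addr0 // => l lj.
by rewrite [X in X * _](hB (A_S Ac)) ?mul0r // eq_sym.
Qed.

Lemma torus_mulmxr c M j k : AF c -> cB (M *m c) j k = cB M j k * e c k.
Proof.
move=> Ac; rewrite /cB bconjM // [LHS]mxE (bigD1 k) //= big1 ?addr0 // => l lk.
by rewrite [X in _ * X](hB (A_S Ac)) ?mulr0.
Qed.

Hypothesis hOproper : O <> setT.

(** If a nonzero entry of [h] joins two distinct coordinates, some [b] scales it so that the entry
    of [invmx b *m h *m b] has the absolute value of a chosen [w] outside [O]; this contradicts
    integrality. *)
Lemma fixator_centralizes h : (forall b, AF b -> integral_mx O (invmx b *m h *m b)) ->
  forall c, AF c -> h *m c = c *m h.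
Proof.
move=> hh c Ac; apply: (@bconj_inj _ _ _ uB _ iF); apply/matrixP => j k.
rewrite -!/cB (torus_mulmxl _ _ _ Ac) (torus_mulmxr _ _ _ Ac).
have [->|nz] := eqVneq (cB h j k) 0; first by rewrite mul0r mulr0.
have [->|ne] := pselect (e c j = e c k); first exact: mulrC.
have [w nw] : exists w, ~ O w.
  by apply: contrapT => /forallNP H; apply: hOproper; apply/seteqP; split=> // x _; exact: contrapT.
have w0 : w != 0 by apply: contra_notN nw => /eqP ->; exact: convex_subring0.
have t0 : 0 < `|w| / `|cB h j k| by rewrite divr_gt0 ?normr_gt0.
have [b Ab Eb] := eigen_ratio_surj hmax hT uB hB ha Ac ne t0.
case: nw; have : O (cB (invmx b *m h *m b) j k) by apply: Omx_conj; exact: hh.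
rewrite torus_mulmxr // torus_mulmxl ?eV //; last exact: AV.
move=> Ow; apply: (convex_subring_abs hO (y := `|(e b j)^-1 * cB h j k * e b k|)); last first.
  by case: (ger0P ((e b j)^-1 * cB h j k * e b k)) => // _; exact: (convex_subringN hO).
have eb0 : `|e b j| != 0 by rewrite normr_eq0 gt_eqF ?e_gt0.
have h0 : `|cB h j k| != 0 by rewrite normr_eq0.
rewrite [e b k]Eb -/(e b j) !normrM !normfV !normr_id [_ * `|e b j|]mulrC mulrACA.
by rewrite mulVf // mul1r mulrC divfK.
Qed.

Lemma rational_torus b : pos_tor S psi idfun b -> AF (map_mx iF b).
Proof.
have E p : mxeval iF p (map_mx iF b) = iF (mxeval idfun p b) by apply: mxeval_map.
move=> [Sb pb]; split=> [p Sp|j]; rewrite E; first by rewrite Sb // rmorph0.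
by rewrite -(rmorph0 iF) ltr_rcf_rmorph.
Qed.

Lemma eig_map b j : e (map_mx iF b) j = iF (eig B idfun b j).
Proof.
have E : bconj B iF (map_mx iF b) = map_mx iF (bconj B idfun b).
  rewrite /bconj !map_mxM; congr (_ *m _ *m _); by apply/matrixP => p q; rewrite !mxE.
by rewrite /e /eig E mxE.
Qed.

(** Coordinates that differ somewhere on the torus over [F] already differ at a [K]-point, so a
    nonzero entry of [M] can only join coordinates that agree on the whole torus. *)
Lemma commute_rational_torus M :
  (forall b, pos_tor S psi idfun b -> M *m map_mx iF b = map_mx iF b *m M) ->
  forall c, AF c -> M *m c = c *m M.
Proof.
move=> hM c Ac; apply: (@bconj_inj _ _ _ uB _ iF); apply/matrixP => j k.
rewrite -!/cB (torus_mulmxl _ _ _ Ac) (torus_mulmxr _ _ _ Ac).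
have [->|nz] := eqVneq (cB M j k) 0; first by rewrite mul0r mulr0.
have [->|ne] := pselect (e c j = e c k); first exact: mulrC.
have [b Ab Eb] := eigen_separated_base Ac ne; case: Eb.
have Ab' := rational_torus Ab.
have := congr1 (fun M => cB M j k) (hM b Ab).
rewrite (torus_mulmxl _ _ _ Ab') (torus_mulmxr _ _ _ Ab') [RHS]mulrC => /(mulfI nz).
by rewrite !eig_map => /(fmorph_inj iF).
Qed.

Lemma positive_commutes_torus Q (x : 'rV[F]_n) : Q \in unitmx -> (forall j, 0 < x 0 j) ->
  GF (dconj Q x) -> (forall c, AF c -> dconj Q x *m c = c *m dconj Q x) -> AF (dconj Q x).
Proof.
move=> uQ x0 Gx hx; apply: (pos_tor_absorbs hG hmax hSsym hT) => // s As.
by rewrite hx.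
Qed.

Lemma stab_conjugates g c : stab g -> AF c -> AF (invmx g *m c *m g).
Proof.
move=> [Gg]; rewrite -/apt => E Ac; have ug := Gunit Gg.
have cdj : invmx g *m c *m g = dconj (BF *m g) (\row_j e c j).
  rewrite {1}(Adconj Ac) /dconj !mulmxA; congr (_ *m _ *m _ *m _).
  have uBF : BF \in unitmx by rewrite map_unitmx.
  have ubg : BF *m g \in unitmx by rewrite unitmx_mul uBF.
  apply: (can_inj (mulmxK ubg)); rewrite mulVmx //.
  by rewrite -mulmxA (mulmxA (invmx BF)) mulVmx // mul1mx mulVmx.
have GC : GF (invmx g *m c *m g) by apply: GM => //; apply: GM; [exact: GV | exact: A_G].
rewrite cdj; apply: positive_commutes_torus; rewrite -?cdj //.
- by rewrite unitmx_mul map_unitmx uB.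
- by move=> j; rewrite mxE e_gt0.
(* Commutation of [invmx g *m c *m g] with [b] is the commutation of [c] with the conjugate of [b]
   by [g]. The matrix [b] is integral and commutes with the torus, so it fixes the apartment
   pointwise, and so does its conjugate. *)
apply: commute_rational_torus => b Kb; have Ab := rational_torus Kb.
have Gh : GF (g *m map_mx iF b *m invmx g) by apply: GM; [apply: GM => //; exact: A_G | exact: GV].
have fixb : forall b', AF b' -> bact (map_mx iF b) (bact b' B0) = bact b' B0.
  apply/(fixes_apartment (A_G Ab)) => b' Ab'.
  by rewrite -mulmxA (A_comm Ab Ab') mulKmx ?A_unit.
have fixh : forall b', AF b' -> integral_mx O (invmx b' *m (g *m map_mx iF b *m invmx g) *m b').
  apply/(fixes_apartment Gh) => b' Ab'.
  have : apt (bact b' B0) by rewrite aptE; exists b'.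
  rewrite -{1}E aptE => -[_ [b2 Ab2 <-] <-].
  by rewrite !bact_comp -(bact_comp (invmx g) g) mulVmx // bact1 fixb.
have := fixator_centralizes fixh Ac => Eq.
have := congr1 (fun M => invmx g *m M *m g) Eq.
by rewrite !mulmxA mulVmx // mul1mx mulmxKV.
Qed.

Lemma stab_normalizes g : stab g -> mxnormalizer GF AF g.
Proof.
move=> sg; have [Gg _] := sg; have ug := Gunit Gg; split=> //.
apply/seteqP; split=> [_ [c Ac <-]|c Ac].
  by have := stab_conjugates (stabV sg) Ac; rewrite invmxK.
exists (invmx g *m c *m g); first exact: stab_conjugates.
by rewrite /mxconj !mulmxA mulmxV // mul1mx mulmxK.
Qed.

(** The square root is a multiplicative function of positive numbers, so the root of [g^T *m g]
    satisfies the equations of the group and the polar decomposition stays inside it. *)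
Lemma group_polar g : GF g -> exists k P (x : 'rV[F]_n) p,
  [/\ KF GF k, P \in unitmx /\ p = dconj P x, (forall j, 0 < x 0 j), GF p &
    p^T = p /\ g = k *m p].
Proof.
move=> Gg; have ug := Gunit Gg; have [P [x [uP x0 gE]]] := gram_diagonalizable ug.
set y := map_mx Num.sqrt x; have y0 j : 0 < y 0 j by rewrite mxE sqrtr_gt0.
have Gp : GF (dconj P y).
  apply: zeros_generalized_power => // [k|u w u0 w0|]; last exact: sqrtr1.
    rewrite -dconj_exp //; elim: k => [|k IH] //=.
    by apply: GM => //; rewrite -gE; apply: GM => //; exact: GT.
  by rewrite sqrtrM // ltW.
have sp : (dconj P y)^T = dconj P y by apply: dconj_sym => //; rewrite -gE trmx_mul trmxK.
have pp : dconj P y *m dconj P y = g^T *m g.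
  rewrite gE dconjM //; congr dconj; apply/rowP => j; rewrite !mxE.
  by rewrite -expr2 sqr_sqrtr // ltW.
have [p pE] : exists p, p = dconj P y by eexists.
rewrite -pE in Gp sp pp.
have up := Gunit Gp; exists (g *m invmx p), P, y, p; split=> //; last first.
  by split=> //; rewrite mulmxKV.
apply/KFE; split; first by apply: GM => //; exact: GV.
apply: mulmx1C; rewrite trmx_mul trmx_inv sp !mulmxA -(mulmxA (invmx _) g^T) -pp.
by rewrite !mulmxA mulVmx // mul1mx mulmxV.
Qed.

Lemma normalizer_conj H g c : mxnormalizer H AF g -> AF c -> AF (mxconj g c).
Proof. by move=> [_ E] Ac; rewrite -[X in X _]E; exists c. Qed.

Lemma orthogonal_inv (k : 'M[F]_n) : k *m k^T = 1%:M -> invmx k = k^T.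
Proof.
move=> kk; have [uk _] := mulmx1_unit kk.
by rewrite -[LHS]mulmx1 -kk mulKmx.
Qed.

Lemma normalizer_polar :
  mxnormalizer GF AF = [set x *m k | x in AF & k in mxnormalizer (KF GF) AF].
Proof.
have torus_conj x c : AF x -> AF c -> mxconj x c = c.
  by move=> Ax Ac; rewrite /mxconj (A_comm Ax Ac) mulmxK ?A_unit.
have conjM x k c : x \in unitmx -> k \in unitmx -> mxconj (x *m k) c = mxconj x (mxconj k c).
  move=> ux uk; rewrite /mxconj !mulmxA -[RHS]mulmxA; congr (_ *m _).
  have uxk : x *m k \in unitmx by rewrite unitmx_mul ux.
  apply: (can_inj (mulmxK uxk)); rewrite mulVmx //.
  by rewrite -mulmxA (mulmxA (invmx x)) mulVmx // mul1mx mulVmx.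
apply/seteqP; split=> [g ng|_ [x Ax [k [[Gk okk] E] <-]]]; last first.
  split; first by apply: GM => //; exact: A_G.
  have uk := Gunit Gk; have ux := A_unit Ax.
  rewrite -[RHS]E; apply: eq_imagel => c Ac; rewrite conjM // torus_conj //.
  by rewrite -E; exists c.
have [Gg E] := ng; have [k [P [x [p [Kk [uP pE] x0 Gp [sp gE]]]]]] := group_polar Gg.
have [Gk kk] := (KFE k).1 Kk.
have up := Gunit Gp; have uk := Gunit Gk.
have gconj c : mxconj g c = mxconj k (mxconj p c) by rewrite gE conjM.
have Ap : AF p.
  rewrite pE; apply: positive_commutes_torus; rewrite -?pE // => c Ac.
  have Ac' := normalizer_conj ng Ac.
  have Epc : mxconj p c = k^T *m mxconj g c *m k.
    rewrite gconj {2}/mxconj (orthogonal_inv kk) !mulmxA (mulmx1C kk) mul1mx.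
    by rewrite -mulmxA (mulmx1C kk) mulmx1.
  have sym : (mxconj p c)^T = mxconj p c.
    rewrite Epc; move: (A_sym Ac'); move: (mxconj g c) => M sM.
    by rewrite !trmx_mul trmxK sM mulmxA.
  (* Symmetry of the conjugate of [c] by [p] says exactly that the square of [p] commutes with [c];
     [p] is a function of its square, so it commutes with [c] as well. *)
  have ppc : c *m dconj P (\row_j (x 0 j * x 0 j)) = dconj P (\row_j (x 0 j * x 0 j)) *m c.
    rewrite -dconjM // -pE; move: sym; rewrite /mxconj !trmx_mul trmx_inv sp (A_sym Ac).
    move=> /(congr1 (fun M => p *m M *m p)).
    by rewrite !mulmxA mulmxV // mul1mx mulmxKV.
  have -> : p = dconj P (map_mx Num.sqrt (\row_j (x 0 j * x 0 j))).
    by rewrite pE; congr dconj; apply/rowP => j; rewrite !mxE -expr2 sqrtr_sqr gtr0_norm //.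
  by apply/esym/dconj_commute.
have nk : mxnormalizer (KF GF) AF k.
  split=> //; rewrite -[RHS]E; apply: eq_imagel => c Ac.
  by rewrite gconj (torus_conj p c Ap Ac).
(* The product [k *m p] is reordered as [mxconj k p *m k], which puts the torus factor on the
   left. *)
exists (mxconj k p); first exact: normalizer_conj nk Ap.
exists k => //; by rewrite /mxconj mulmxKV.
Qed.

(** For the inclusion of the normalizer, write [g = x *m k]: the orthogonal factor [k] fixes the
    base point, so [g] sends the translate by [b] to the translate by [x *m mxconj k b], which is
    again a point of the apartment. *)
Lemma stab_apartment_normalizer : stab = mxnormalizer GF AF.
Proof.
apply/seteqP; split=> g; first exact: stab_normalizes.
move=> ng; have [Gg Eg] := ng; split=> //; rewrite -/apt.
have : mxnormalizer GF AF g by [].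
rewrite {1}normalizer_polar => -[x Ax [k [Gk nk] gE]].
have Ok : integral_mx O k by exact: (integral_mx_orthogonal hO ((KFE k).1 Gk).2).
have [Gk' kk] := (KFE k).1 Gk.
have kB : bact k B0 = B0 by apply/base_fixed.
have uk := Gunit Gk'; have ux := A_unit Ax.
have act_apt b : bact g (bact b B0) = bact (x *m mxconj k b) B0.
  rewrite -gE -{2}kB -!bact_comp; congr bact.
  by rewrite /mxconj !mulmxA mulmxKV.
rewrite aptE; apply/seteqP; split=> [_ [_ [b Ab <-] <-]|_ [b Ab <-]].
  exists (x *m mxconj k b); last by rewrite act_apt.
  by apply: AM => //; rewrite -[AF]nk; exists b.
have : AF (invmx x *m b) by apply: AM => //; exact: AV.
rewrite -[X in X _]nk => -[b' Ab' Eb']; exists (bact b' B0); first by exists b'.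
by rewrite act_apt Eb' mulKVmx.
Qed.

End ApartmentStabilizer.

Theorem proposition5p52
  (K F : rcfType) (R : realType)
  (iR : {rmorphism K -> R}) (iF : {rmorphism K -> F})
  (O : set F) (hO : order_convex_subring O) (hOproper : O <> setT)
  (n : nat) (G S : set (mxpolynomial n K))
  (hG : alg_subgroup_SL G)
  (hGconn : zconnected (geom G))
  (hGss : semisimple (geom G))
  (hGadj : forall g, geom G g -> geom G g^T)
  (hS : maximal_split_torus G S)
  (hSsym : forall s, geom S s -> s = s^T)
  (A : sadesc n K)
  (hA : sa_component (zeros idfun S) 1%:M (saext idfun A))
  (a : {vspace 'M[R]_n})
  (ha : forall X, (X \in a) <-> lie (saext iR A) X)
  (Sigma := root_system (lie (zeros iR G)) a)
  (chi : dual a -> mxpolynomial n K)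
  (hchi : root_characters iR S Sigma chi)
  (Delta : seq (dual a)) (hDelta : root_basis Sigma Delta)
  (hred : reduced Sigma)
  (GF := zeros iF G) (AF := saext iF A) (NF := mxnormalizer (KF GF) AF) :
  stab_apartment iF O GF AF Sigma Delta chi = mxnormalizer GF AF /\
  mxnormalizer GF AF = [set x *m k | x in AF & k in NF].
Proof.
have [[hST [d [phi [psi hT]]]] _ _] := hS.
have AE := saext_pos_tor hST hT iR hA.
have ha' X : (X \in a) <-> lie (pos_tor S psi iR) X by rewrite ha AE.
have [B uB hB] := torus_diagonalizable hS hSsym.
rewrite {}/NF {}/AF {}/GF AE; split.
  exact: (stab_apartment_normalizer hG hGadj hS hSsym hT uB hB ha' hDelta hchi iF hO hOproper).
exact: (normalizer_polar hG hGadj hS hSsym hT iF).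
Qed.
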